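(* Let $n\ge 2$ and let $\mu$ be a positive Borel measure on $\mathbb{R}^n$ satisfying the growth condition $$\int_{\mathbb{R}^n}\prod_{\ell=1}^n\frac{1}{1+t_\ell^2}\,d\mu(t)<\infty .$$ Then $\mu$ is a Nevanlinna measure if and only if its distributional Fourier transform $\widehat{\mu}$ satisfies $$\operatorname{supp}(\widehat\mu)\subset [0,\infty)^n\cup(-\infty,0]^n .$$
   Context: A positive Borel measure $\mu$ on $\mathbb{R}^n$ is called a Nevanlinna measure if it satisfies the growth condition $\int_{\mathbb{R}^n}\prod_{\ell=1}^n\frac{1}{1+t_\ell^2}\,d\mu(t)<\infty$ and the Nevanlinna condition $$\int_{\mathbb{R}^n}\frac{1}{(t_{j_1}-z_{j_1})^2(t_{j_2}-\overline{z_{j_2}})^2}\prod_{\ell\ne j_1,j_2}\Big(\frac{1}{t_\ell-z_\ell}-\frac{1}{t_\ell-\overline{z_\ell}}\Big)d\mu(t)=0$$ for all $z\in(\mathbb{C}^+)^n$ and all indices $1\le j_1<j_2\le n$, where $\mathbb{C}^+=\{z\in\mathbb{C}:\operatorname{Im} z>0\}$ (equivalently, $\mu$ satisfies the growth condition and its Poisson integral $z\mapsto\int_{\mathbb{R}^n}\prod_{j=1}^n\frac{\operatorname{Im} z_j}{|z_j-t_j|^2}d\mu(t)$ is pluriharmonic on $(\mathbb{C}^+)^n$). A measure satisfying the growth condition defines a tempered (Schwartz) distribution, and $\widehat\mu$ denotes its Fourier transform in the sense of tempered distributions, with the convention $\widehat f(\xi)=\int_{\mathbb{R}^n}f(x)e^{-i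 x\cdot\xi}\,dx$ for $f\in L^1(\mathbb{R}^n)$. *)

(* Defs.v *)
From HB Require Import structures.
From mathcomp Require Import all_boot all_order all_algebra.
From mathcomp Require Import all_classical all_reals all_analysis.
From mathcomp Require Import complex.

Set Implicit Arguments.
Unset Strict Implicit.
Unset Printing Implicit Defensive.

Import Order.TTheory GRing.Theory Num.Theory.
Import numFieldNormedType.Exports.

Local Open Scope classical_set_scope.
Local Open Scope ring_scope.
Local Open Scope complex_scope.

(* Matrices over R, in particular R^n := 'rV[R]_n, carry the Borel
   sigma-algebra of their topology. *)
HB.instance Definition _ (R : realType) (m n : nat) :=
  @isMeasurable.Build (sigma_display (open : set (set 'M[R]_(m, n))))
    'M[R]_(m, n) <<s (open : set (set 'M[R]_(m, n))) >>
    (@sigma_algebra0 _ setT _) (@sigma_algebraC _ _)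
    (@sigma_algebra_bigcup _ setT _).

Lemma open_measurable_mx (R : realType) m n (U : set 'M[R]_(m, n)) :
  open U -> measurable U.
Proof. exact: sub_sigma_algebra. Qed.

Lemma measurable_coord (R : realType) m n (i : 'I_m) (j : 'I_n) :
  measurable_fun [set: 'M[R]_(m, n)] (fun M : 'M[R]_(m, n) => M i j).
Proof.
apply: (measurability _ (measurable_realfun.RGenOpens.measurableE R)).
move=> _ [_ [a [b ->]] <-].
rewrite setTI; apply: open_measurable_mx.
by apply: open_comp; [move=> + _; exact: coord_continuous|exact: interval_open].
Qed.

Definition mx_rat_box (R : realType) m n (qk : 'M[rat]_(m, n) * nat) :
    set 'M[R]_(m, n) :=
  [set M | forall i j, `|ratr (qk.1 i j) - M i j| < qk.2.+1%:R^-1].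

Lemma open_mx_ratE (R : realType) m n (U : set 'M[R]_(m, n)) : open U ->
  U = \bigcup_(qk in [set qk | @mx_rat_box R m n qk `<=` U]) mx_rat_box qk.
Proof.
move=> oU; apply/seteqP; split=> [M UM|M [qk /= + +]]; last exact.
have /nbhs_ballP[e /= e0 eU] : nbhs M U by exact: open_nbhs_nbhs.
have [k ke] : exists k : nat, k.+1%:R^-1 < e / 2.
  have /ltr_add_invr[k] : 0 < e / 2 by rewrite divr_gt0.
  by rewrite add0r => ?; exists k.
have k0 : (0 : R) < k.+1%:R^-1 by rewrite invr_gt0.
have /choice[q qM] : forall ij : 'I_m * 'I_n, exists q : rat,
    `|ratr q - M ij.1 ij.2| < k.+1%:R^-1.
  move=> [i j] /=.
  have /rat_in_itvoo[q] : M i j - k.+1%:R^-1 < M i j + k.+1%:R^-1.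
    by rewrite ltrBlDr -addrA ltrDl addr_gt0.
  by rewrite in_itv/= => qM; exists q; rewrite ltr_distl.
exists (\matrix_(i, j) q (i, j), k) => [N /= qN|i j/=]; last first.
  by rewrite mxE; exact: (qM (i, j)).
apply: eU; split=> // i j; rewrite /ball/=.
have /= := qN i j; rewrite mxE => qNij.
rewrite (splitr e) -(subrKA (ratr (q (i, j)))).
apply: (le_lt_trans (ler_normD _ _)); rewrite ltrD//.
  by rewrite distrC (lt_trans (qM (i, j))).
by rewrite (lt_trans qNij).
Qed.

Lemma measurable_fun_mxP d (T : measurableType d) (R : realType) m n
    (f : T -> 'M[R]_(m, n)) :
  measurable_fun setT f <->
  forall i j, measurable_fun setT (fun x => f x i j).
Proof.
split=> [mf i j|mf].
  exact: (measurableT_comp (@measurable_coord R m n i j)).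
apply: (@measurability _ _ _ _ _ _ (open : set (set 'M[R]_(m, n)))) => //.
move=> _ [U oU <-]; rewrite setTI (open_mx_ratE oU) preimage_bigcup.
rewrite bigcup_mkcond; apply: countable_bigcupT_measurable => // qk.
case: ifPn => // _.
rewrite (_ : _ @^-1` _ = \bigcap_(ij in [set: 'I_m * 'I_n])
    (fun x => f x ij.1 ij.2) @^-1` ball (ratr (qk.1 ij.1 ij.2) : R) qk.2.+1%:R^-1).
  apply: fin_bigcap_measurable => //.
  move=> -[i j] _ /=; rewrite -[X in measurable X]setTI; apply: mf => //.
  exact: measurable_realfun.measurable_ball.
by apply/seteqP; split=> x /= h => [[i j] _|i j]; [exact: h|exact: (h (i, j))].
Qed.

Definition cons_rV (R : realType) (n : nat) (p : R * 'rV[R]_n) :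
  'rV[R]_n.+1 := row_mx p.1%:M p.2.

Definition uncons_rV (R : realType) (n : nat) (v : 'rV[R]_n.+1) :
  R * 'rV[R]_n := (v 0 0, rsubmx (v : 'rV_(1 + n))).

Lemma cons_rV0 (R : realType) n (p : R * 'rV[R]_n) : cons_rV p 0 0 = p.1.
Proof.
have -> : 0 = lshift n 0 :> 'I_(1 + n) by exact: val_inj.
by apply: etrans (row_mxEl _ _ _ _) _; rewrite mxE eqxx mulr1n.
Qed.

Lemma cons_rVK (R : realType) n : cancel (@cons_rV R n) (@uncons_rV R n).
Proof.
by move=> p; rewrite /uncons_rV cons_rV0 /cons_rV row_mxKr -surjective_pairing.
Qed.

Lemma cons_rVS (R : realType) n (p : R * 'rV[R]_n) (i : 'I_n) :
  cons_rV p 0 (lift 0 i) = p.2 0 i.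
Proof.
have -> : lift 0 i = rshift 1 i :> 'I_(1 + n) by exact: val_inj.
exact: row_mxEr.
Qed.

Lemma measurable_cons_rV (R : realType) n : measurable_fun setT (@cons_rV R n).
Proof.
apply/measurable_fun_mxP => i j; rewrite (ord1 i).
case: (unliftP 0 j) => [k ->|->].
- under eq_fun do rewrite cons_rVS.
  exact: (measurableT_comp (@measurable_coord R 1 n 0 k) measurable_snd).
- by under eq_fun do rewrite cons_rV0; exact: measurable_fst.
Qed.

Lemma measurable_uncons_rV (R : realType) n :
  measurable_fun setT (@uncons_rV R n).
Proof.
apply: measurable_fun_pair; first exact: measurable_coord.
apply/measurable_fun_mxP => i j; under eq_fun do rewrite mxE.
exact: measurable_coord.
Qed.

(* The image on R^(n+1) of the product of the Lebesgue measure of R with m. *)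
Definition lebesgue_rVS (R : realType) (n : nat)
    (m : {sigma_finite_measure set 'rV[R]_n -> \bar R}) :
    set 'rV[R]_n.+1 -> \bar R :=
  pushforward (@lebesgue_measure R \x m)%E (@cons_rV R n).

Section lebesgue_rVS.
Context (R : realType) (n : nat).
Variable m : {sigma_finite_measure set 'rV[R]_n -> \bar R}.

Let mcons : measurable_fun [set: measurableTypeR R * 'rV[R]_n] (@cons_rV R n) :=
  @measurable_cons_rV R n.

Let rVS0 : lebesgue_rVS m set0 = 0%E.
Proof. by rewrite /lebesgue_rVS /pushforward preimage_set0 measure0. Qed.

Let rVS_ge0 A : (0 <= lebesgue_rVS m A)%E.
Proof. exact: measure_ge0. Qed.

Let rVS_sigma_additive : semi_sigma_additive (lebesgue_rVS m).
Proof. exact: measure_semi_sigma_additive. Qed.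

HB.instance Definition _ := isMeasure.Build _ _ _ (lebesgue_rVS m)
  rVS0 rVS_ge0 rVS_sigma_additive.

Let rVS_sigma_finite : sigma_finite setT (lebesgue_rVS m).
Proof.
have /sigma_finiteP[F [TF ndF Foo]] := sigma_finiteT (@lebesgue_measure R).
have /sigma_finiteP[G [TG ndG Goo]] := sigma_finiteT m.
exists (fun k => @uncons_rV R n @^-1` (F k `*` G k)) => [|k].
  rewrite -preimage_bigcup -[LHS](preimage_setT (@uncons_rV R n)).
  congr (_ @^-1` _); apply/seteqP; split=> // -[x v] _.
  have [k _ Fkx] : (\bigcup_i F i) x by rewrite -TF.
  have [l _ Glv] : (\bigcup_i G i) v by rewrite -TG.
  exists (maxn k l) => //; split => /=.
    by move: x Fkx; exact/subsetPset/ndF/leq_maxl.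
  by move: v Glv; exact/subsetPset/ndG/leq_maxr.
have [mF Fk] := Foo k; have [mG Gk] := Goo k.
have mFG : measurable (F k `*` G k) by exact: measurableX.
split; first by rewrite -[X in measurable X]setTI; exact: measurable_uncons_rV.
rewrite /lebesgue_rVS /pushforward -comp_preimage.
rewrite (_ : _ \o _ = id); last by apply/funext => p; exact: cons_rVK.
by rewrite preimage_id product_measure1E// lte_mul_pinfty// ge0_fin_numE.
Qed.

HB.instance Definition _ := @Measure_isSigmaFinite.Build _ _ _
  (lebesgue_rVS m) rVS_sigma_finite.

End lebesgue_rVS.

Fixpoint lebesgue_rV (R : realType) (n : nat) :
    {sigma_finite_measure set 'rV[R]_n -> \bar R} :=
  match n with
  | 0 => \d_(0 : 'rV[R]_0)
  | n'.+1 => lebesgue_rVS (lebesgue_rV R n')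
  end.

Lemma lebesgue_rV_box (R : realType) (n : nat) (A : 'I_n -> set R) :
  (forall i, measurable (A i)) ->
  lebesgue_rV R n [set v | forall i, A i (v 0 i)] =
  (\prod_(i < n) @lebesgue_measure R (A i))%E.
Proof.
elim: n A => [|n IHn] A mA.
  by rewrite big_ord0 /= diracE mem_set// => -[].
rewrite big_ord_recl -(IHn (fun i => A (lift 0 i)))// -product_measure1E//.
  rewrite /= /lebesgue_rVS /pushforward; congr (product_measure1 _ _ _).
  apply/seteqP; split=> [p /= Ap|p /= [Ap0 ApS] i].
    split; first by have := Ap 0; rewrite cons_rV0.
    by move=> i; have := Ap (lift 0 i); rewrite cons_rVS.
  by case: (unliftP 0 i) => [k ->|->]; rewrite ?cons_rVS ?cons_rV0.
- exact: mA.
rewrite (_ : (fun _ => _) = \bigcap_(i in [set: 'I_n])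
    (fun v : 'rV[R]_n => v 0 i) @^-1` A (lift 0 i)); last first.
  by apply/seteqP; split=> v /= h i => [_|]; exact: h.
apply: fin_bigcap_measurable => // i _.
by rewrite -[X in measurable X]setTI; apply: measurable_coord.
Qed.

Definition cintegral d (T : measurableType d) (R : realType)
    (mu : {measure set T -> \bar R}) (f : T -> R[i]) : R[i] :=
  (\int[mu]_t complex.Re (f t)) +i* (\int[mu]_t complex.Im (f t)).

Definition growth_condition (R : realType) (n : nat)
    (mu : {measure set 'rV[R]_n -> \bar R}) : Prop :=
  (\int[mu]_t (\prod_(l < n) (1 + t 0 l ^+ 2)^-1)%:E < +oo)%E.

Definition nevanlinna_kernel (R : realType) (n : nat) (z : 'rV[R[i]]_n)
    (j1 j2 : 'I_n) (t : 'rV[R]_n) : R[i] :=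
  (((t 0 j1)%:C - z 0 j1) ^+ 2 * ((t 0 j2)%:C - (z 0 j2)^*) ^+ 2)^-1 *
  \prod_(l < n | (l != j1) && (l != j2))
    (((t 0 l)%:C - z 0 l)^-1 - ((t 0 l)%:C - (z 0 l)^*)^-1).

Definition nevanlinna_condition (R : realType) (n : nat)
    (mu : {measure set 'rV[R]_n -> \bar R}) : Prop :=
  forall z : 'rV[R[i]]_n, (forall l, 0 < complex.Im (z 0 l)) ->
  forall j1 j2 : 'I_n, (j1 < j2)%N ->
    cintegral mu (nevanlinna_kernel z j1 j2) = 0.

Definition nevanlinna_measure (R : realType) (n : nat)
    (mu : {measure set 'rV[R]_n -> \bar R}) : Prop :=
  growth_condition mu /\ nevanlinna_condition mu.

Definition partial_deriv (R : realType) (n : nat) (s : seq 'I_n)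
    (f : 'rV[R]_n -> R) : 'rV[R]_n -> R :=
  foldr (fun i g => 'D_(delta_mx 0 i) g) f s.

Definition smooth (R : realType) (n : nat) (f : 'rV[R]_n -> R) : Prop :=
  forall s : seq 'I_n, continuous (partial_deriv s f) /\
    forall i x, derivable (partial_deriv s f) x (delta_mx 0 i).

Definition fsupport (R : realType) (n : nat) (phi : 'rV[R]_n -> R[i]) :
    set 'rV[R]_n :=
  closure [set x | phi x != 0].

(* C_c^oo(R^n; C); smoothness is required of both components because R[i] is
   not a normed module over R in the library. *)
Definition test_function (R : realType) (n : nat) (phi : 'rV[R]_n -> R[i]) :
    Prop :=
  [/\ smooth (fun x => complex.Re (phi x)),
      smooth (fun x => complex.Im (phi x)) & compact (fsupport phi)].

Definition dot (R : realType) (n : nat) (x y : 'rV[R]_n) : R :=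
  \sum_(i < n) x 0 i * y 0 i.

Definition cexpi (R : realType) (a : R) : R[i] := cos a +i* sin a.

Definition fourier (R : realType) (n : nat) (f : 'rV[R]_n -> R[i]) :
    'rV[R]_n -> R[i] :=
  fun xi => cintegral (lebesgue_rV R n) (fun x => f x * cexpi (- dot x xi)).

(* A tempered distribution is represented by its action on functions; only its
   values on Schwartz functions are meaningful. *)
Definition functional (R : realType) (n : nat) := ('rV[R]_n -> R[i]) -> R[i].

Definition measure_distribution (R : realType) (n : nat)
    (mu : {measure set 'rV[R]_n -> \bar R}) : functional R n :=
  fun phi => cintegral mu phi.

Definition fourier_distribution (R : realType) (n : nat)
    (T : functional R n) : functional R n :=
  fun phi => T (fourier phi).

(* The complement of the union of the open sets U such that T vanishes on the
   test functions supported in U. *)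
Definition distribution_support (R : realType) (n : nat)
    (T : functional R n) : set 'rV[R]_n :=
  ~` \bigcup_(U in [set U | open U /\
        forall phi, test_function phi -> fsupport phi `<=` U -> T phi = 0]) U.

(* Main.v *)
(** Write [Q_{j1 j2}] for the open set of the [s] with [s_j1 > 0 > s_j2]; the
complement of the two closed octants is the union of these sets.

From Nevanlinna to the support: in one variable, if a functional vanishes on the
squares [1/(t-z)^2], [Im z > 0], then it vanishes on the products of at least two
distinct factors [1/(1+ist)], [s > 0], by the resolvent identity; choosing factors
whose parameters tend to [0] and have a fixed sum, it vanishes on
[exp(-ist) / ((1+iet)(1+2iet))] for all [s, e > 0]. Doing this one coordinate at a
time (with Poisson kernels for the coordinates other than [j1], [j2]) yields
integrable regularizers [reg_e] with [|reg_e| <= 1], [reg_e -> 1], such that the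
Fourier transform of [reg_e mu] vanishes on [Q_{j1 j2}]. Let [e -> 0].

Conversely, if the Fourier transform of [mu] vanishes on [Q_{j1 j2}], mollify:
if [h] is the normalized Fourier transform of a bump function supported in a small
cube inside [Q_{j1 j2}], then the transform of [h mu] vanishes on the closed set
[s_j1 >= 0 >= s_j2]. This property is stable under multiplication by [1/(t_l-z)],
[l <> j2], and by [1/(t_l-conj z)], [l <> j1], since these kernels are limits of
geometric series of exponentials. Hence the integral of [h] times the Nevanlinna
kernel is [0]; shrink the cube to the origin, so that [h -> 1]. *)
Require Import Defs.
From HB Require Import structures.
From mathcomp Require Import all_boot all_order all_algebra.
From mathcomp Require Import all_classical all_reals all_analysis.
From mathcomp Require Import measurable_realfun complex ring lra.

Set Implicit Arguments.
Unset Strict Implicit.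
Unset Printing Implicit Defensive.

Import Order.TTheory GRing.Theory Num.Theory.
Import numFieldNormedType.Exports.
Import Normc.

Local Open Scope classical_set_scope.
Local Open Scope ring_scope.
Local Open Scope complex_scope.

(** * Complex-valued measurable and integrable functions *)

(** [mu] may have infinite mass, so its transform has no value at a point and plane waves are not
    integrable against it. Everything is therefore done for [h mu] with [h] integrable: products of
    resolvents in one direction, transforms of bump functions in the other. The growth condition
    provides the weight 1/(1+x^2) per coordinate and no more, so a single factor 1/(1+isx) is out of
    reach, and resolvent identities may shorten a product only down to two factors. Distinct
    parameters permit division by their difference; the hypothesis gives the confluent case of equal
    parameters, and a subdivision leads from it to distinct ones. In the coordinates other than j1,
    j2 the hypothesis concerns Poisson kernels; annihilating these is stronger than annihilating the
    squares and does not restrict the sign of s. The support is defined by open sets given near each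
    point, so local vanishing has to be glued; mollification and Fubini do this, and Fubini uses the
    sigma-finiteness that growth provides. *)

Section complex_modulus.
Context {R : realType}.
Implicit Types x y z : R[i].

Lemma ReD x y : complex.Re (x + y) = complex.Re x + complex.Re y.
Proof. by case: x y => a b [c d]. Qed.

Lemma ImD x y : complex.Im (x + y) = complex.Im x + complex.Im y.
Proof. by case: x y => a b [c d]. Qed.

Lemma ReN x : complex.Re (- x) = - complex.Re x.
Proof. by case: x. Qed.

Lemma ImN x : complex.Im (- x) = - complex.Im x.
Proof. by case: x. Qed.

Lemma ReM x y : complex.Re (x * y) =
  complex.Re x * complex.Re y - complex.Im x * complex.Im y.
Proof. by case: x y => a b [c d]. Qed.

Lemma ImM x y : complex.Im (x * y) =
  complex.Re x * complex.Im y + complex.Im x * complex.Re y.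
Proof. by case: x y => a b [c d]. Qed.

Lemma ReV x : complex.Re x^-1 =
  complex.Re x * (complex.Re x ^+ 2 + complex.Im x ^+ 2)^-1.
Proof. by case: x. Qed.

Lemma ImV x : complex.Im x^-1 =
  - (complex.Im x * (complex.Re x ^+ 2 + complex.Im x ^+ 2)^-1).
Proof. by case: x. Qed.

Lemma Re_conjc x : complex.Re (conjc x) = complex.Re x.
Proof. by case: x. Qed.

Lemma Im_conjc x : complex.Im (conjc x) = - complex.Im x.
Proof. by case: x. Qed.

Lemma complex_ext x y : complex.Re x = complex.Re y ->
  complex.Im x = complex.Im y -> x = y.
Proof. by case: x y => a b [c d] /= -> ->. Qed.

Lemma conjcD x y : conjc (x + y) = conjc x + conjc y.
Proof. by apply: complex_ext; rewrite ?(Re_conjc, Im_conjc, ReD, ImD) ?opprD. Qed.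

Lemma conjcN x : conjc (- x) = - conjc x.
Proof. by apply: complex_ext; rewrite ?(Re_conjc, Im_conjc, ReN, ImN). Qed.

Lemma conjcM x y : conjc (x * y) = conjc x * conjc y.
Proof.
apply: complex_ext; rewrite ?(Re_conjc, Im_conjc, ReM, ImM) ?mulrNN//.
by rewrite mulrN mulNr opprD.
Qed.

Lemma normc_ge0 x : 0 <= normc x.
Proof. by case: x => a b; exact: sqrtr_ge0. Qed.

Lemma normcB x y : normc (x - y) <= normc x + normc y.
Proof. by rewrite -[normc y]normcN le_normcD. Qed.

Lemma normcX x n : normc (x ^+ n) = normc x ^+ n.
Proof.
by elim: n => [|n IHn]; rewrite ?expr0 ?normc1// !exprS normcM IHn.
Qed.

Lemma normc_real (a : R) : normc a%:C = `|a|.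
Proof. by rewrite /normc /= expr0n /= addr0 sqrtr_sqr. Qed.

Lemma normc_conj x : normc (conjc x) = normc x.
Proof. by case: x => a b /=; rewrite sqrrN. Qed.

Lemma normc_eq0 x : (normc x == 0) = (x == 0).
Proof.
by apply/eqP/eqP => [/eq0_normc//|->]; rewrite normc0.
Qed.

Lemma normc_gt0 x : (0 < normc x) = (x != 0).
Proof. by rewrite lt_def normc_ge0 andbT normc_eq0. Qed.

Lemma sqr_normcE x : normc x ^+ 2 = complex.Re x ^+ 2 + complex.Im x ^+ 2.
Proof. by case: x => a b /=; rewrite sqr_sqrtr// addr_ge0// sqr_ge0. Qed.

Lemma ler_normRe x : `|complex.Re x| <= normc x.
Proof.
by case: x => a b /=; rewrite -sqrtr_sqr ler_sqrt ?lerDl ?addr_ge0 ?sqr_ge0.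
Qed.

Lemma ler_normIm x : `|complex.Im x| <= normc x.
Proof.
by case: x => a b /=; rewrite -sqrtr_sqr ler_sqrt ?lerDr ?addr_ge0 ?sqr_ge0.
Qed.

Lemma ler_normc_ReIm x : normc x <= `|complex.Re x| + `|complex.Im x|.
Proof.
rewrite -(@ler_pXn2r _ 2) ?nnegrE ?normc_ge0 ?addr_ge0//.
rewrite sqr_normcE sqrrD !real_normK ?num_real//.
by rewrite addrAC lerDl mulrn_wge0 ?mulr_ge0.
Qed.

Lemma normc_prod (I : Type) (s : seq I) (P : pred I) (F : I -> R[i]) :
  normc (\prod_(i <- s | P i) F i) = \prod_(i <- s | P i) normc (F i).
Proof.
by elim/big_rec2: _ => [|i x y _ <-]; rewrite ?normc1// normcM.
Qed.

Lemma ler_normc_sum (I : Type) (s : seq I) (P : pred I) (F : I -> R[i]) :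
  normc (\sum_(i <- s | P i) F i) <= \sum_(i <- s | P i) normc (F i).
Proof.
elim/big_rec2: _ => [|i y x _ xy]; first by rewrite normc0.
by rewrite (le_trans (le_normcD _ _))// lerD2l.
Qed.

Lemma normc_prod_le1 (I : Type) (s : seq I) (P : pred I) (F : I -> R[i]) :
  (forall i, P i -> normc (F i) <= 1) ->
  normc (\prod_(i <- s | P i) F i) <= 1.
Proof.
move=> F1; rewrite normc_prod; apply: prodr_ile1 => i Pi.
by rewrite normc_ge0 F1.
Qed.

(** Telescoping: factors are exchanged one at a time, while the others, of modulus at most 1, do not
    enlarge the difference. *)
Lemma normc_prodB (I : Type) (s : seq I) (F G : I -> R[i]) :
  (forall i, normc (F i) <= 1) -> (forall i, normc (G i) <= 1) ->
  normc (\prod_(i <- s) F i - \prod_(i <- s) G i) <=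
    \sum_(i <- s) normc (F i - G i).
Proof.
move=> F1 G1; elim: s => [|i s IHs].
  by rewrite !big_nil subrr normc0.
rewrite !big_cons.
set f := \prod_(j <- s) F j; set g := \prod_(j <- s) G j.
rewrite (_ : F i * f - G i * g = (F i - G i) * f + G i * (f - g)); last by ring.
rewrite (le_trans (le_normcD _ _))// lerD// normcM.
  by rewrite ler_piMr ?normc_ge0// normc_prod_le1.
by rewrite (le_trans _ IHs)// ler_piMl ?normc_ge0.
Qed.

End complex_modulus.

Section cmeasurable.
Context d (T : measurableType d) (R : realType).
Implicit Types f g : T -> R[i].

Definition cmeasurable f :=
  measurable_fun setT (@complex.Re R \o f) /\ measurable_fun setT (@complex.Im R \o f).

Lemma cmeasurable_cst (c : R[i]) : cmeasurable (fun=> c).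
Proof. by split; exact: measurable_cst. Qed.

Lemma cmeasurable_real (f : T -> R) : measurable_fun setT f ->
  cmeasurable (fun t => (f t)%:C).
Proof. by move=> mf; split => //; exact: measurable_cst. Qed.

Lemma cmeasurable_complex (f g : T -> R) : measurable_fun setT f ->
  measurable_fun setT g -> cmeasurable (fun t => f t +i* g t).
Proof. by []. Qed.

Lemma cmeasurableD f g : cmeasurable f -> cmeasurable g ->
  cmeasurable (fun t => f t + g t).
Proof.
move=> [f1 f2] [g1 g2]; split.
  by rewrite (_ : _ \o _ = (@complex.Re R \o f) \+ (@complex.Re R \o g));
    [exact: measurable_funD|apply/funext => t /=; rewrite ReD].
by rewrite (_ : _ \o _ = (@complex.Im R \o f) \+ (@complex.Im R \o g));
  [exact: measurable_funD|apply/funext => t /=; rewrite ImD].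
Qed.

Lemma cmeasurableN f : cmeasurable f -> cmeasurable (fun t => - f t).
Proof.
move=> [f1 f2]; split.
  by rewrite (_ : _ \o _ = \- (@complex.Re R \o f));
    [exact: measurable_funN|apply/funext => t /=; rewrite ReN].
by rewrite (_ : _ \o _ = \- (@complex.Im R \o f));
  [exact: measurable_funN|apply/funext => t /=; rewrite ImN].
Qed.

Lemma cmeasurableB f g : cmeasurable f -> cmeasurable g ->
  cmeasurable (fun t => f t - g t).
Proof. by move=> mf mg; apply: cmeasurableD => //; exact: cmeasurableN. Qed.

Lemma cmeasurableM f g : cmeasurable f -> cmeasurable g ->
  cmeasurable (fun t => f t * g t).
Proof.
move=> [f1 f2] [g1 g2]; split.
  rewrite (_ : _ \o _ = (@complex.Re R \o f) \* (@complex.Re R \o g) \-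
      (@complex.Im R \o f) \* (@complex.Im R \o g)).
    by apply: measurable_funB; exact: measurable_funM.
  by apply/funext => t /=; rewrite ReM.
rewrite (_ : _ \o _ = (@complex.Re R \o f) \* (@complex.Im R \o g) \+
    (@complex.Im R \o f) \* (@complex.Re R \o g)).
  by apply: measurable_funD; exact: measurable_funM.
by apply/funext => t /=; rewrite ImM.
Qed.

Lemma cmeasurable_conj f : cmeasurable f -> cmeasurable (fun t => conjc (f t)).
Proof.
move=> [f1 f2]; split.
  by rewrite (_ : _ \o _ = @complex.Re R \o f)//; apply/funext => t /=; rewrite Re_conjc.
rewrite (_ : _ \o _ = \- (@complex.Im R \o f)); first exact: measurable_funN.
by apply/funext => t /=; rewrite Im_conjc.
Qed.

Lemma measurable_invr : measurable_fun [set: R] (@GRing.inv R).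
Proof.
(* These continuous quotients tend to [x^-1] everywhere, including at 0, where both sides are 0
   because [0^-1 = 0]. *)
pose h k (x : R) := x / (x ^+ 2 + k.+1%:R^-1).
have pos k (x : R) : 0 < x ^+ 2 + k.+1%:R^-1.
  by rewrite ltr_wpDl ?sqr_ge0// invr_gt0.
apply: (@measurable_fun_cvg _ _ _ _ h) => [k|x _].
  apply: continuous_measurable_fun => x.
  apply: cvgM => //; apply: cvgV; first by rewrite gt_eqF.
  by apply: cvgD; [exact: exprn_continuous|exact: cvg_cst].
have [->|x0] := eqVneq x 0.
  by rewrite /h invr0; under eq_fun do rewrite mul0r; exact: cvg_cst.
rewrite (_ : x^-1 = x * (x ^+ 2 + 0)^-1); last by field.
apply: cvgM; first exact: cvg_cst.
apply: cvgV; first by rewrite addr0 expf_neq0.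
apply: cvgD; first exact: cvg_cst.
exact: cvg_harmonic.
Qed.

Lemma cmeasurableV f : cmeasurable f -> cmeasurable (fun t => (f t)^-1).
Proof.
move=> [f1 f2].
have m2 : measurable_fun setT
    (fun t => (complex.Re (f t) ^+ 2 + complex.Im (f t) ^+ 2)^-1).
  apply: (measurableT_comp measurable_invr).
  by apply: measurable_funD; exact: measurable_funX.
split.
  rewrite (_ : _ \o _ = fun t =>
    complex.Re (f t) * (complex.Re (f t) ^+ 2 + complex.Im (f t) ^+ 2)^-1).
    exact: measurable_funM.
  by apply/funext => t /=; rewrite ReV.
rewrite (_ : _ \o _ = fun t =>
  - (complex.Im (f t) * (complex.Re (f t) ^+ 2 + complex.Im (f t) ^+ 2)^-1)).
  by apply: measurable_funN; exact: measurable_funM.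
by apply/funext => t /=; rewrite ImV.
Qed.

Lemma cmeasurableX f n : cmeasurable f -> cmeasurable (fun t => f t ^+ n).
Proof.
move=> mf; elim: n => [|n IHn].
  by under eq_fun do rewrite expr0; exact: cmeasurable_cst.
by under eq_fun do rewrite exprS; exact: cmeasurableM.
Qed.

Lemma cmeasurable_prod (I : Type) (s : seq I) (P : pred I) (F : I -> T -> R[i]) :
  (forall i, P i -> cmeasurable (F i)) ->
  cmeasurable (fun t => \prod_(i <- s | P i) F i t).
Proof.
move=> mF; elim: s => [|i s IHs].
  by under eq_fun do rewrite big_nil; exact: cmeasurable_cst.
have [Pi|/negbTE nPi] := boolP (P i); last by under eq_fun do rewrite big_cons nPi.
by under eq_fun do rewrite big_cons Pi; apply: cmeasurableM => //; exact: mF.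
Qed.

Lemma cmeasurable_sum (I : Type) (s : seq I) (P : pred I) (F : I -> T -> R[i]) :
  (forall i, P i -> cmeasurable (F i)) ->
  cmeasurable (fun t => \sum_(i <- s | P i) F i t).
Proof.
move=> mF; elim: s => [|i s IHs].
  by under eq_fun do rewrite big_nil; exact: cmeasurable_cst.
have [Pi|/negbTE nPi] := boolP (P i); last by under eq_fun do rewrite big_cons nPi.
by under eq_fun do rewrite big_cons Pi; apply: cmeasurableD => //; exact: mF.
Qed.

Lemma cmeasurable_cexpi (f : T -> R) : measurable_fun setT f ->
  cmeasurable (fun t => cexpi (f t)).
Proof.
move=> mf; split; apply: measurableT_comp => //; apply: continuous_measurable_fun.
  exact: continuous_cos.
exact: continuous_sin.
Qed.

Lemma measurable_normc f : cmeasurable f -> measurable_fun setT (fun t => normc (f t)).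
Proof.
move=> [f1 f2].
rewrite (_ : (fun t => normc (f t)) =
  fun t => Num.sqrt (complex.Re (f t) ^+ 2 + complex.Im (f t) ^+ 2)).
  apply: (@measurableT_comp _ _ _ _ _ _ (@Num.sqrt R)).
    apply: continuous_measurable_fun; exact: sqrt_continuous.
  by apply: measurable_funD; exact: measurable_funX.
by apply/funext => t; case: (f t).
Qed.

End cmeasurable.

Lemma cmeasurable_comp d1 d2 (T1 : measurableType d1) (T2 : measurableType d2)
    (R : realType) (g : T2 -> R[i]) (h : T1 -> T2) :
  cmeasurable g -> measurable_fun setT h -> cmeasurable (fun t => g (h t)).
Proof.
by move=> [g1 g2] mh; split;
  [exact: (measurableT_comp g1 mh)|exact: (measurableT_comp g2 mh)].
Qed.

Section cintegral.
Context d (T : measurableType d) (R : realType) (mu : {measure set T -> \bar R}).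
Implicit Types f g : T -> R[i].

Definition cintegrable f :=
  cmeasurable f /\ mu.-integrable setT (fun t => (normc (f t))%:E).

Lemma cintegrable_le f (g : T -> R) : cmeasurable f ->
  mu.-integrable setT (EFin \o g) -> (forall t, normc (f t) <= g t) ->
  cintegrable f.
Proof.
move=> mf ig fg; split => //.
apply: le_integrable ig => //; first exact/measurable_EFinP/measurable_normc.
move=> t _ /=; rewrite lee_fin ger0_norm ?normc_ge0//.
by rewrite (le_trans (fg t))// ler_norm.
Qed.

Lemma cintegrable_Re f : cintegrable f ->
  mu.-integrable setT (fun t => (complex.Re (f t))%:E).
Proof.
move=> [[f1 f2]]; apply: le_integrable => //; first exact/measurable_EFinP.
move=> t _ /=; rewrite lee_fin [leRHS]ger0_norm ?normc_ge0//.
exact: ler_normRe.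
Qed.

Lemma cintegrable_Im f : cintegrable f ->
  mu.-integrable setT (fun t => (complex.Im (f t))%:E).
Proof.
move=> [[f1 f2]]; apply: le_integrable => //; first exact/measurable_EFinP.
move=> t _ /=; rewrite lee_fin [leRHS]ger0_norm ?normc_ge0//.
exact: ler_normIm.
Qed.

Lemma cintegrableD f g : cintegrable f -> cintegrable g ->
  cintegrable (fun t => f t + g t).
Proof.
move=> [mf If] [mg ig].
apply: (@cintegrable_le _ (fun t => normc (f t) + normc (g t))).
- exact: cmeasurableD.
- exact: (integrableD _ If ig).
- by move=> t; exact: le_normcD.
Qed.

Lemma cintegrableMr f g (M : R) : cintegrable f -> cmeasurable g ->
  (forall t, normc (g t) <= M) -> cintegrable (fun t => f t * g t).
Proof.
move=> [mf If] mg gM.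
apply: (@cintegrable_le _ (fun t => M * normc (f t))).
- exact: cmeasurableM.
- exact: (integrableZl _ _ If).
- by move=> t; rewrite normcM mulrC ler_wpM2r// normc_ge0.
Qed.

Lemma cintegrableMl f g (M : R) : cintegrable f -> cmeasurable g ->
  (forall t, normc (g t) <= M) -> cintegrable (fun t => g t * f t).
Proof.
by move=> If mg gM; under eq_fun do rewrite mulrC; exact: cintegrableMr gM.
Qed.

Lemma cintegrableZ (c : R[i]) f : cintegrable f -> cintegrable (fun t => c * f t).
Proof.
by move=> If; apply: (@cintegrableMl _ _ (normc c)) => //; exact: cmeasurable_cst.
Qed.

Lemma cintegrableN f : cintegrable f -> cintegrable (fun t => - f t).
Proof.
by move=> If; under eq_fun do rewrite -mulN1r; exact: cintegrableZ.
Qed.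

Lemma cintegrableB f g : cintegrable f -> cintegrable g ->
  cintegrable (fun t => f t - g t).
Proof. by move=> If ig; apply: cintegrableD => //; exact: cintegrableN. Qed.

Lemma cintegrable_conj f : cintegrable f -> cintegrable (fun t => conjc (f t)).
Proof.
move=> [mf If]; split; first exact: cmeasurable_conj.
by under eq_fun do rewrite normc_conj.
Qed.

Lemma cintegralE f : cintegral mu f =
  (\int[mu]_t complex.Re (f t)) +i* (\int[mu]_t complex.Im (f t)).
Proof. by []. Qed.

Lemma cintegral0 : cintegral mu (fun=> 0) = 0.
Proof. by rewrite cintegralE/= Rintegral_cst// mul0r. Qed.

Lemma cintegralD f g : cintegrable f -> cintegrable g ->
  cintegral mu (fun t => f t + g t) = cintegral mu f + cintegral mu g.
Proof.
move=> If Ig; apply: complex_ext; rewrite ?ReD ?ImD /=.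
  under eq_Rintegral do rewrite ReD.
  by rewrite RintegralD//; exact: cintegrable_Re.
under eq_Rintegral do rewrite ImD.
by rewrite RintegralD//; exact: cintegrable_Im.
Qed.

Lemma cintegralZ c f : cintegrable f ->
  cintegral mu (fun t => c * f t) = c * cintegral mu f.
Proof.
move=> If; have I1 := cintegrable_Re If; have I2 := cintegrable_Im If.
have ZI k (h : T -> R) : mu.-integrable setT (fun t => (h t)%:E) ->
    mu.-integrable setT (fun t => (k * h t)%:E).
  by move=> Ih; exact: (integrableZl _ k Ih).
apply: complex_ext; rewrite ?ReM ?ImM /=.
  under eq_Rintegral do rewrite ReM.
  by rewrite RintegralB ?RintegralZl//; exact: ZI.
under eq_Rintegral do rewrite ImM.
by rewrite RintegralD ?RintegralZl//; exact: ZI.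
Qed.

Lemma cintegralN f : cintegrable f ->
  cintegral mu (fun t => - f t) = - cintegral mu f.
Proof.
by move=> If; under eq_fun do rewrite -mulN1r; rewrite cintegralZ// mulN1r.
Qed.

Lemma cintegralB f g : cintegrable f -> cintegrable g ->
  cintegral mu (fun t => f t - g t) = cintegral mu f - cintegral mu g.
Proof.
by move=> If Ig; rewrite cintegralD ?cintegralN//; exact: cintegrableN.
Qed.

Lemma cintegral_sum (I : Type) (s : seq I) (F : I -> T -> R[i]) :
  (forall i, cintegrable (F i)) ->
  cintegrable (fun t => \sum_(i <- s) F i t) /\
  cintegral mu (fun t => \sum_(i <- s) F i t) = \sum_(i <- s) cintegral mu (F i).
Proof.
move=> IF; elim: s => [|i s [IH1 IH2]].
  rewrite big_nil; under eq_fun do rewrite big_nil; split; last exact: cintegral0.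
  apply: (@cintegrable_le _ (fun=> 0)); first exact: cmeasurable_cst.
    exact: integrable0.
  by move=> t; rewrite normc0.
rewrite big_cons; under eq_fun do rewrite big_cons; split.
  exact: cintegrableD.
by rewrite cintegralD// IH2.
Qed.

Lemma cintegral_conj f : cintegrable f ->
  cintegral mu (fun t => conjc (f t)) = conjc (cintegral mu f).
Proof.
move=> If; apply: complex_ext; rewrite ?Re_conjc ?Im_conjc /=.
  by under eq_Rintegral do rewrite Re_conjc.
under eq_Rintegral do rewrite Im_conjc -mulN1r.
by rewrite RintegralZl ?mulN1r//; exact: cintegrable_Im.
Qed.

(** The real and imaginary parts are bounded separately, whence the factor 2. Later only the
    existence of such a bound matters. *)
Lemma le_normc_cintegral f (g : T -> R) : cmeasurable f ->
  mu.-integrable setT (EFin \o g) -> (forall t, normc (f t) <= g t) ->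
  normc (cintegral mu f) <= 2 * \int[mu]_t g t.
Proof.
move=> mf ig fg; have If := cintegrable_le mf ig fg.
rewrite (le_trans (ler_normc_ReIm _))//= mulr_natl mulr2n lerD//.
  rewrite (le_trans (le_normr_Rintegral _ (cintegrable_Re If)))//.
  apply: le_Rintegral => //; first exact: integrable_norm (cintegrable_Re If).
  by move=> t _; rewrite (le_trans (ler_normRe _)).
rewrite (le_trans (le_normr_Rintegral _ (cintegrable_Im If)))//.
apply: le_Rintegral => //; first exact: integrable_norm (cintegrable_Im If).
by move=> t _; rewrite (le_trans (ler_normIm _)).
Qed.

Lemma dominated_Rintegral (f_ : nat -> T -> R) (f g : T -> R) :
  (forall k, measurable_fun setT (f_ k)) ->
  mu.-integrable setT (EFin \o g) ->
  (forall k t, `|f_ k t| <= g t) ->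
  (forall t, f_ k t @[k --> \oo] --> f t) ->
  \int[mu]_t f_ k t @[k --> \oo] --> \int[mu]_t f t.
Proof.
move=> mf ig fg ff.
have mlim : measurable_fun setT f.
  by apply: (@measurable_fun_cvg _ _ _ _ f_) => // t _; exact: ff.
have [|||||If _ cvgf] := @dominated_convergence _ _ _ mu setT measurableT
    (fun k t => (f_ k t)%:E) (EFin \o f) (EFin \o g).
- by move=> k; exact/measurable_EFinP.
- exact/measurable_EFinP.
- by apply: aeW => t _; apply: cvg_EFin; [exact: nearW|exact: ff].
- exact: ig.
- by apply: aeW => t k _ /=; rewrite lee_fin.
apply: fine_cvg; rewrite fineK; first exact: cvgf.
exact: integrable_fin_num If.
Qed.

(** The form in which limits of integrals are taken throughout: integrals that vanish along a
    dominated sequence. Convergence is stated for the modulus of the difference, where explicit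
    rates are available. *)
Lemma cintegral_lim0 (f_ : nat -> T -> R[i]) (f : T -> R[i]) (g : T -> R) :
  (forall k, cmeasurable (f_ k)) -> mu.-integrable setT (EFin \o g) ->
  (forall k t, normc (f_ k t) <= g t) ->
  (forall t, normc (f_ k t - f t) @[k --> \oo] --> (0 : R)) ->
  (forall k, cintegral mu (f_ k) = 0) -> cintegral mu f = 0.
Proof.
move=> mf ig fg ff f0.
have lim0 (P : R[i] -> R) : (forall x y, P (x - y) = P x - P y) ->
    (forall x, `|P x| <= normc x) ->
    (forall k, measurable_fun setT (P \o f_ k)) ->
    (forall k, \int[mu]_t P (f_ k t) = 0) ->
    \int[mu]_t P (f t) = 0.
  move=> PB Pn mP P0.
  suff : \int[mu]_t P (f_ k t) @[k --> \oo] --> \int[mu]_t P (f t).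
    under eq_fun do rewrite P0.
    by move=> /cvg_lim => /(_ (@Rhausdorff _)) <-; rewrite lim_cst.
  apply: (@dominated_Rintegral (fun k => P \o f_ k) (P \o f) g mP ig).
    by move=> k t; rewrite /= (le_trans (Pn _)) ?fg.
  move=> t.
    apply/subr_cvg0; apply/norm_cvg0P.
    apply: (@squeeze_cvgr _ _ _ _ (cst 0) (fun k => normc (f_ k t - f t))).
    + by apply: nearW => k /=; rewrite normr_ge0/= -PB.
    + exact: cvg_cst.
    + exact: ff.
have f0' k := f0 k; rewrite /cintegral in f0'.
apply: complex_ext => /=; apply: lim0.
- by move=> x y; rewrite ReD ReN.
- exact: ler_normRe.
- by move=> k; have [] := mf k.
- by move=> k; have [] := f0' k.
- by move=> x y; rewrite ImD ImN.
- exact: ler_normIm.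
- by move=> k; have [] := mf k.
- by move=> k; have [] := f0' k.
Qed.

End cintegral.

(** The product majorant makes every section integrable, not merely almost every one, so at each
    point the finite inner integral agrees with the extended one. *)
Lemma cintegral_Fubini d1 d2 (T1 : measurableType d1) (T2 : measurableType d2)
    (R : realType) (m1 : {sigma_finite_measure set T1 -> \bar R})
    (m2 : {sigma_finite_measure set T2 -> \bar R}) (f : T1 * T2 -> R[i])
    (g1 : T1 -> R) (g2 : T2 -> R) :
  cmeasurable f -> m1.-integrable setT (EFin \o g1) ->
  m2.-integrable setT (EFin \o g2) ->
  (forall x, 0 <= g1 x) -> (forall y, 0 <= g2 y) ->
  (forall x y, normc (f (x, y)) <= g1 x * g2 y) ->
  cintegral m1 (fun x => cintegral m2 (fun y => f (x, y))) =
  cintegral m2 (fun y => cintegral m1 (fun x => f (x, y))).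
Proof.
move=> [mRe mIm] ig1 ig2 g10 g20 fg.
suff RF (h : T1 * T2 -> R) : measurable_fun setT h ->
    (forall x y, `|h (x, y)| <= g1 x * g2 y) ->
    \int[m1]_x (\int[m2]_y h (x, y)) = \int[m2]_y (\int[m1]_x h (x, y)).
  apply: complex_ext => /=; apply: (RF (fun p => _ (f p))) => // x y.
    by rewrite (le_trans (ler_normRe _)).
  by rewrite (le_trans (ler_normIm _)).
move=> mh hg.
have mEh : measurable_fun setT (fun p => (h p)%:E) by exact/measurable_EFinP.
have mhx x : measurable_fun setT (fun y => h (x, y)).
  exact: (measurableT_comp mh (pair1_measurable x)).
have mhy y : measurable_fun setT (fun x => h (x, y)).
  exact: (measurableT_comp mh (pair2_measurable y)).
have ih2 x : m2.-integrable setT (fun y => (h (x, y))%:E).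
  apply: (@le_integrable _ _ _ m2 _ measurableT _ (fun y => (g1 x * g2 y)%:E)).
  - exact/measurable_EFinP.
  - by move=> y _ /=; rewrite lee_fin (le_trans (hg _ _))// ler_norm.
  - exact: (integrableZl _ (g1 x) ig2).
have ih1 y : m1.-integrable setT (fun x => (h (x, y))%:E).
  apply: (@le_integrable _ _ _ m1 _ measurableT _ (fun x => (g2 y * g1 x)%:E)).
  - exact/measurable_EFinP.
  - by move=> x _ /=; rewrite lee_fin (le_trans (hg _ _))// mulrC ler_norm.
  - exact: (integrableZl _ (g2 y) ig1).
have ih : (m1 \x m2)%E.-integrable setT (fun p => (h p)%:E).
  apply/integrable12ltyP => //.
  apply: (@le_lt_trans _ _ (\int[m1]_x ((fine (\int[m2]_y (g2 y)%:E))%:E * (g1 x)%:E))%E).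
    apply: ge0_le_integral => //.
    - by move=> x _; exact: integral_ge0.
    - apply: (measurable_fun_fubini_tonelli_F (abse \o (EFin \o h))) => //=.
      exact: measurableT_comp.
    - by apply: measurable_funeM; exact: measurable_int ig1.
    - move=> x _; rewrite fineK ?integrable_fin_num// muleC -integralZl//.
      apply: ge0_le_integral => //.
      + by apply: measurableT_comp => //; exact/measurable_EFinP.
      + by apply: measurable_funeM; exact: measurable_int ig2.
      + by move=> y _; rewrite lee_fin.
  rewrite integralZl// ltey_eq fin_numM//.
  exact: integrable_fin_num.
rewrite /Rintegral; congr fine.
transitivity (\int[m1]_x \int[m2]_y (h (x, y))%:E)%E.
  by apply: eq_integral => x _; rewrite fineK// integrable_fin_num.
rewrite (Fubini ih).
by apply: eq_integral => y _; rewrite fineK// integrable_fin_num.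
Qed.

(** * Taylor estimates for exp(ia) *)

Section cexpi_theory.
Context {R : realType}.
Implicit Types a b : R.

(** The derivative is bounded only at distance at most |b - a| from a, so [M] may depend on b. With
    [M] equal to |b - a|, a first-order bound on the derivative becomes a second-order bound on the
    function, as in [ler_dist_cos]. *)
Lemma ler_mvt (f df : R -> R) a b (M : R) :
  (forall x : R, is_derive x 1 f (df x)) ->
  (forall x, `|x - a| <= `|b - a| -> `|df x| <= M) ->
  `|f b - f a| <= M * `|b - a|.
Proof.
move=> fdf dfM.
have cf : continuous f.
  by move=> x; apply/differentiable_continuous/derivable1_diffP; case: (fdf x).
have seg x y : x <= y -> exists2 c, x <= c <= y & f y - f x = df c * (y - x).
  move=> xy; have [c] := MVT_segment xy (fun x _ => fdf x) (continuous_subspaceT cf).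
  by rewrite in_itv => xcy ?; exists c.
have [ab|/ltW ba] := leP a b.
  have [c /andP[ac cb] ->] := seg _ _ ab.
  rewrite normrM ler_wpM2r//; apply: dfM.
  by rewrite !ger0_norm ?subr_ge0// lerD2r.
have [c /andP[bc ca] e] := seg _ _ ba.
rewrite -opprB normrN e -(distrC a) normrM ler_wpM2r//; apply: dfM.
rewrite distrC [leRHS]distrC !ger0_norm ?subr_ge0// lerD2l lerN2//.
Qed.

Lemma cexpi0 : cexpi 0 = 1 :> R[i].
Proof. by rewrite /cexpi cos0 sin0. Qed.

Lemma cexpiD a b : cexpi (a + b) = cexpi a * cexpi b.
Proof.
by rewrite /cexpi cosD sinD; apply: complex_ext; rewrite ?ReM ?ImM /=; ring.
Qed.

Lemma cexpiN a : cexpi (- a) = conjc (cexpi a).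
Proof. by rewrite /cexpi cosN sinN. Qed.

Lemma normc_cexpi a : normc (cexpi a) = 1.
Proof. by rewrite /= cos2Dsin2 sqrtr1. Qed.

Lemma cexpiX a n : cexpi a ^+ n = cexpi (n%:R * a).
Proof.
elim: n => [|n IHn]; first by rewrite mul0r cexpi0.
by rewrite exprS IHn -cexpiD; congr cexpi; rewrite -natr1; ring.
Qed.

Lemma cexpi_sum (I : Type) (s : seq I) (F : I -> R) :
  cexpi (\sum_(i <- s) F i) = \prod_(i <- s) cexpi (F i).
Proof.
by elim/big_rec2: _ => [|i y x _ <-]; rewrite ?cexpi0// cexpiD.
Qed.

Lemma ler_norm_sin a : `|sin a| <= `|a|.
Proof.
have := @ler_mvt (@sin R) (@cos R) 0 a 1 (fun x => is_derive_sin x).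
rewrite sin0 !subr0 mul1r; apply=> x _.
by rewrite ler_norml cos_geN1 cos_le1.
Qed.

Lemma ler_dist_cos a : `|cos a - 1| <= a ^+ 2.
Proof.
have := @ler_mvt (@cos R) (fun x => - sin x) 0 a `|a| (fun x => is_derive_cos x).
rewrite cos0 !subr0 -expr2 real_normK ?num_real//; apply=> x.
by rewrite subr0 normrN; exact/le_trans/ler_norm_sin.
Qed.

Lemma ler_norm_cosB1 a : `|cos a - 1| <= `|a|.
Proof.
have := @ler_mvt (@cos R) (fun x => - sin x) 0 a 1 (fun x => is_derive_cos x).
rewrite cos0 !subr0 mul1r; apply=> x _.
by rewrite normrN ler_norml sin_geN1 sin_le1.
Qed.

Lemma ler_dist_sin a : `|sin a - a| <= a ^+ 2.
Proof.
have := @ler_mvt (fun x => sin x - x) (fun x => cos x - 1) 0 a `|a|.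
rewrite sin0 !subr0 -expr2 real_normK ?num_real//; apply=> x.
  by rewrite subr0; exact/le_trans/ler_norm_cosB1.
Qed.

Lemma normc_cexpiB1 a : normc (cexpi a - 1) <= 2 * `|a|.
Proof.
rewrite (le_trans (ler_normc_ReIm _))// /= oppr0 addr0 mulr_natl mulr2n lerD//.
  exact: ler_norm_cosB1.
exact: ler_norm_sin.
Qed.

Lemma normc_cexpi_taylor a : normc (cexpi a - (1 +i* a)) <= 2 * a ^+ 2.
Proof.
rewrite (le_trans (ler_normc_ReIm _))// /= mulr_natl mulr2n lerD//.
  exact: ler_dist_cos.
exact: ler_dist_sin.
Qed.

End cexpi_theory.

(** * Functionals annihilating the Cauchy kernels, in one variable *)

Section resolvent.
Context {R : realType}.
Implicit Types (s x : R).

(* [resolv s] is the Fourier-Laplace transform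
   [1 / (1 + i s x) = \int_0^oo exp(-v) exp(- i s x v) dv]. *)
Definition resolv s x : R[i] := (1 +i* (s * x))^-1.

Lemma normc_resolv_sq s x : normc (resolv s x) ^+ 2 = (1 + (s * x) ^+ 2)^-1.
Proof.
by rewrite /resolv normcV exprVn sqr_normcE /= expr1n.
Qed.

Lemma normc_resolv_le1 s x : normc (resolv s x) <= 1.
Proof.
rewrite -(@ler_pXn2r _ 2) ?nnegrE ?normc_ge0//.
by rewrite normc_resolv_sq expr1n invf_le1 ?lerDl ?sqr_ge0// ltr_wpDr ?sqr_ge0.
Qed.

Lemma resolv_neq0 s x : (1 +i* (s * x)) != 0 :> R[i].
Proof. by rewrite eq_complex /= oner_eq0. Qed.

Lemma resolvN s x : resolv s (- x) = resolv (- s) x.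
Proof. by rewrite /resolv mulrN mulNr. Qed.

(** This form of the resolvent identity trades a product for single factors with constant
    coefficients, so it shortens products. [resolv_sub] is the form that measures continuity in the
    parameter, at the price of a factor x. *)
Lemma resolv_mul s s' x :
  (s - s')%:C * (resolv s x * resolv s' x) =
  s%:C * resolv s x - s'%:C * resolv s' x.
Proof.
have := resolv_neq0 s x; have := resolv_neq0 s' x; rewrite /resolv.
set a := 1 +i* (s' * x); set b := 1 +i* (s * x) => a0 b0.
have -> : (s - s')%:C = s%:C * a - s'%:C * b.
  by rewrite /a /b; apply: complex_ext; simpc; rewrite /=; ring.
by field; rewrite a0 b0.
Qed.

Lemma resolv_sub s s' x :
  resolv s x - resolv s' x = (s' - s)%:C * (0 +i* x) * (resolv s x * resolv s' x).
Proof.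
have := resolv_neq0 s x; have := resolv_neq0 s' x; rewrite /resolv.
set a := 1 +i* (s' * x); set b := 1 +i* (s * x) => a0 b0.
have -> : (s' - s)%:C * (0 +i* x) = a - b.
  by rewrite /a /b; apply: complex_ext; simpc; rewrite /=; ring.
by field; rewrite a0 b0.
Qed.

(** The bound is uniform in all parameters with |s| >= m, as domination along a subdivision
    requires. The constant comes from 1 + x^2 <= (1 + m^-2) (1 + s^2 x^2). *)
Lemma normc_resolv_decay (m : R) s x : 0 < m -> m <= `|s| ->
  normc (resolv s x) ^+ 2 <= (1 + m^-2) / (1 + x ^+ 2).
Proof.
move=> m0 ms; rewrite normc_resolv_sq.
have p1 : 0 < 1 + (s * x) ^+ 2 by rewrite ltr_wpDr ?sqr_ge0.
have p2 : 0 < 1 + x ^+ 2 by rewrite ltr_wpDr ?sqr_ge0.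
rewrite ler_pdivlMr// mulrC ler_pdivrMr//.
have ms2 : m ^+ 2 <= s ^+ 2 by rewrite -(real_normK (num_real s)) ler_pXn2r ?nnegrE ?(ltW m0).
rewrite mulrDl mul1r mulrDr mulr1 exprMn.
have -> : 1 + x ^+ 2 = 1 + m ^- 2 * (m ^+ 2 * x ^+ 2).
  by rewrite mulrA mulVf ?mul1r// expf_neq0// gt_eqF.
rewrite -addrA lerD2l; apply: ler_wpDl; first by rewrite mulr_ge0 ?sqr_ge0.
apply: ler_wpDl; first by rewrite invr_ge0 sqr_ge0.
by rewrite ler_wpM2l ?invr_ge0 ?sqr_ge0// ler_wpM2r ?sqr_ge0.
Qed.

Lemma normc_resolv2_decay (m : R) s s' x : 0 < m -> m <= `|s| -> m <= `|s'| ->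
  normc (resolv s x * resolv s' x) <= (1 + m^-2) / (1 + x ^+ 2).
Proof.
move=> m0 ms ms'; rewrite normcM.
have h1 := normc_resolv_decay x m0 ms; have h2 := normc_resolv_decay x m0 ms'.
set a := normc _ in h1 *; set b := normc _ in h2 *; set c := (_ / _) in h1 h2 *.
have : 0 <= (a - b) ^+ 2 by exact: sqr_ge0.
by clearbody a b c => h; nra.
Qed.

(** With exp(-isx) / (1 + isx) factored out, the difference is the remainder exp(isx) - (1 +
    isx). *)
Lemma normc_resolvB_cexpi s x :
  normc (resolv s x - cexpi (- (s * x))) <= 2 * (s * x) ^+ 2.
Proof.
have -> : resolv s x - cexpi (- (s * x)) =
    resolv s x * cexpi (- (s * x)) * (cexpi (s * x) - (1 +i* (s * x))).
  rewrite mulrBr -mulrA -cexpiD addNr cexpi0 mulr1; congr (_ - _).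
  by rewrite /resolv mulrAC mulVf ?mul1r// resolv_neq0.
rewrite !normcM normc_cexpi mulr1.
apply: le_trans (normc_cexpi_taylor _).
by rewrite ler_piMl ?normc_ge0// normc_resolv_le1.
Qed.

Lemma measurable_resolv s : cmeasurable (resolv s).
Proof.
apply: cmeasurableV; apply: cmeasurable_complex; first exact: measurable_cst.
exact: mulrl_measurable.
Qed.

End resolvent.

Lemma squeeze_cvg0 (R : realType) (u : nat -> R) (C : R) :
  (forall k, 0 <= u k <= C * k.+1%:R^-1) -> u k @[k --> \oo] --> (0 : R).
Proof.
move=> uC; apply: (@squeeze_cvgr _ _ _ _ (cst 0) (fun k => C * k.+1%:R^-1)).
- exact: nearW.
- exact: cvg_cst.
- by rewrite -[X in _ --> X](mulr0 C); apply: cvgM; [exact: cvg_cst|exact: cvg_harmonic].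
Qed.

(** The domain of the one-variable functionals: growth supplies exactly this weight in each
    coordinate. Products of two resolvents or Cauchy kernels belong to it; a single one decays too
    slowly. *)
Definition quadratic_decay (R : realType) (b : R -> R[i]) :=
  cmeasurable b /\ exists C : R, forall x, normc (b x) <= C / (1 + x ^+ 2).

Section quadratic_decay.
Context {R : realType}.
Implicit Types b : R -> R[i].

Lemma decayD b1 b2 : quadratic_decay b1 -> quadratic_decay b2 ->
  quadratic_decay (fun x => b1 x + b2 x).
Proof.
move=> [m1 [C1 h1]] [m2 [C2 h2]]; split; first exact: cmeasurableD.
by exists (C1 + C2) => x; rewrite mulrDl (le_trans (le_normcD _ _))// lerD.
Qed.

Lemma decayM b h (M : R) : quadratic_decay b -> cmeasurable h ->
  (forall x, normc (h x) <= M) -> quadratic_decay (fun x => b x * h x).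
Proof.
move=> [mb [C bC]] mh hM; split; first exact: cmeasurableM.
exists (M * C) => x; rewrite normcM mulrC -mulrA ler_pM ?normc_ge0//.
Qed.

Lemma decayZ (c : R[i]) b : quadratic_decay b -> quadratic_decay (fun x => c * b x).
Proof.
move=> db; under eq_fun do rewrite mulrC.
by apply: (@decayM _ _ (normc c)) => //; exact: cmeasurable_cst.
Qed.

Lemma decayN b : quadratic_decay b -> quadratic_decay (fun x => - b x).
Proof. by move=> db; under eq_fun do rewrite -mulN1r; exact: decayZ. Qed.

Lemma decayB b1 b2 : quadratic_decay b1 -> quadratic_decay b2 ->
  quadratic_decay (fun x => b1 x - b2 x).
Proof. by move=> d1 d2; apply: decayD => //; exact: decayN. Qed.

Lemma decay_resolv2 (s s' : R) : s != 0 -> s' != 0 ->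
  quadratic_decay (fun x => resolv s x * resolv s' x).
Proof.
move=> s0 s'0; split.
  by apply: cmeasurableM; exact: measurable_resolv.
exists (1 + (Num.min `|s| `|s'|)^-2) => x.
by apply: normc_resolv2_decay; rewrite ?lt_min ?normr_gt0 ?s0// ge_min lexx ?orbT.
Qed.

Lemma decay_resolv_prod (ss : seq R) : all (fun s => s != 0) ss ->
  (1 < size ss)%N -> quadratic_decay (fun x => \prod_(s <- ss) resolv s x).
Proof.
case: ss => [//|s [//|s' ss]] /and3P[s0 s'0 _] _.
under eq_fun do rewrite !big_cons mulrA.
apply: (@decayM _ _ 1); first exact: decay_resolv2.
  by apply: cmeasurable_prod => i _; exact: measurable_resolv.
by move=> x; apply: normc_prod_le1 => i _; exact: normc_resolv_le1.
Qed.

End quadratic_decay.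

(** At equally spaced points [resolv_mul] turns each summand into a difference, and the sum
    telescopes to the endpoints. *)
Lemma resolv_mean (R : realType) (s s' x : R) (N : nat)
    (p := fun j => s' + j%:R * ((s - s') / N.+1%:R)) : s != s' ->
  resolv s x * resolv s' x =
    (N.+1%:R^-1)%:C * \sum_(0 <= j < N.+1) resolv (p j.+1) x * resolv (p j) x.
Proof.
move=> ss'; have ss0 : (s - s')%:C != 0 :> R[i].
  by rewrite eq_complex /= negb_and subr_eq0 ss'.
apply: (mulfI ss0); rewrite resolv_mul mulrA -rmorphM /=.
have pS j : (s - s') / N.+1%:R = p j.+1 - p j by rewrite /p -natr1; ring.
rewrite mulr_sumr.
under eq_bigr => j _ do rewrite (pS j) resolv_mul.
rewrite (telescope_sumr (fun j => (p j)%:C * resolv (p j) x))//.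
by congr (_%:C * resolv _ x - _%:C * resolv _ x); rewrite /p; field.
Qed.

Section exponential_approximation.
Context {R : realType}.
Implicit Types s x : R.

(* Distinct positive numbers [split_pt s m 0, ..., split_pt s m m], small and of
   sum [s]: the product of the [resolv] at these points tends to [exp (- i s x)]. *)
Definition split_pt s m j : R := 2 * s * j.+1%:R / (m.+1%:R * m.+2%:R).

Definition split_pts s m := [seq split_pt s m j | j <- iota 0 m.+1].
Arguments split_pts : simpl never.

Lemma sum_split_pt s m : \sum_(0 <= j < m.+1) split_pt s m j = s.
Proof.
(* The normalization of [split_pt] comes from 1 + ... + n = n (n + 1) / 2. *)
have sumS n : \sum_(0 <= j < n) j.+1%:R = n%:R * n.+1%:R / 2 :> R.
  elim: n => [|n IHn]; first by rewrite big_geq// mul0r mul0r.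
  by rewrite big_nat_recr//= IHn -!natr1; field.
rewrite /split_pt -mulr_suml -mulr_sumr sumS.
have : m.+1%:R != 0 :> R by rewrite pnatr_eq0.
have : m.+2%:R != 0 :> R by rewrite pnatr_eq0.
move: (m.+1%:R : R) (m.+2%:R : R) => a b b0 a0.
by field; rewrite a0 b0.
Qed.

Lemma split_pt_gt0 s m j : 0 < s -> 0 < split_pt s m j.
Proof. by move=> s0; rewrite divr_gt0// mulr_gt0// mulr_gt0. Qed.

Lemma split_pt_le s m j : 0 < s -> (j < m.+1)%N ->
  split_pt s m j <= 2 * s / m.+1%:R.
Proof.
move=> s0 jm; rewrite /split_pt ler_pdivrMr ?mulr_gt0// mulrA divfK ?pnatr_eq0//.
by rewrite ler_wpM2l ?mulr_ge0 ?(ltW s0)// ler_nat ltnW.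
Qed.

(** Each factor is within 2 p^2 x^2 of exp(-ipx). Since every p is at most 2s/(m+1) and the p have
    sum s, the errors add up to at most 2 (2s/(m+1)) s x^2. *)
Lemma normc_split_pts s m x : 0 < s ->
  normc (\prod_(v <- split_pts s m) resolv v x - cexpi (- (s * x))) <=
    4 * s ^+ 2 * x ^+ 2 / m.+1%:R.
Proof.
move=> s0; rewrite /split_pts big_map -{2}(sum_split_pt s m) -mulNr -sumrN.
rewrite mulr_suml cexpi_sum /index_iota subn0.
apply: le_trans (normc_prodB _ _ _) _ => [j|j|].
- exact: normc_resolv_le1.
- by rewrite normc_cexpi.
have -> : 4 * s ^+ 2 * x ^+ 2 / m.+1%:R =
    \sum_(j <- iota 0 m.+1) (2 * (2 * s / m.+1%:R) * x ^+ 2) * split_pt s m j.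
  rewrite -mulr_sumr; have := sum_split_pt s m; rewrite /index_iota subn0 => ->.
  by field.
rewrite big_seq [leRHS]big_seq; apply: ler_sum => j.
rewrite mem_iota add0n => /andP[_ jm].
rewrite mulNr; apply: le_trans (normc_resolvB_cexpi _ _) _.
have := split_pt_gt0 m j s0; have := split_pt_le s0 jm.
move: (split_pt s m j) (2 * s / _) => p b pb p0.
rewrite -subr_ge0 (_ : _ - _ = 2 * (x ^+ 2 * (p * (b - p)))); last by ring.
apply: mulr_ge0 => //; apply: mulr_ge0; first exact: sqr_ge0.
by rewrite mulr_ge0 ?subr_ge0 ?(ltW p0).
Qed.

Lemma uniq_split_pts s m : 0 < s -> uniq (split_pts s m).
Proof.
move=> s0; rewrite map_inj_uniq ?iota_uniq// => i j.
have h : (m.+1%:R * m.+2%:R : R) != 0 by rewrite mulf_neq0// pnatr_eq0.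
rewrite /split_pt => /(divIf h)/mulfI.
rewrite mulf_neq0 ?gt_eqF// => /(_ isT)/eqP.
by rewrite eqr_nat eqSS => /eqP.
Qed.

Lemma split_pts_small (s e : R) : 0 < s -> 0 < e -> exists N, forall m,
  (N <= m)%N -> all (fun v : R => 0 < v < e) (split_pts s m).
Proof.
move=> s0 e0.
have [N Ne] : exists N : nat, 2 * s / e < N%:R.
  exists (Num.truncn (2 * s / e)).+1.
  by rewrite truncnS_gt.
exists N => m Nm; apply/allP => v /mapP[j].
rewrite mem_iota add0n => /andP[_ jm] ->.
rewrite split_pt_gt0//= (le_lt_trans (split_pt_le s0 jm))//.
rewrite ltr_pdivrMr// -ltr_pdivrMl// mulrC (lt_le_trans Ne)// ler_nat.
exact: leqW.
Qed.

End exponential_approximation.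

(** * From squares of resolvents to regularized exponentials *)

Section weighted_functional.
Context d (T : measurableType d) (R : realType) (mu : {measure set T -> \bar R}).
Variables (tau : T -> R) (r : T -> R[i]).
Hypotheses (mtau : measurable_fun setT tau) (mr : cmeasurable r).
Hypothesis ir :
  mu.-integrable setT (fun t => (normc (r t) / (1 + tau t ^+ 2))%:E).

(** In the applications [tau] is a coordinate up to sign and [r] collects the kernels in the other
    coordinates. The condition [ir] is what makes [L] finite on functions of quadratic decay. *)
Local Notation L b := (cintegral mu (fun t => r t * b (tau t))).

Lemma functional_integrable b : quadratic_decay b ->
  cintegrable mu (fun t => r t * b (tau t)).
Proof.
move=> [mb [C bC]].
apply: (@cintegrable_le _ _ _ _ _ (fun t => C * (normc (r t) / (1 + tau t ^+ 2)))).
- by apply: cmeasurableM => //; exact: cmeasurable_comp.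
- exact: (integrableZl _ C ir).
- by move=> t; rewrite normcM mulrCA ler_wpM2l ?normc_ge0.
Qed.

Lemma functional_lim0 (b_ : nat -> R -> R[i]) b (C : R) :
  (forall k, cmeasurable (b_ k)) ->
  (forall k x, normc (b_ k x) <= C / (1 + x ^+ 2)) ->
  (forall x, exists K : R, forall k, normc (b_ k x - b x) <= K * k.+1%:R^-1) ->
  (forall k, L (b_ k) = 0) -> L b = 0.
Proof.
move=> mb bC bb b0.
apply: (@cintegral_lim0 _ _ _ _ (fun k t => r t * b_ k (tau t)) _
  (fun t => C * (normc (r t) / (1 + tau t ^+ 2)))) => //.
- by move=> k; apply: cmeasurableM => //; exact: cmeasurable_comp.
- exact: (integrableZl _ C ir).
- by move=> k t; rewrite normcM mulrCA ler_wpM2l ?normc_ge0.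
- move=> t; have [K hK] := bb (tau t).
  apply: (@squeeze_cvg0 _ _ (normc (r t) * K)) => k.
  by rewrite normc_ge0 -mulrBr normcM -mulrA ler_wpM2l ?normc_ge0.
Qed.

Lemma functionalZ c b : quadratic_decay b -> L (fun x => c * b x) = c * L b.
Proof.
move=> db; rewrite -cintegralZ; last exact: functional_integrable.
by under eq_fun do rewrite mulrCA.
Qed.

Lemma functionalB b1 b2 : quadratic_decay b1 -> quadratic_decay b2 ->
  L (fun x => b1 x - b2 x) = L b1 - L b2.
Proof.
move=> d1 d2; rewrite -cintegralB; [|exact: functional_integrable..].
by under eq_fun do rewrite mulrBr.
Qed.

Lemma functional_sumZ (I : Type) (e : seq I) (c : R[i]) (F : I -> R -> R[i]) :
  (forall j, quadratic_decay (F j)) ->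
  L (fun x => c * \sum_(j <- e) F j x) = c * \sum_(j <- e) L (F j).
Proof.
move=> dF.
have IF j := functional_integrable (dF j).
have [IS <-] := cintegral_sum e IF; rewrite -cintegralZ//.
by under eq_fun do rewrite mulrCA mulr_sumr.
Qed.

(* Along the subdivision [p] of [[s', s]], the resolvent identity makes
   [resolv s * resolv s'] the mean of the [resolv p_j * resolv p_(j+1)], hence a
   limit of means of squares. *)
Lemma functional_resolv_pair :
  (forall s : R, 0 < s -> L (fun x => resolv s x * resolv s x) = 0) ->
  forall s s' : R, 0 < s -> 0 < s' -> L (fun x => resolv s x * resolv s' x) = 0.
Proof.
move=> L2 s s' s0 s'0; have [->|ss'] := eqVneq s s'; first exact: L2.
pose p N j := s' + j%:R * ((s - s') / N.+1%:R).
pose m := Num.min s s'; have m0 : 0 < m by rewrite lt_min s0.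
(* The points of the subdivision are convex combinations of s and s', hence stay above [m]; this
   makes the majorant uniform in N. *)
have pm N j : (j <= N.+1)%N -> m <= p N j.
  move=> jN; rewrite /p; have N0 : 0 < N.+1%:R :> R by [].
  have [c0 c1] : 0 <= j%:R / N.+1%:R :> R /\ j%:R / N.+1%:R <= 1 :> R.
    by rewrite ler_pdivrMr// mul1r ler_nat divr_ge0.
  rewrite mulrCA; set c := (_ / _) in c0 c1 *.
  have ms : m <= s by rewrite /m ge_min lexx.
  have ms' : m <= s' by rewrite /m ge_min lexx orbT.
  by clearbody m c; nra.
have pa N j : (j <= N.+1)%N -> m <= `|p N j|.
  by move=> jN; rewrite (le_trans (pm _ _ jN))// ler_norm.
apply: (@functional_lim0 (fun N x => (N.+1%:R^-1)%:C *
    \sum_(0 <= j < N.+1) resolv (p N j) x * resolv (p N j) x)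
    (fun x => resolv s x * resolv s' x) (1 + m^-2)).
- move=> N; apply: cmeasurableM; first exact: cmeasurable_cst.
  by apply: cmeasurable_sum => j _; apply: cmeasurableM; exact: measurable_resolv.
- move=> N x; rewrite normcM normc_real ger0_norm// ler_pdivrMl//.
  apply: le_trans (ler_normc_sum _ _ _) _.
  have <- : \sum_(0 <= j < N.+1) ((1 + m^-2) / (1 + x ^+ 2)) =
      N.+1%:R * ((1 + m^-2) / (1 + x ^+ 2)).
    by rewrite sumr_const_nat subn0 mulr_natl.
  rewrite !big_mkord; apply: ler_sum => j _.
  apply: normc_resolv2_decay => //; apply: pa; exact: ltnW.
(* By [resolv_sub], replacing [p N j.+1] by [p N j] in one factor costs at most |x| |s - s'| / (N +
   1), and the mean inherits this rate. *)
- move=> x; exists (`|x| * `|s - s'|) => N.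
  rewrite (resolv_mean x N ss') -mulrBr -sumrB normcM normc_real ger0_norm//.
  rewrite mulrC ler_pM2r ?invr_gt0//.
  apply: le_trans (ler_normc_sum _ _ _) _.
  have -> : `|x| * `|s - s'| = \sum_(0 <= j < N.+1) `|x| * (`|s - s'| / N.+1%:R).
    by rewrite sumr_const_nat subn0 -mulr_natl; field.
  rewrite !big_mkord; apply: ler_sum => j _.
  rewrite -mulrBl normcM resolv_sub 2!normcM.
  have -> : p N j.+1 - p N j = (s - s') / N.+1%:R by rewrite /p -natr1; ring.
  rewrite normc_real normrM (gtr0_norm (_ : 0 < N.+1%:R^-1)) ?invr_gt0//.
  have -> : normc (0 +i* x) = `|x| by rewrite /= expr0n add0r sqrtr_sqr.
  rewrite [leRHS]mulrC -[leRHS]mulr1 -mulrA; apply: ler_wpM2l.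
    by rewrite mulr_ge0// divr_ge0.
  rewrite normcM -mulrA mulr_ile1 ?mulr_ge0 ?normc_ge0 ?normc_resolv_le1//.
  by rewrite mulr_ile1 ?normc_ge0 ?normc_resolv_le1.
- move=> N; have dF (j : 'I_N.+1) :
      quadratic_decay (fun x => resolv (p N j) x * resolv (p N j) x).
    by apply: decay_resolv2; rewrite gt_eqF// (lt_le_trans m0)// pm// ltnW.
  under eq_fun do rewrite big_mkord.
  rewrite (functional_sumZ (index_enum 'I_N.+1) (N.+1%:R^-1)%:C dF) big1 ?mulr0// => j _.
  by apply: L2; rewrite (lt_le_trans m0)// pm// ltnW.
Qed.

(** Induction on the number of factors: applied to the first two parameters, the resolvent identity
    gives two products with one factor less, and distinctness allows division by s - s'. The descent
    stops at two factors, the least number that ensures quadratic decay. *)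
Lemma functional_resolv_prod :
  (forall s : R, 0 < s -> L (fun x => resolv s x * resolv s x) = 0) ->
  forall ss : seq R, uniq ss -> all (fun s : R => 0 < s) ss -> (1 < size ss)%N ->
    L (fun x => \prod_(s <- ss) resolv s x) = 0.
Proof.
move=> L2 ss; have [n] := ubnP (size ss); elim: n ss => [//|n IHn] ss.
case: ss => [//|s [//|s' ss]] /= ssn /and3P[].
rewrite inE negb_or => /andP[ss' sss] s'ss uss /and3P[s0 s'0 ss0] _.
case: ss => [|s'' ss] in ssn sss s'ss uss ss0 *.
  under eq_fun do rewrite !big_cons big_nil mulr1.
  exact: functional_resolv_pair.
have pos_neq0 e : all (fun s => 0 < s) e -> all (fun s => s != 0) e.
  by apply: sub_all => v /gt_eqF ->.
have dec v : 0 < v -> quadratic_decay (fun x => \prod_(s <- [:: v, s'' & ss]) resolv s x).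
  by move=> v0; apply: decay_resolv_prod => //; apply: pos_neq0; rewrite /= v0.
have Lv v : 0 < v -> v \notin s'' :: ss ->
    L (fun x => \prod_(s <- [:: v, s'' & ss]) resolv s x) = 0.
  by move=> v0 vss; apply: IHn => //; rewrite /= ?v0 ?vss.
have c0 : (s - s')%:C != 0 :> R[i].
  by rewrite eq_complex /= negb_and subr_eq0 ss'.
have dall : quadratic_decay (fun x => \prod_(s <- [:: s, s', s'' & ss]) resolv s x).
  by apply: decay_resolv_prod => //; apply: pos_neq0; rewrite /= s0 s'0.
apply: (mulfI c0); rewrite mulr0 -(functionalZ _ dall).
transitivity (L (fun x => s%:C * \prod_(s <- [:: s, s'' & ss]) resolv s x -
                          s'%:C * \prod_(s <- [:: s', s'' & ss]) resolv s x)).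
  congr cintegral; apply/funext => t; congr (_ * _).
  have := resolv_mul s s' (tau t); rewrite !big_cons => h.
  by rewrite [X in _ * X]mulrA mulrA h mulrBl !mulrA.
rewrite (functionalB (decayZ _ (dec _ s0)) (decayZ _ (dec _ s'0))).
by rewrite (functionalZ _ (dec _ s0)) (functionalZ _ (dec _ s'0)) !Lv// !mulr0 subr0.
Qed.

(** [reg] carries the decay, since the resolvent products are only bounded by 1. [N] lets the
    hypothesis start when the splitting points have become small. *)
Lemma functional_cexpi (s : R) reg N : 0 < s -> quadratic_decay reg ->
  (forall m, (N <= m)%N ->
    L (fun x => reg x * \prod_(v <- split_pts s m) resolv v x) = 0) ->
  L (fun x => reg x * cexpi (- (s * x))) = 0.
Proof.
move=> s0 [mreg [C regC]] L0.
apply: (@functional_lim0 (fun k x => reg x *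
    \prod_(v <- split_pts s (k + N)) resolv v x)
    (fun x => reg x * cexpi (- (s * x))) C).
- move=> k; apply: cmeasurableM => //.
  by apply: cmeasurable_prod => v _; exact: measurable_resolv.
- move=> k x; apply: le_trans (regC x); rewrite normcM ler_piMr ?normc_ge0//.
  by apply: normc_prod_le1 => v _; exact: normc_resolv_le1.
- move=> x; exists (normc (reg x) * (4 * s ^+ 2 * x ^+ 2)) => k.
  rewrite -mulrBr normcM -[leRHS]mulrA ler_wpM2l ?normc_ge0//.
  apply: le_trans (normc_split_pts _ _ s0) _.
  apply: ler_wpM2l; first by rewrite mulr_ge0 ?sqr_ge0// mulr_ge0 ?sqr_ge0.
  by rewrite lef_pV2 ?posrE// ler_nat ltnS leq_addr.
- by move=> k; apply: L0; exact: leq_addl.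
Qed.

(** The parameters e and 2e are distinct and the splitting points eventually lie below e, so no
    parameter of the whole product is repeated. *)
Lemma functional_positive (s e : R) :
  (forall s : R, 0 < s -> L (fun x => resolv s x * resolv s x) = 0) ->
  0 < s -> 0 < e ->
  L (fun x => resolv e x * resolv (2 * e) x * cexpi (- (s * x))) = 0.
Proof.
move=> L2 s0 e0; have [N hN] := split_pts_small s0 e0.
apply: (@functional_cexpi s (fun x => resolv e x * resolv (2 * e) x) N) => //.
  by apply: decay_resolv2; rewrite gt_eqF// mulr_gt0.
move=> m /hN sm.
suff : L (fun x => \prod_(v <- [:: e, 2 * e & split_pts s m]) resolv v x) = 0.
  by under eq_fun do rewrite 2!big_cons [X in _ * X]mulrA.
apply: functional_resolv_prod => //.
- rewrite 2!cons_uniq uniq_split_pts// andbT inE negb_or -andbA; apply/and3P; split.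
  + by rewrite lt_eqF// ltr_pMl// ltr1n.
  + by apply/negP => /(allP sm); rewrite ltxx andbF.
  + apply/negP => /(allP sm) /andP[_]; apply/negP.
    by rewrite -leNgt ler_pMl// ler1n.
- apply/allP => v; rewrite !inE => /or3P[/eqP->//|/eqP->|/(allP sm)/andP[]//].
  exact: mulr_gt0.
Qed.

(** The resolvent identity is applied to s and -e, whose difference s + e is nonzero. It leaves a
    product with distinct positive parameters only, covered by [functional_resolv_prod], and the
    same expression with s removed, covered by induction. *)
Lemma functional_poisson_prod (e : R) :
  (forall s : R, 0 < s -> L (fun x => resolv s x * resolv s x) = 0) ->
  (forall s : R, 0 < s -> L (fun x => resolv s x * resolv (- s) x) = 0) -> 0 < e ->
  forall ss : seq R, uniq ss -> all (fun v : R => 0 < v < e) ss ->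
    L (fun x => resolv e x * resolv (- e) x * \prod_(s <- ss) resolv s x) = 0.
Proof.
move=> L2 LP e0; elim=> [_ _|s ss IHss /=].
  by under eq_fun do rewrite big_nil mulr1; exact: LP.
move=> /andP[sss uss] /andP[/andP[s0 se] ss0].
have c0 : (s - - e)%:C != 0 :> R[i].
  by rewrite eq_complex /= negb_and gt_eqF// opprK addr_gt0.
have ss_e : all (fun v => 0 < v) ss by apply: sub_all ss0 => v /andP[].
have d1 : quadratic_decay (fun x => \prod_(v <- [:: e, s & ss]) resolv v x).
  apply: decay_resolv_prod => //=; rewrite !gt_eqF//=.
  by apply: sub_all ss_e => v /gt_eqF ->.
have d2 (h : R -> R[i]) : cmeasurable h -> (forall x, normc (h x) <= 1) ->
    quadratic_decay (fun x => resolv e x * resolv (- e) x * h x).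
  move=> mh h1; apply: (@decayM _ _ _ 1) => //.
  by apply: decay_resolv2; rewrite ?oppr_eq0 gt_eqF.
have mP (e' : seq R) : cmeasurable (fun x => \prod_(v <- e') resolv v x).
  by apply: cmeasurable_prod => v _; exact: measurable_resolv.
have P1 (e' : seq R) x : normc (\prod_(v <- e') resolv v x) <= 1.
  by apply: normc_prod_le1 => v _; exact: normc_resolv_le1.
apply: (mulfI c0); rewrite mulr0 -(functionalZ _ (d2 _ (mP (s :: ss)) (P1 _))).
transitivity (L (fun x => s%:C * \prod_(v <- [:: e, s & ss]) resolv v x -
  (- e)%:C * (resolv e x * resolv (- e) x * \prod_(v <- ss) resolv v x))).
  congr cintegral; apply/funext => t; congr (_ * _).
  have := resolv_mul s (- e) (tau t); rewrite !big_cons => h.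
  set P := \prod_(j <- _) _.
  transitivity ((s - - e)%:C * (resolv s (tau t) * resolv (- e) (tau t)) *
     (resolv e (tau t) * P)); first by ring.
  by rewrite h; ring.
have d3 := d2 _ (mP ss) (P1 ss).
rewrite (functionalB (decayZ _ d1) (decayZ _ d3)).
rewrite (functionalZ _ d1) (functionalZ _ d3) IHss// mulr0 subr0.
rewrite functional_resolv_prod ?mulr0//=.
  rewrite inE negb_or sss uss eq_sym lt_eqF//= andbT.
  by apply/negP => /(allP ss0); rewrite ltxx andbF.
by rewrite e0 s0.
Qed.

Lemma functional_poisson_positive (s e : R) :
  (forall s : R, 0 < s -> L (fun x => resolv s x * resolv s x) = 0) ->
  (forall s : R, 0 < s -> L (fun x => resolv s x * resolv (- s) x) = 0) ->
  0 <= s -> 0 < e ->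
  L (fun x => resolv e x * resolv (- e) x * cexpi (- (s * x))) = 0.
Proof.
move=> L2 LP; rewrite le_eqVlt => /predU1P[<- e0|s0 e0].
  by under eq_fun do rewrite mul0r oppr0 cexpi0 mulr1; exact: LP.
have [N hN] := split_pts_small s0 e0.
apply: (@functional_cexpi s (fun x => resolv e x * resolv (- e) x) N) => //.
  by apply: decay_resolv2; rewrite ?oppr_eq0 gt_eqF.
by move=> m /hN sm; apply: functional_poisson_prod => //; exact: uniq_split_pts.
Qed.

End weighted_functional.

(** * Cauchy kernels and their decay *)

Section cauchy_kernel.
Context {R : realType}.
Implicit Types (z w a : R[i]) (x s : R).

Definition cauchy z x : R[i] := (x%:C - z)^-1.

Lemma cauchy_den_neq0 z x : complex.Im z != 0 -> x%:C - z != 0.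
Proof.
move=> z0; rewrite eq_complex negb_and ImD ImN /= add0r oppr_eq0 z0.
by rewrite orbT.
Qed.

Lemma measurable_cauchy z : cmeasurable (cauchy z).
Proof.
apply: cmeasurableV; apply: cmeasurableB; last exact: cmeasurable_cst.
exact: cmeasurable_real.
Qed.

Lemma normc_cauchy_le z (y : R) x : 0 < y -> y <= `|complex.Im z| ->
  normc (cauchy z x) <= y^-1.
Proof.
move=> y0 yz; rewrite /cauchy normcV.
have h : y <= normc (x%:C - z).
  rewrite (le_trans yz)// -(normrN (complex.Im z)).
  by rewrite -[leLHS]/(`| _ |) (le_trans _ (ler_normIm _))// ImD ImN /= add0r.
by rewrite lef_pV2 ?posrE// (lt_le_trans y0).
Qed.

(** The constant depends on z only through [M] and [y], so it survives the shifts of z in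
    [functional_cauchy_sq]. It comes from x^2 <= 2 (x - a)^2 + 2 a^2 with a = Re z. *)
Lemma normc_cauchy_decay z (M y : R) x : 0 < y -> y <= `|complex.Im z| ->
  `|complex.Re z| <= M ->
  normc (cauchy z x) ^+ 2 <= (2 + (2 * M ^+ 2 + 1) / y ^+ 2) / (1 + x ^+ 2).
Proof.
move=> y0 yz zM; rewrite /cauchy normcV exprVn sqr_normcE ReD ReN ImD ImN /= add0r.
set a := complex.Re z in zM *; set b := complex.Im z in yz *.
rewrite sqrrN.
have yb : y ^+ 2 <= b ^+ 2.
  by rewrite -(real_normK (num_real b)) ler_pXn2r ?nnegrE ?(ltW y0).
have aM : a ^+ 2 <= M ^+ 2.
  by rewrite -(real_normK (num_real a)) ler_pXn2r ?nnegrE// (le_trans _ zM).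
have y20 : 0 < y ^+ 2 by rewrite exprn_gt0.
have p1 : 0 < (x - a) ^+ 2 + b ^+ 2 by rewrite ltr_wpDl ?sqr_ge0// (lt_le_trans y20).
have p2 : 0 < 1 + x ^+ 2 by rewrite ltr_wpDr ?sqr_ge0.
rewrite ler_pdivlMr// mulrC ler_pdivrMr//.
have : 0 <= (2 * M ^+ 2 + 1) / y ^+ 2.
  by rewrite divr_ge0 ?(ltW y20)// addr_ge0// mulr_ge0// sqr_ge0.
have : (2 * M ^+ 2 + 1) = (2 * M ^+ 2 + 1) / y ^+ 2 * y ^+ 2 by rewrite divfK// gt_eqF.
set q := _ / y ^+ 2 => qE q0.
have : q * y ^+ 2 <= q * ((x - a) ^+ 2 + b ^+ 2).
  by rewrite ler_wpM2l// (le_trans yb)// lerDr sqr_ge0.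
have := sqr_ge0 (x - 2 * a); have := sqr_ge0 b.
by rewrite -qE mulrDl; nra.
Qed.

Lemma normc_cauchy2_decay z w (M y : R) x : 0 < y ->
  y <= `|complex.Im z| -> y <= `|complex.Im w| ->
  `|complex.Re z| <= M -> `|complex.Re w| <= M ->
  normc (cauchy z x * cauchy w x) <=
    (2 + (2 * M ^+ 2 + 1) / y ^+ 2) / (1 + x ^+ 2).
Proof.
move=> y0 yz yw zM wM; rewrite normcM.
have h1 := normc_cauchy_decay x y0 yz zM; have h2 := normc_cauchy_decay x y0 yw wM.
set a := normc _ in h1 *; set b := normc _ in h2 *; set c := (_ / _) in h1 h2 *.
have : 0 <= (a - b) ^+ 2 by exact: sqr_ge0.
by clearbody a b c => h; nra.
Qed.

Lemma decay_cauchy2 z w : complex.Im z != 0 -> complex.Im w != 0 ->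
  quadratic_decay (fun x => cauchy z x * cauchy w x).
Proof.
move=> z0 w0; split; first by apply: cmeasurableM; exact: measurable_cauchy.
pose y := Num.min `|complex.Im z| `|complex.Im w|.
pose M := Num.max `|complex.Re z| `|complex.Re w|.
exists (2 + (2 * M ^+ 2 + 1) / y ^+ 2) => x.
apply: normc_cauchy2_decay; rewrite ?lt_min ?normr_gt0 ?z0//.
- by rewrite ge_min lexx.
- by rewrite ge_min lexx orbT.
- by rewrite le_max lexx.
- by rewrite le_max lexx orbT.
Qed.

Lemma cauchyB z a x : complex.Im z != 0 -> complex.Im (z + a) != 0 ->
  cauchy (z + a) x - cauchy z x = a * (cauchy z x * cauchy (z + a) x).
Proof.
move=> /(cauchy_den_neq0 x) h1 /(cauchy_den_neq0 x) h2; rewrite /cauchy.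
by move: h1 h2; set X := x%:C => h1 h2; field; rewrite h1 h2.
Qed.

Lemma decay_cauchyB z w : complex.Im z != 0 -> complex.Im w != 0 ->
  quadratic_decay (fun x => cauchy z x - cauchy w x).
Proof.
move=> z0 w0; have -> : (fun x => cauchy z x - cauchy w x) =
    fun x => (z - w) * (cauchy w x * cauchy z x).
  by apply/funext => x; have := @cauchyB w (z - w) x w0; rewrite addrC subrK; exact.
by apply: decayZ; exact: decay_cauchy2.
Qed.

(** Resolvents are Cauchy kernels with pole i/s on the imaginary axis; the sign of s selects the
    half-plane. *)
Lemma cauchy_resolv s x : s != 0 ->
  cauchy (0 +i* s^-1) x = (0 +i* s) * resolv s x.
Proof.
move=> s0; rewrite /cauchy /resolv.
have -> : 1 +i* (s * x) = (0 +i* s) * (x%:C - (0 +i* s^-1)).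
  by apply: complex_ext; rewrite ?ReM ?ImM ?ReD ?ImD ?ReN ?ImN /=; field.
rewrite invfM mulrA mulfV ?mul1r//.
by rewrite eq_complex /= negb_and s0 orbT.
Qed.

End cauchy_kernel.

Section functional_cauchy.
Context d (T : measurableType d) (R : realType) (mu : {measure set T -> \bar R}).
Variables (tau : T -> R) (r : T -> R[i]).
Hypotheses (mtau : measurable_fun setT tau) (mr : cmeasurable r).
Hypothesis ir :
  mu.-integrable setT (fun t => (normc (r t) / (1 + tau t ^+ 2))%:E).

Local Notation L b := (cintegral mu (fun t => r t * b (tau t))).

Lemma functional_resolv_of_cauchy :
  (forall z : R[i], 0 < complex.Im z -> L (fun x => cauchy z x * cauchy z x) = 0) ->
  forall s : R, 0 < s -> L (fun x => resolv s x * resolv s x) = 0.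
Proof.
move=> Lz s s0; have c0 : (0 +i* s) * (0 +i* s) != 0 :> R[i].
  by rewrite mulf_neq0// eq_complex /= negb_and (gt_eqF s0) orbT.
have d2 : quadratic_decay (fun x : R => resolv s x * resolv s x).
  by apply: decay_resolv2; rewrite gt_eqF.
apply: (mulfI c0); rewrite mulr0 -(functionalZ mtau mr ir _ d2).
have := Lz (0 +i* s^-1); rewrite /= invr_gt0 => /(_ s0) => <-.
congr cintegral; apply/funext => t; congr (_ * _).
by rewrite !cauchy_resolv ?gt_eqF//; ring.
Qed.

Lemma functional_poisson_of_cauchy :
  (forall z : R[i], 0 < complex.Im z -> L (fun x => cauchy z x - cauchy (conjc z) x) = 0) ->
  forall s : R, 0 < s -> L (fun x => resolv s x * resolv (- s) x) = 0.
Proof.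
(* The constant is 2is: at the pole i/s the difference of Cauchy kernels is is times
   [resolv s + resolv (- s)], and by [resolv_mul] this sum is twice the product. *)
move=> Lz s s0; have c0 : (0 +i* s) * 2%:C != 0 :> R[i].
  by rewrite mulf_neq0 // eq_complex /= negb_and ?(gt_eqF s0) ?orbT ?pnatr_eq0.
have d2 : quadratic_decay (fun x : R => resolv s x * resolv (- s) x).
  by apply: decay_resolv2; rewrite ?oppr_eq0 gt_eqF.
apply: (mulfI c0); rewrite mulr0 -(functionalZ mtau mr ir _ d2).
have := Lz (0 +i* s^-1); rewrite /= invr_gt0 => /(_ s0) => <-.
congr cintegral; apply/funext => t; congr (_ * _).
have -> : (0 -i* s^-1) = (0 +i* (- s)^-1) :> R[i] by rewrite invrN.
rewrite !cauchy_resolv ?oppr_eq0 ?gt_eqF//.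
have := resolv_mul s (- s) (tau t) => h.
have s1 : s%:C != 0 :> R[i] by rewrite eq_complex /= negb_and gt_eqF.
apply: (mulfI s1); set A := resolv s _ in h *; set B := resolv (- s) _ in h *.
transitivity ((0 +i* s) * ((s - - s)%:C * (A * B))).
  by rewrite opprK rmorphD /=; ring.
have -> : (0 +i* - s) = - (0 +i* s) :> R[i].
  by apply: complex_ext; rewrite /= ?oppr0.
rewrite h.
by rewrite rmorphN /=; ring.
Qed.

(* With [P z := cauchy z - cauchy (conjc z)], the operator [(d/dx - i d/dy) / 2]
   maps [P z] to [cauchy z ^+ 2]: the second term is antiholomorphic. *)
Lemma functional_cauchy_sq :
  (forall z : R[i], 0 < complex.Im z -> L (fun x => cauchy z x - cauchy (conjc z) x) = 0) ->
  forall z : R[i], 0 < complex.Im z -> L (fun x => cauchy z x * cauchy z x) = 0.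
Proof.
move=> LP z z0.
(* The [+ 1] in [M] leaves room for the real increments [h k <= 1]. *)
pose y : R := complex.Im z; pose M : R := `|complex.Re z| + 1.
pose h (k : nat) : R := k.+1%:R^-1.
have h0 k : 0 < h k by rewrite invr_gt0.
have h1 k : h k <= 1 by rewrite invf_le1// ler1n.
pose P (w : R[i]) (x : R) := cauchy w x - cauchy (conjc w) x.
pose D (w c : R[i]) (x : R) := cauchy w x * cauchy (w + c) x.
pose a k : R[i] := (h k)%:C; pose b k : R[i] := 0 +i* h k.
have Ima k : complex.Im (z + a k) = y by rewrite ImD /= addr0.
have Imb k : complex.Im (z + b k) = y + h k by rewrite ImD.
have za k : 0 < complex.Im (z + a k) by rewrite Ima.
have zb k : 0 < complex.Im (z + b k) by rewrite Imb addr_gt0.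
(* [D w c] is the difference quotient of the Cauchy kernel from w to w + c. Conjugation turns the
   increment ih into -ih, hence the increment [- b k] and the sign of the last term: the two
   quotients at [conjc z] have the same limit and cancel. *)
pose f k (x : R) := 2^-1%:C * (D z (a k) x + D z (b k) x -
  D (conjc z) (a k) x + D (conjc z) (- b k) x).
have n0 (w : R[i]) : 0 < complex.Im w -> complex.Im w != 0 by move=> /gt_eqF ->.
have n1 (w : R[i]) : 0 < complex.Im w -> complex.Im (conjc w) != 0.
  by move=> w0; rewrite Im_conjc oppr_eq0 (gt_eqF w0).
have decP (w : R[i]) : 0 < complex.Im w -> quadratic_decay (P w).
  by move=> w0; apply: decay_cauchyB; [exact: n0|exact: n1].
have fE k : f k = fun x => (2^-1 * (h k)^-1)%:C *
    ((P (z + a k) x - P z x) - (0 +i* 1) * (P (z + b k) x - P z x)).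
  apply/funext => x; rewrite /f /P.
  have e1 : (conjc (z + a k)) = (conjc z) + a k by rewrite conjcD /a conjc_real.
  have e2 : (conjc (z + b k)) = (conjc z) - b k.
    by rewrite conjcD; congr (_ + _); apply: complex_ext; rewrite /= ?oppr0.
  rewrite e1 e2.
  have := cauchyB x (n0 _ z0) (n0 _ (za k)).
  have := cauchyB x (n0 _ z0) (n0 _ (zb k)).
  have n1a := n1 _ (za k); have n1b := n1 _ (zb k).
  rewrite e1 in n1a; rewrite e2 in n1b.
  have := cauchyB x (n1 _ z0) n1a; have := cauchyB x (n1 _ z0) n1b.
  rewrite -!/(D _ _ _); set X1 := D _ _ _; set X2 := D _ _ _; set X3 := D _ _ _.
  set X4 := D _ _ _ => E1 E2 E3 E4.
  transitivity ((2^-1 * (h k)^-1)%:C * ((a k * X4 - a k * X2) -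
      (0 +i* 1) * (b k * X3 - (- b k) * X1))).
    have -> : b k = (0 +i* 1) * a k by apply: complex_ext; rewrite ?ReM ?ImM /=; ring.
    have ii : (0 +i* 1) * (0 +i* 1) = - 1 :> R[i].
      by apply: complex_ext; rewrite ?ReM ?ImM /=; ring.
    have ha : (2^-1 * (h k)^-1)%:C * a k = 2^-1%:C.
      by rewrite /a -rmorphM /= mulfVK// gt_eqF.
    rewrite -ha; set c := (_ * _)%:C; move: (a k) ii => ak ii.
    transitivity (c * ak * (X4 + X3 - X2 + X1)); first by ring.
    transitivity (c * ak * (X4 - ((0 +i* 1) * (0 +i* 1)) * X3 - X2 -
      ((0 +i* 1) * (0 +i* 1)) * X1)); last by ring.
    by rewrite ii; ring.
  by rewrite -E1 -E2 -E3 -E4; ring.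
have Lf k : L (f k) = 0.
  rewrite fE.
  have d1 := decayB (decP _ (za k)) (decP _ z0).
  have d2 := decayB (decP _ (zb k)) (decP _ z0).
  have d2' := decayZ (0 +i* 1) d2.
  rewrite (functionalZ mtau mr ir _ (decayB d1 d2')).
  rewrite (functionalB mtau mr ir d1 d2') (functionalZ mtau mr ir _ d2).
  rewrite (functionalB mtau mr ir (decP _ (za k)) (decP _ z0)).
  rewrite (functionalB mtau mr ir (decP _ (zb k)) (decP _ z0)).
  by rewrite !LP// !subr0 mulr0 subr0 mulr0.
pose C := 2 + (2 * M ^+ 2 + 1) / y ^+ 2.
have Re_le w : complex.Re w = complex.Re z -> `|complex.Re w| <= M.
  by move=> ->; rewrite lerDl.
have Rea_le k w : complex.Re w = complex.Re z -> `|complex.Re (w + a k)| <= M.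
  by move=> wz; rewrite ReD wz /= (le_trans (ler_normD _ _))// lerD2l gtr0_norm.
have Imz : y <= `|complex.Im z| by exact: ler_norm.
have Imzc : y <= `|complex.Im (conjc z)| by rewrite Im_conjc normrN ler_norm.
have Imza k : y <= `|complex.Im (z + a k)| by rewrite Ima ler_norm.
have Imzb k : y <= `|complex.Im (z + b k)|.
  by rewrite Imb (le_trans _ (ler_norm _))// lerDl ltW.
have Imzca k : y <= `|complex.Im ((conjc z) + a k)|.
  by rewrite ImD Im_conjc /= addr0 normrN ler_norm.
have Imzcb k : y <= `|complex.Im ((conjc z) - b k)|.
  rewrite ImD Im_conjc ImN /= -opprD normrN (le_trans _ (ler_norm _))//.
  by rewrite lerDl ltW.
have Reb k : complex.Re (z + b k) = complex.Re z by rewrite ReD /= addr0.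
have Rebc k : complex.Re ((conjc z) - b k) = complex.Re z.
  by rewrite ReD Re_conjc ReN /= oppr0 addr0.
have Rec : complex.Re (conjc z) = complex.Re z by exact: Re_conjc.
have normc2 (A B E F : R[i]) : normc (2^-1%:C * (A + B - E + F)) <=
    2^-1 * (normc A + normc B + normc E + normc F).
  rewrite normcM normc_real ger0_norm// ler_wpM2l//.
  rewrite (le_trans (le_normcD _ _))// lerD2r (le_trans (normcB _ _))// lerD2r.
  exact: le_normcD.
apply: (@functional_lim0 _ _ _ _ tau r mtau mr ir f
  (fun x => cauchy z x * cauchy z x) (2 * C)) => //.
- move=> k; have mD w c : cmeasurable (D w c).
    by apply: cmeasurableM; exact: measurable_cauchy.
  apply: cmeasurableM; first exact: cmeasurable_cst.
  by apply: cmeasurableD => //; apply: cmeasurableB => //; exact: cmeasurableD.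
- move=> k x; rewrite /f /D; apply: le_trans (normc2 _ _ _ _) _.
  have -> : 2 * C / (1 + x ^+ 2) = 2^-1 * (C / (1 + x ^+ 2) + C / (1 + x ^+ 2) +
      C / (1 + x ^+ 2) + C / (1 + x ^+ 2)) by field; rewrite gt_eqF// ltr_wpDr ?sqr_ge0.
  rewrite ler_wpM2l//.
  by rewrite !lerD//; apply: normc_cauchy2_decay => //; try exact: Re_le;
    exact: Rea_le.
- move=> x; exists (2 * y^-1 ^+ 3) => k.
  have DB w c : complex.Im w != 0 -> complex.Im (w + c) != 0 ->
     y <= `|complex.Im w| -> y <= `|complex.Im (w + c)| -> normc c = h k ->
     normc (D w c x - cauchy w x * cauchy w x) <= y^-1 ^+ 3 * h k.
    move=> w0 wc0 yw ywc ch; rewrite /D -mulrBr cauchyB// !normcM ch.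
    have := normc_cauchy_le x z0 yw; have := normc_cauchy_le x z0 ywc.
    rewrite -/y; set A := normc (cauchy w x); set B := normc _ => By Ay.
    have -> : A * (h k * (A * B)) = A * (A * B) * h k by ring.
    rewrite ler_wpM2r ?(ltW (h0 _))// exprS expr2.
    by rewrite !ler_pM ?mulr_ge0 ?normc_ge0.
  rewrite -/(h k) /f.
  set c2 := cauchy z x * _; pose c3 := cauchy (conjc z) x * cauchy (conjc z) x.
  have -> : 2^-1%:C * (D z (a k) x + D z (b k) x - D (conjc z) (a k) x + D (conjc z) (- b k) x) - c2 =
     2^-1%:C * ((D z (a k) x - c2) + (D z (b k) x - c2) - (D (conjc z) (a k) x - c3)
       + (D (conjc z) (- b k) x - c3)).
    rewrite -[X in _ - X = _](_ : 2^-1%:C * (c2 + c2) = c2); first by ring.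
    have -> : c2 + c2 = 2%:C * c2 by rewrite (rmorphD _ 1 1) /= mulrDl mul1r.
    by rewrite mulrA -rmorphM /= mulVf ?mul1r.
  apply: le_trans (normc2 _ _ _ _) _.
  have -> : 2 * y^-1 ^+ 3 * h k = 2^-1 * (y^-1 ^+ 3 * h k + y^-1 ^+ 3 * h k +
     y^-1 ^+ 3 * h k + y^-1 ^+ 3 * h k) by field; rewrite gt_eqF.
  rewrite ler_wpM2l//.
  have nb : normc (b k) = h k by rewrite /= expr0n add0r sqrtr_sqr gtr0_norm.
  have na : normc (a k) = h k by rewrite normc_real gtr0_norm.
  have nz (w : R[i]) : y <= `|complex.Im w| -> complex.Im w != 0.
    by move=> yw; have := lt_le_trans z0 yw; rewrite normr_gt0.
  by rewrite !lerD//; apply: DB; rewrite ?normcN ?nz.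
Qed.

End functional_cauchy.

(** * From the Nevanlinna condition to plane waves *)

Section product_functions.
Context (R : realType) (n : nat).
Implicit Types (b : 'I_n -> R -> R[i]) (t : 'rV[R]_n).

Definition cauchy_weight t : R := \prod_(l < n) (1 + t 0 l ^+ 2)^-1.

Lemma cauchy_weight_ge0 t : 0 <= cauchy_weight t.
Proof.
by apply: prodr_ge0 => l _; rewrite invr_ge0 addr_ge0// sqr_ge0.
Qed.

Lemma measurable_coord_rV (l : 'I_n) : measurable_fun setT (fun t : 'rV[R]_n => t 0 l).
Proof. exact: measurable_coord. Qed.

Lemma cmeasurable_prod_coord b (p : pred 'I_n) :
  (forall l, cmeasurable (b l)) ->
  cmeasurable (fun t => \prod_(l < n | p l) b l (t 0 l)).
Proof.
move=> mb; apply: cmeasurable_prod => l _.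
by apply: cmeasurable_comp => //; exact: measurable_coord_rV.
Qed.

Lemma normc_prod_decay b (p : pred 'I_n) : (forall l, quadratic_decay (b l)) ->
  exists C : R, forall t, normc (\prod_(l < n | p l) b l (t 0 l)) <=
    C * \prod_(l < n | p l) (1 + t 0 l ^+ 2)^-1.
Proof.
move=> db; have [C hC] : exists C : 'I_n -> R,
    forall l x, normc (b l x) <= C l / (1 + x ^+ 2).
  have /choice[C hC] : forall l, exists C : R, forall x, normc (b l x) <= C / (1 + x ^+ 2).
    by move=> l; have [_] := db l.
  by exists C.
exists (\prod_(l < n | p l) C l) => t; rewrite normc_prod -big_split/=.
by apply: ler_prod => l _; rewrite normc_ge0 hC.
Qed.

Variable mu : {measure set 'rV[R]_n -> \bar R}.
Hypothesis growth : growth_condition mu.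

Lemma measurable_cauchy_weight : measurable_fun setT cauchy_weight.
Proof.
have := @cmeasurable_prod_coord (fun _ x => (1 + x ^+ 2)^-1%:C) predT.
case=> [_|m1 _].
  apply: cmeasurable_real; apply: (measurableT_comp (@measurable_invr R)).
  by apply: measurable_funD => //; exact: exprn_measurable.
move: m1; congr (measurable_fun _ _); apply/funext => t /=.
by rewrite -rmorph_prod.
Qed.

Lemma integrable_cauchy_weight : mu.-integrable setT (EFin \o cauchy_weight).
Proof.
apply/integrableP; split.
  by apply/measurable_EFinP; exact: measurable_cauchy_weight.
under eq_integral do rewrite /= ger0_norm ?cauchy_weight_ge0//.
exact: growth.
Qed.

(** One coordinate is exchanged at a time: at stage m, the coordinates l < m carry functions from
    [Q] and the others from [P]. The fixed coordinates form the weight [r], which is why the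
    one-variable statements admit an arbitrary weight. *)
Lemma replace_coordinates (P Q : 'I_n -> (R -> R[i]) -> Prop) :
  (forall l c, P l c -> quadratic_decay c) ->
  (forall l c, Q l c -> quadratic_decay c) ->
  (forall l (r : 'rV[R]_n -> R[i]), cmeasurable r ->
    mu.-integrable setT (fun t => (normc (r t) / (1 + t 0 l ^+ 2))%:E) ->
    (forall c, P l c -> cintegral mu (fun t => r t * c (t 0 l)) = 0) ->
    forall c, Q l c -> cintegral mu (fun t => r t * c (t 0 l)) = 0) ->
  (forall b, (forall l, P l (b l)) ->
    cintegral mu (fun t => \prod_(l < n) b l (t 0 l)) = 0) ->
  forall b, (forall l, Q l (b l)) ->
    cintegral mu (fun t => \prod_(l < n) b l (t 0 l)) = 0.
Proof.
move=> dP dQ step P0 b Qb.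
suff : forall m b, (forall l : 'I_n, if (l < m)%N then Q l (b l) else P l (b l)) ->
    cintegral mu (fun t => \prod_(l < n) b l (t 0 l)) = 0.
  by move=> /(_ n b); apply => l; rewrite ltn_ord.
move=> {b Qb} m; elim: m => [|m IHm] b hb; first exact: P0.
have [nm|mn] := leqP n m.
  apply: IHm => l; have := hb l; rewrite ltnS.
  by rewrite (leq_trans (ltn_ord l) nm) ltnW// (leq_trans (ltn_ord l) nm).
pose l0 := Ordinal mn.
have db l : quadratic_decay (b l) by have := hb l; case: ifP => _; [exact: dQ|exact: dP].
pose r t := \prod_(l < n | l != l0) b l (t 0 l).
under eq_fun do rewrite (bigD1 l0)//= mulrC -/(r _).
apply: (step l0 r).
- by apply: cmeasurable_prod_coord => l; have [] := db l.
- have [C hC] := normc_prod_decay (fun l => l != l0) db.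
  apply: (le_integrable _ _ _ (integrableZl _ C integrable_cauchy_weight)) => //.
    apply/measurable_EFinP; apply: measurable_funM.
      by apply: measurable_normc; apply: cmeasurable_prod_coord => l; have [] := db l.
    apply: (measurableT_comp (@measurable_invr R)).
    apply: measurable_funD => //; apply: measurable_funX; exact: measurable_coord_rV.
  move=> t _ /=; rewrite lee_fin.
  have p0 : 0 < 1 + t 0 l0 ^+ 2 by rewrite ltr_wpDr ?sqr_ge0.
  rewrite ger0_norm ?divr_ge0 ?normc_ge0 ?(ltW p0)//.
  apply: le_trans (ler_norm _); rewrite /cauchy_weight (bigD1 l0)//=.
  by rewrite [leRHS]mulrCA [leRHS]mulrC ler_pM2r ?invr_gt0 ?hC.
- move=> c Pc; pose b1 l := if l == l0 then c else b l.
  transitivity (cintegral mu (fun t => \prod_(l < n) b1 l (t 0 l))).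
    congr cintegral; apply/funext => t; rewrite [RHS](bigD1 l0)//= [RHS]mulrC.
    congr (_ * _); last by rewrite /b1 eqxx.
    by apply: eq_bigr => l ll0; rewrite /b1 (negbTE ll0).
  apply: IHm => l; rewrite /b1; case: eqVneq => [->|ll0]; first by rewrite ltnn.
  by have := hb l; rewrite ltnS leq_eqVlt -[X in X || _]/(l == l0) (negbTE ll0).
- by have := hb l0; rewrite /= ltnSn.
Qed.

End product_functions.

Section regularizer.
Context {R : realType}.
Implicit Types (e s x : R).

Definition exp_wave s x : R[i] := cexpi (- (s * x)).

Lemma measurable_exp_wave s : cmeasurable (exp_wave s).
Proof.
apply: cmeasurable_cexpi; apply: measurable_funN; exact: mulrl_measurable.
Qed.

Lemma normc_resolvB1 s x : normc (resolv s x - 1) <= `|s| * `|x|.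
Proof.
have r0 : resolv 0 x = 1 by rewrite /resolv mul0r; exact: invr1.
rewrite -r0 resolv_sub !normcM normc_real sub0r normrN r0 normc1 mulr1.
have -> : normc (0 +i* x) = `|x| by rewrite /= expr0n add0r sqrtr_sqr.
by rewrite ler_piMr ?normc_resolv_le1// mulr_ge0.
Qed.

Lemma normc_resolv2B1 s s' x :
  normc (resolv s x * resolv s' x - 1) <= (`|s| + `|s'|) * `|x|.
Proof.
have -> : resolv s x * resolv s' x - 1 =
  (resolv s x - 1) * resolv s' x + (resolv s' x - 1) by ring.
rewrite [leRHS]mulrDl (le_trans (le_normcD _ _))// lerD ?normc_resolvB1//.
rewrite normcM (le_trans _ (normc_resolvB1 _ _))//.
by rewrite ler_piMr ?normc_ge0 ?normc_resolv_le1.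
Qed.

End regularizer.

(** * Annihilated exponentials on each half-line and on the whole line *)

Section half_line_functionals.
Context d (T : measurableType d) (R : realType) (mu : {measure set T -> \bar R}).
Variables (tau : T -> R) (r : T -> R[i]).
Hypotheses (mtau : measurable_fun setT tau) (mr : cmeasurable r).
Hypothesis ir :
  mu.-integrable setT (fun t => (normc (r t) / (1 + tau t ^+ 2))%:E).

Local Notation L b := (cintegral mu (fun t => r t * b (tau t))).

Let irN :
  mu.-integrable setT (fun t => (normc (r t) / (1 + (- tau t) ^+ 2))%:E).
Proof. by under eq_fun do rewrite sqrrN. Qed.

Let mtauN : measurable_fun setT (fun t => - tau t).
Proof. exact: measurable_funN. Qed.

Let cauchyN (z : R[i]) (x : R) : cauchy z (- x) = - cauchy (- z) x.
Proof.
by rewrite /cauchy -invrN opprB rmorphN /= addrC.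
Qed.

Lemma functional_upper :
  (forall z : R[i], 0 < complex.Im z -> L (fun x => cauchy z x * cauchy z x) = 0) ->
  forall s e : R, 0 < s -> 0 < e ->
    L (fun x => resolv e x * resolv (2 * e) x * exp_wave s x) = 0.
Proof.
move=> Lz s e s0 e0; apply: functional_positive => //.
exact: functional_resolv_of_cauchy.
Qed.

(** Reflection: replacing x by -x moves a pole z to -z, and [- conjc z] lies in the upper half-plane
    when z does. The sign of s is reversed at the same time. *)
Lemma functional_lower :
  (forall z : R[i], 0 < complex.Im z ->
    L (fun x => cauchy (conjc z) x * cauchy (conjc z) x) = 0) ->
  forall s e : R, s < 0 -> 0 < e ->
    L (fun x => resolv (- e) x * resolv (- (2 * e)) x * exp_wave s x) = 0.
Proof.
move=> Lz s e s0 e0.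
transitivity (cintegral mu (fun t => r t * (fun x => resolv e x * resolv (2 * e) x *
    cexpi (- (- s * x))) (- tau t))).
  by congr cintegral; apply/funext => t; rewrite !resolvN mulrNN.
apply: (functional_positive mtauN mr irN) => //; last by rewrite oppr_gt0.
apply: (functional_resolv_of_cauchy mtauN mr irN) => z z0.
have := Lz (- conjc z); rewrite ImN Im_conjc opprK => /(_ z0) => <-.
congr cintegral; apply/funext => t; congr (_ * _); rewrite !cauchyN mulrNN.
by rewrite conjcN conjcK.
Qed.

(** Annihilating the Poisson kernels implies annihilating the squares, hence the case s >= 0. Up to
    sign, reflection maps Poisson kernels to Poisson kernels, which gives the case s < 0 as well. *)
Lemma functional_line :
  (forall z : R[i], 0 < complex.Im z ->
    L (fun x => cauchy z x - cauchy (conjc z) x) = 0) ->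
  forall s e : R, 0 < e ->
    L (fun x => resolv e x * resolv (- e) x * exp_wave s x) = 0.
Proof.
move=> Lz s e e0; have [s0|s0] := leP 0 s.
  apply: functional_poisson_positive => //.
    by apply: functional_resolv_of_cauchy => //; exact: functional_cauchy_sq.
  exact: functional_poisson_of_cauchy.
transitivity (cintegral mu (fun t => r t * (fun x => resolv e x * resolv (- e) x *
    cexpi (- (- s * x))) (- tau t))).
  congr cintegral; apply/funext => t; rewrite !resolvN mulrNN opprK.
  by rewrite [resolv (- e) _ * _]mulrC.
have LzN (z : R[i]) : 0 < complex.Im z ->
    cintegral mu (fun t => r t * (fun x => cauchy z x - cauchy (conjc z) x) (- tau t)) = 0.
  move=> z0; have := Lz (- conjc z); rewrite ImN Im_conjc opprK => /(_ z0) => <-.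
  congr cintegral; apply/funext => t; congr (_ * _); rewrite !cauchyN.
  by rewrite conjcN conjcK opprK addrC.
apply: (functional_poisson_positive mtauN mr irN) => //.
- apply: (functional_resolv_of_cauchy mtauN mr irN) => //.
  exact: (functional_cauchy_sq mtauN mr irN).
- exact: (functional_poisson_of_cauchy mtauN mr irN).
- by rewrite oppr_ge0 ltW.
Qed.

End half_line_functionals.

Section translates.
Context (R : realType) (n : nat) (mu : {measure set 'rV[R]_n -> \bar R}).
Hypothesis growth : growth_condition mu.

Definition plane_wave (s t : 'rV[R]_n) : R[i] := cexpi (- dot s t).

Lemma plane_wave_prod s t : plane_wave s t = \prod_(l < n) exp_wave (s 0 l) (t 0 l).
Proof. by rewrite /plane_wave /dot -sumrN cexpi_sum. Qed.

Lemma normc_plane_wave s t : normc (plane_wave s t) = 1.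
Proof. exact: normc_cexpi. Qed.

Lemma dotC (s t : 'rV[R]_n) : dot s t = dot t s.
Proof. by apply: eq_bigr => l _; rewrite mulrC. Qed.

Lemma dotDl (s s' t : 'rV[R]_n) : dot (s + s') t = dot s t + dot s' t.
Proof.
by rewrite /dot -big_split/=; apply: eq_bigr => l _; rewrite mxE mulrDl.
Qed.

Lemma dotNl (s t : 'rV[R]_n) : dot (- s) t = - dot s t.
Proof. by rewrite /dot -sumrN; apply: eq_bigr => l _; rewrite mxE mulNr. Qed.

Lemma plane_waveD s s' t : plane_wave (s + s') t = plane_wave s t * plane_wave s' t.
Proof. by rewrite /plane_wave dotDl opprD cexpiD. Qed.

Lemma plane_wave_conj s t : conjc (plane_wave s t) = plane_wave (- s) t.
Proof. by rewrite /plane_wave -cexpiN dotNl. Qed.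

Lemma measurable_dot (s : 'rV[R]_n) : measurable_fun setT (fun t : 'rV[R]_n => dot s t).
Proof.
apply: measurable_sum => l; apply: measurable_funM; first exact: measurable_cst.
exact: measurable_coord_rV.
Qed.

Lemma measurable_plane_wave (s : 'rV[R]_n) : cmeasurable (plane_wave s).
Proof. by apply: cmeasurable_cexpi; apply: measurable_funN; exact: measurable_dot. Qed.

Definition nevanlinna_factor (j1 j2 l : 'I_n) (z : R[i]) (x : R) : R[i] :=
  if l == j1 then cauchy z x * cauchy z x
  else if l == j2 then cauchy (conjc z) x * cauchy (conjc z) x
  else cauchy z x - cauchy (conjc z) x.

Lemma nevanlinna_kernel_prod (j1 j2 : 'I_n) z t : j1 != j2 ->
  nevanlinna_kernel z j1 j2 t =
  \prod_(l < n) nevanlinna_factor j1 j2 l (z 0 l) (t 0 l).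
Proof.
move=> j12; rewrite (bigD1 j1)//= (bigD1 j2)//= 1?eq_sym//.
rewrite mulrA /nevanlinna_kernel; congr (_ * _).
  rewrite /nevanlinna_factor !eqxx eq_sym (negbTE j12) invfM !expr2 !invfM.
  by [].
by apply: eq_bigr => l /andP[/negbTE l1 /negbTE l2]; rewrite /nevanlinna_factor l1 l2.
Qed.

Lemma decay_nevanlinna_factor j1 j2 l z : 0 < complex.Im z ->
  quadratic_decay (nevanlinna_factor j1 j2 l z).
Proof.
move=> z0; have z1 : complex.Im z != 0 by rewrite gt_eqF.
have z2 : complex.Im (conjc z) != 0 by rewrite Im_conjc oppr_eq0.
rewrite /nevanlinna_factor; case: eqP => _; first exact: decay_cauchy2.
case: eqP => _; first exact: decay_cauchy2.
exact: decay_cauchyB.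
Qed.

(** Each branch is the factor produced by the matching one-variable result: [functional_upper],
    [functional_lower], [functional_line]. *)
Definition regularizer (j1 j2 l : 'I_n) (e x : R) : R[i] :=
  if l == j1 then resolv e x * resolv (2 * e) x
  else if l == j2 then resolv (- e) x * resolv (- (2 * e)) x
  else resolv e x * resolv (- e) x.

Lemma decay_regularizer j1 j2 l e : 0 < e ->
  quadratic_decay (regularizer j1 j2 l e).
Proof.
move=> e0; have e1 : e != 0 by rewrite gt_eqF.
have e2 : 2 * e != 0 by rewrite mulf_neq0.
by rewrite /regularizer; case: eqP => _; [|case: eqP => _];
  apply: decay_resolv2; rewrite ?oppr_eq0.
Qed.

Lemma normc_regularizer_le1 j1 j2 l e x : normc (regularizer j1 j2 l e x) <= 1.
Proof.
by rewrite /regularizer; case: eqP => _; [|case: eqP => _];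
  rewrite normcM mulr_ile1 ?normc_ge0 ?normc_resolv_le1.
Qed.

Lemma normc_regularizerB1 j1 j2 l e x : 0 < e ->
  normc (regularizer j1 j2 l e x - 1) <= 3 * `|x| * e.
Proof.
move=> e0; rewrite mulrAC /regularizer; case: eqP => _; [|case: eqP => _];
  apply: le_trans (normc_resolv2B1 _ _ _) _; apply: ler_wpM2r => //;
  by rewrite ?normrN ?normrM (gtr0_norm e0) ?(@gtr0_norm _ 2)//; lra.
Qed.

(** The condition holds for every choice of the z_l separately, so the kernels form a product family
    to which [replace_coordinates] applies. The signs of s matter at j1 and j2 only. *)
Lemma nevanlinna_regularized (j1 j2 : 'I_n) : j1 != j2 ->
  (forall z : 'rV[R[i]]_n, (forall l, 0 < complex.Im (z 0 l)) ->
    cintegral mu (nevanlinna_kernel z j1 j2) = 0) ->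
  forall (s : 'rV[R]_n) e, 0 < s 0 j1 -> s 0 j2 < 0 -> 0 < e ->
  cintegral mu (fun t => (\prod_(l < n) regularizer j1 j2 l e (t 0 l)) *
    plane_wave s t) = 0.
Proof.
move=> j12 nev s e s1 s2 e0.
under eq_fun do rewrite plane_wave_prod -big_split/=.
apply: (@replace_coordinates _ _ mu growth
  (fun l c => exists2 z : R[i], 0 < complex.Im z & c = nevanlinna_factor j1 j2 l z)
  (fun l c => c = fun x => regularizer j1 j2 l e x * exp_wave (s 0 l) x)
  _ _ _ _ (fun l x => regularizer j1 j2 l e x * exp_wave (s 0 l) x)) => //.
- by move=> l _ [z z0 ->]; exact: decay_nevanlinna_factor.
- move=> l _ ->; apply: (@decayM _ _ _ 1); first exact: decay_regularizer.
    exact: measurable_exp_wave.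
  by move=> x; rewrite normc_cexpi.
- move=> l r mr ir Lr _ ->; rewrite /regularizer.
  have {}Lr z : 0 < complex.Im z ->
      cintegral mu (fun t => r t * nevanlinna_factor j1 j2 l z (t 0 l)) = 0.
    by move=> z0; apply: Lr; exists z.
  move: Lr; rewrite /nevanlinna_factor; case: eqVneq => [lj1|lj1] Lr.
    by apply: (functional_upper (measurable_coord_rV _) mr ir) => //; rewrite lj1.
  move: Lr; case: eqVneq => [lj2|lj2] Lr.
    by apply: (functional_lower (measurable_coord_rV _) mr ir) => //; rewrite lj2.
  exact: (functional_line (measurable_coord_rV _) mr ir).
- move=> b hb; have /choice[z zb] : forall l, exists z : R[i],
      0 < complex.Im z /\ b l = nevanlinna_factor j1 j2 l z.
    by move=> l; have [z] := hb l; exists z.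
  transitivity (cintegral mu (nevanlinna_kernel (\row_l z l) j1 j2)).
    congr cintegral; apply/funext => t; rewrite nevanlinna_kernel_prod//.
    by apply: eq_bigr => l _; rewrite mxE; have [_ ->] := zb l.
  by apply: nev => l; rewrite mxE; have [] := zb l.
Qed.

(** Precisely the properties of the regularizers that the support argument uses. Stated in this way
    they are preserved by conjugation, which exchanges j1 and j2. *)
Definition approximate_unit (j1 j2 : 'I_n) := exists reg : nat -> 'rV[R]_n -> R[i],
  [/\ forall k, cintegrable mu (reg k),
      forall k t, normc (reg k t) <= 1,
      forall t, exists K : R, forall k, normc (reg k t - 1) <= K * k.+1%:R^-1 &
      forall k (s : 'rV[R]_n), 0 < s 0 j1 -> s 0 j2 < 0 ->
        cintegral mu (fun t => reg k t * plane_wave s t) = 0].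

Lemma nevanlinna_approximate_unit (j1 j2 : 'I_n) : j1 != j2 ->
  (forall z : 'rV[R[i]]_n, (forall l, 0 < complex.Im (z 0 l)) ->
    cintegral mu (nevanlinna_kernel z j1 j2) = 0) ->
  approximate_unit j1 j2.
Proof.
move=> j12 nev.
pose reg k (t : 'rV[R]_n) := \prod_(l < n) regularizer j1 j2 l k.+1%:R^-1 (t 0 l).
have k0 k : 0 < k.+1%:R^-1 :> R by rewrite invr_gt0.
exists reg; split.
- move=> k; have dr l := decay_regularizer j1 j2 l (k0 k).
  have [C hC] := normc_prod_decay predT dr.
  apply: (@cintegrable_le _ _ _ _ _ (fun t => C * cauchy_weight t)) => //.
  + apply: (@cmeasurable_prod_coord _ _ (fun l => regularizer j1 j2 l k.+1%:R^-1)).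
    by move=> l; have [] := dr l.
  + exact: (integrableZl _ C (integrable_cauchy_weight growth)).
- by move=> k t; apply: normc_prod_le1 => l _; exact: normc_regularizer_le1.
- move=> t; exists (\sum_(l < n) 3 * `|t 0 l|) => k.
  have -> : 1 = \prod_(l < n) 1 :> R[i] by rewrite big1.
  apply: le_trans (normc_prodB _ _ _) _ => [l|l|].
  + exact: normc_regularizer_le1.
  + by rewrite normc1.
  + by rewrite mulr_suml; apply: ler_sum => l _; exact: normc_regularizerB1.
- by move=> k s s1 s2; exact: nevanlinna_regularized.
Qed.

(* Conjugation maps [plane_wave s] to [plane_wave (- s)]. *)
Lemma approximate_unit_sym (j1 j2 : 'I_n) :
  approximate_unit j1 j2 -> approximate_unit j2 j1.
Proof.
move=> [reg [ireg reg1 regB reg0]]; exists (fun k t => conjc (reg k t)); split.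
- by move=> k; exact: cintegrable_conj.
- by move=> k t; rewrite normc_conj.
- move=> t; have [K hK] := regB t; exists K => k.
  by rewrite -[1]conjc1 -conjcN -conjcD normc_conj.
- move=> k s s1 s2.
  have := reg0 k (- s); rewrite !mxE oppr_gt0 oppr_lt0 => /(_ s2 s1) h.
  transitivity (cintegral mu (fun t => conjc (reg k t * plane_wave (- s) t))).
    congr cintegral; apply/funext => t.
    by rewrite conjcM plane_wave_conj opprK.
  rewrite cintegral_conj ?h ?conjc0//.
  apply: (@cintegrableMr _ _ _ _ _ _ 1) => //; first exact: measurable_plane_wave.
  by move=> t; rewrite normc_plane_wave.
Qed.

End translates.

(** * Test functions and their Fourier transforms *)

(** Equips the pushforward with a measure structure, so that uniqueness theorems for measures apply
    to it. *)
Lemma pushforward_measureE d1 d2 (T1 : measurableType d1)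
    (T2 : measurableType d2) (R : realType) (m : {measure set T1 -> \bar R})
    (f : T1 -> T2) : measurable_fun setT f ->
  exists m' : {measure set T2 -> \bar R}, m' = pushforward m f :> (set T2 -> \bar R).
Proof.
move=> mf.
by exists (measure_function_pushforward__canonical__measure_function_Measure m mf).
Qed.

(** * Translation invariance of Lebesgue measure *)

Section euclidean_lebesgue.
Context {R : realType}.

Lemma continuous_measurable_rV n (f : 'rV[R]_n -> R) :
  continuous f -> measurable_fun setT f.
Proof.
move=> cf; apply: (measurability _ (measurable_realfun.RGenOpens.measurableE R)).
move=> _ [_ [a [b ->]] <-].
rewrite setTI; apply: open_measurable_mx.
by apply: open_comp; [move=> + _; exact: cf|exact: interval_open].
Qed.

Lemma measurable_translate n (a : 'rV[R]_n) :
  measurable_fun setT (fun v : 'rV[R]_n => v + a).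
Proof.
apply/measurable_fun_mxP => i j; under eq_fun do rewrite mxE.
by apply: measurable_funD => //; exact: measurable_coord.
Qed.

Lemma lebesgue_measure_translate (a : R) (A : set R) : measurable A ->
  lebesgue_measure ((fun x => x + a) @^-1` A) = lebesgue_measure A.
Proof.
move=> mA; have ma : measurable_fun [set: measurableTypeR R]
    ((fun x => x + a) : measurableTypeR R -> measurableTypeR R).
  by apply: measurable_funD => //; exact: measurable_cst.
have [mua muaE] := pushforward_measureE (@lebesgue_measure R) ma.
suff h X : ocitv X -> lebesgue_measure X = mua X.
  by rewrite [RHS](lebesgue_measure_unique h mA) muaE.
move=> [[x y] _ <-]; rewrite muaE /pushforward.
transitivity (lebesgue_measure (`]x - a, y - a]%classic : set R)).
  rewrite !lebesgue_measure_itv/= !lte_fin ltrD2r.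
  by case: ifP => // _; rewrite -!EFinB; congr EFin; ring.
congr lebesgue_measure; apply/seteqP.
by split=> z /=; rewrite !in_itv /= ltrBlDr lerBrDr.
Qed.

(** Induction on n: translation splits into one on R and one on R^n, the translated measure has the
    right value on rectangles, and the product measure is unique. *)
Lemma lebesgue_rV_translate n (a : 'rV[R]_n) (A : set 'rV[R]_n) :
  measurable A ->
  lebesgue_rV R n ((fun v => v + a) @^-1` A) = lebesgue_rV R n A.
Proof.
elim: n a A => [a A mA|n IHn a A mA].
  congr (lebesgue_rV R 0 _); apply/seteqP.
  by split=> v /=; rewrite (_ : v + a = v)//; apply/rowP => -[].
have mA' : measurable (@cons_rV R n @^-1` A).
  by rewrite -[X in measurable X]setTI; exact: (@measurable_cons_rV R n measurableT _ mA).
set m := lebesgue_rV R n in IHn *.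
pose sh (p : measurableTypeR R * 'rV[R]_n) : measurableTypeR R * 'rV[R]_n :=
  (p.1 + (uncons_rV a).1, p.2 + (uncons_rV a).2).
have msh : measurable_fun setT sh.
  apply: measurable_fun_pair.
    by apply: measurable_funD; [exact: measurable_fst|exact: measurable_cst].
  exact: (measurableT_comp (measurable_translate _) measurable_snd).
have cons_sh p : cons_rV p + a = cons_rV (sh p).
  apply/rowP => i; rewrite mxE; case: (unliftP 0 i) => [k ->|->].
    by rewrite !cons_rVS !mxE; congr (_ + a _ _); apply: val_inj.
  by rewrite !cons_rV0.
have [m' m'E] := pushforward_measureE (@lebesgue_measure R \x m)%E msh.
change ((@lebesgue_measure R \x m)%E (@cons_rV R n @^-1` ((fun v => v + a) @^-1` A)) =
  (@lebesgue_measure R \x m)%E (@cons_rV R n @^-1` A)).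
transitivity (m' (@cons_rV R n @^-1` A)).
  rewrite m'E /pushforward; congr (product_measure1 _ _ _).
  by apply/seteqP; split=> p /=; rewrite cons_sh.
apply/esym; apply: (@product_measure_unique _ _ _ _ _ (@lebesgue_measure R) m m') => //.
move=> B C mB mC.
rewrite m'E /pushforward.
rewrite (_ : sh @^-1` (B `*` C) = ((fun x => x + (uncons_rV a).1) @^-1` B) `*`
  ((fun v => v + (uncons_rV a).2) @^-1` C))//.
apply: etrans (product_measure1E _ _ _ _) _.
- have mtr : measurable_fun [set: measurableTypeR R]
      ((fun x => x + (uncons_rV a).1) : measurableTypeR R -> measurableTypeR R).
    by apply: measurable_funD => //; exact: measurable_cst.
  by rewrite -[X in measurable X]setTI; exact: (mtr measurableT _ mB).
- by rewrite -[X in measurable X]setTI; exact: (measurable_translate _ measurableT mC).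
- by congr (_ * _)%E; [exact: lebesgue_measure_translate|exact: IHn].
Qed.

Lemma cintegral_translate n (f : 'rV[R]_n -> R[i]) (a : 'rV[R]_n) :
  cmeasurable f -> cintegrable (lebesgue_rV R n) (fun x => f (x + a)) ->
  cintegral (lebesgue_rV R n) (fun x => f (x + a)) = cintegral (lebesgue_rV R n) f.
Proof.
move=> mf If.
suff h (g : 'rV[R]_n -> R) : measurable_fun setT g ->
    (lebesgue_rV R n).-integrable setT (fun x => (g (x + a))%:E) ->
    \int[lebesgue_rV R n]_x g (x + a) = \int[lebesgue_rV R n]_x g x.
  apply: complex_ext => /=; apply: (h (fun x => _ (f x))).
  - by have [] := mf.
  - exact: cintegrable_Re If.
  - by have [] := mf.
  - exact: cintegrable_Im If.
move=> mg ig; rewrite /Rintegral; congr fine.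
have mEg : measurable_fun [set: 'rV[R]_n] (EFin \o g) by exact/measurable_EFinP.
have [m' m'E] := pushforward_measureE (lebesgue_rV R n) (measurable_translate a).
transitivity
  (\int[pushforward (lebesgue_rV R n) (fun v : 'rV[R]_n => (v + a)%R)]_x (g x)%:E)%E.
  by rewrite (integral_pushforward (measurable_translate a) mEg).
rewrite -m'E; apply: eq_measure_integral => A mA _.
by rewrite m'E; exact: lebesgue_rV_translate.
Qed.

End euclidean_lebesgue.

(** * Cubes and functions of bounded support *)

Section boxes.
Context {R : realType} {n : nat}.
Implicit Types (x v : 'rV[R]_n) (N M : R).

Definition cube N : set 'rV[R]_n := [set v | forall l, `[- N, N]%classic (v 0 l)].

Lemma cubeP N v : cube N v <-> forall l, `|v 0 l| <= N.
Proof. by split=> h l; have := h l; rewrite /= in_itv /= ler_norml. Qed.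

Lemma measurable_cube N : measurable (cube N).
Proof.
rewrite (_ : cube N = \bigcap_(l in [set: 'I_n])
    (fun v : 'rV[R]_n => v 0 l) @^-1` `[- N, N]%classic); last first.
  by apply/seteqP; split=> v h l; [move=> _|]; exact: h.
apply: fin_bigcap_measurable => // l _.
by rewrite -[X in measurable X]setTI; apply: measurable_coord.
Qed.

Lemma lebesgue_cube_fin N : (lebesgue_rV R n (cube N) < +oo)%E.
Proof.
rewrite (lebesgue_rV_box (A := fun=> `[- N, N]%classic))//.
rewrite ltey_eq; apply/orP; left.
elim/big_ind : _ => [//|a b|l _]; first exact: fin_numM.
by rewrite lebesgue_measure_itv/=; case: ifP.
Qed.

Lemma compact_cube (K : set 'rV[R]_n) : compact K ->
  exists2 N, 0 <= N & K `<=` cube N.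
Proof.
move=> /compact_bounded[M [_ KM]]; exists (`|M| + 1); first exact: addr_ge0.
move=> v Kv; apply/cubeP => l; have := KM (`|M| + 1) _ v Kv.
rewrite ltr_pwDr ?ler_norm// => /(_ isT); apply: le_trans.
have -> : `|v| = mx_norm v by [].
rewrite mx_normrE.
exact: (@le_bigmax _ _ _ (0 : R) (fun ij : 'I_1 * 'I_n => `|v ij.1 ij.2|) (0, l)).
Qed.

Lemma integrable_cube N M : (lebesgue_rV R n).-integrable setT
  (fun x => (M * \1_(cube N) x)%:E).
Proof.
suff h : (lebesgue_rV R n).-integrable setT (fun x => (\1_(cube N) x)%:E).
  exact: (integrableZl _ M h).
apply/integrableP; split.
  by apply/measurable_EFinP; apply: measurable_indic; exact: measurable_cube.
under eq_integral do rewrite /= ger0_norm//.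
rewrite integral_indic ?setIT; [|exact: measurableT|exact: measurable_cube].
exact: lebesgue_cube_fin.
Qed.

(** A single integrable majorant, a multiple of the indicator of a cube, serves integrability,
    domination and Fubini alike. *)
Definition cube_bounded (f : 'rV[R]_n -> R[i]) := cmeasurable f /\
  exists M N, forall x, normc (f x) <= M * \1_(cube N) x.

Lemma cube_bounded_integrable f : cube_bounded f ->
  cintegrable (lebesgue_rV R n) f.
Proof.
move=> [mf [M [N hMN]]].
by apply: (cintegrable_le mf _ hMN); exact: integrable_cube.
Qed.

Lemma cube_boundedM f g : cube_bounded f -> cmeasurable g ->
  (forall x, normc (g x) <= 1) -> cube_bounded (fun x => f x * g x).
Proof.
move=> [mf [M [N hMN]]] mg g1; split; first exact: cmeasurableM.
exists M, N => x; rewrite normcM; apply: le_trans (hMN x).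
by rewrite ler_piMr ?normc_ge0.
Qed.

Lemma fsupportP (f : 'rV[R]_n -> R[i]) x : ~ fsupport f x -> f x = 0.
Proof.
move=> fx; apply/eqP; apply: contrapT => /negP f0; apply: fx.
exact: subset_closure.
Qed.

Lemma cube_bounded_continuous f : continuous (fun x => complex.Re (f x)) ->
  continuous (fun x => complex.Im (f x)) -> compact (fsupport f) -> cube_bounded f.
Proof.
move=> cRe cIm csupp.
split; first by split; exact: continuous_measurable_rV.
have bnd (g : 'rV[R]_n -> R) : continuous g ->
    exists M, forall x, fsupport f x -> `|g x| <= M.
  move=> cg; have /compact_bounded[M [_ hM]] : compact (g @` fsupport f).
    by apply: continuous_compact => //; exact: continuous_subspaceT.
  exists (`|M| + 1) => x fx; apply: hM; last by exists x.
  by rewrite ltr_pwDr ?ler_norm.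
have [M1 h1] := bnd _ cRe; have [M2 h2] := bnd _ cIm.
have [N _ hN] := compact_cube csupp.
exists (`|M1| + `|M2|), N => x; rewrite indicE.
have [fx|fx] := pselect (fsupport f x).
  rewrite mem_set ?mulr1; last exact: hN.
  rewrite (le_trans (ler_normc_ReIm _))// lerD//.
    by rewrite (le_trans (h1 _ fx))// ler_norm.
  by rewrite (le_trans (h2 _ fx))// ler_norm.
by rewrite (fsupportP fx) normc0 mulr_ge0// addr_ge0.
Qed.

End boxes.

(** * Directional derivatives and test functions *)

Section directional_derivatives.
Context {R : realType} {n : nat}.
Implicit Types (f : 'rV[R]_n -> R) (x e : 'rV[R]_n).

Lemma is_derive_line f x e (s : R) : (forall y, derivable f y e) ->
  is_derive s 1 (fun v : R => f (x + v *: e)) ('D_e f (x + s *: e)).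
Proof.
move=> df.
have E : (fun h : R => h^-1 *: (((fun v : R => f (x + v *: e)) \o shift s) (h *: 1)
      - f (x + s *: e))) =
    (fun h : R => h^-1 *: ((f \o shift (x + s *: e)) (h *: e) - f (x + s *: e))).
  apply/funext => h /=; congr (_ *: (f _ - _)).
  by rewrite scalerDl addrCA -scalerA scale1r.
apply: DeriveDef; first by rewrite /derivable E; exact: df.
by rewrite /derive E.
Qed.

Lemma ler_derive_line f x e (h M : R) : (forall y, derivable f y e) ->
  (forall y, `|'D_e f y| <= M) -> `|f (x + h *: e) - f x| <= M * `|h|.
Proof.
move=> df dM.
have := @ler_mvt _ (fun v : R => f (x + v *: e)) (fun v => 'D_e f (x + v *: e)) 0 h M.
by rewrite scale0r addr0 subr0; apply=> // v; exact: is_derive_line.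
Qed.

Lemma cvg_difference_quotient f x e : derivable f x e ->
  k.+1%:R * (f (x + k.+1%:R^-1 *: e) - f x) @[k --> \oo] --> 'D_e f x.
Proof.
move=> df.
have /cvgr_dnbhsP h : (fun h => h^-1 *: ((f \o shift x) (h *: e) - f x)) @ 0^' -->
   'D_e f x by exact: df.
have h0 : (forall k, (k.+1%:R^-1 : R) != 0) /\ (k.+1%:R^-1 @[k --> \oo] --> (0 : R)).
  by split=> [k|]; [rewrite invr_eq0 pnatr_eq0|exact: cvg_harmonic].
by have := h _ h0; under eq_fun do rewrite /= invrK [_ *: e + x]addrC.
Qed.

Lemma translate_quotient f a x e :
  (fun h : R => h^-1 *: (((fun y => f (y + a)) \o shift x) (h *: e) - f (x + a))) =
  (fun h : R => h^-1 *: ((f \o shift (x + a)) (h *: e) - f (x + a))).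
Proof. by apply/funext => h /=; rewrite addrA. Qed.

Lemma derive_translate f a x e :
  'D_e (fun y => f (y + a)) x = 'D_e f (x + a).
Proof. by rewrite /derive translate_quotient. Qed.

Lemma derivable_translate f a x e : derivable f (x + a) e ->
  derivable (fun y => f (y + a)) x e.
Proof. by rewrite /derivable translate_quotient. Qed.

End directional_derivatives.

Section test_functions.
Context {R : realType} {n : nat}.
Implicit Types (f : 'rV[R]_n -> R) (phi : 'rV[R]_n -> R[i]) (x t a : 'rV[R]_n).

Lemma smooth_continuous f : smooth f -> continuous f.
Proof. by move=> /(_ [::])[]. Qed.

Lemma smooth_derivable f : smooth f -> forall l x, derivable f x (delta_mx 0 l).
Proof. by move=> /(_ [::])[]. Qed.

Lemma smooth_derive f l : smooth f -> smooth ('D_(delta_mx 0 l) f).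
Proof.
move=> sf s; have := sf (rcons s l).
by rewrite /partial_deriv foldr_rcons.
Qed.

Lemma continuous_translate a : continuous (fun y : 'rV[R]_n => y + a).
Proof.
move=> y; apply: (@cvgD R 'rV[R]_n _ (nbhs y) _ id (fun=> a) y a).
  exact: cvg_id.
exact: cvg_cst.
Qed.

Lemma smooth_translate f a : smooth f -> smooth (fun x => f (x + a)).
Proof.
move=> sf s.
have -> : partial_deriv s (fun x => f (x + a)) = fun x => partial_deriv s f (x + a).
  elim: s => [//|l s IHs] /=; rewrite IHs; apply/funext => x.
  exact: derive_translate.
have [cs ds] := sf s; split.
  move=> x; apply: (@continuous_comp _ _ _ (fun x => x + a) (partial_deriv s f));
    last exact: cs.
  exact: continuous_translate.
by move=> l x; apply: derivable_translate; exact: ds.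
Qed.

Lemma fsupport_translate phi a x : fsupport (fun y => phi (y + a)) x ->
  fsupport phi (x + a).
Proof.
move=> xs; have cl : closed ((fun y => y + a) @^-1` fsupport phi).
  by apply: closed_comp => [y _|]; [exact: continuous_translate|exact: closed_closure].
move: xs; rewrite /fsupport closureE => /(_ _)/= h.
apply: (h ((fun y => y + a) @^-1` fsupport phi)).
by split=> // y /= py; exact: subset_closure.
Qed.

Lemma compact_fsupportS phi (K : set 'rV[R]_n) : compact K ->
  fsupport phi `<=` K -> compact (fsupport phi).
Proof.
by move=> cK; apply: subclosed_compact => //; exact: closed_closure.
Qed.

Lemma test_function_translate phi a : test_function phi ->
  test_function (fun x => phi (x + a)).
Proof.
move=> [sRe sIm csupp]; split.
- exact: (smooth_translate a sRe).
- exact: (smooth_translate a sIm).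
- apply: (@compact_fsupportS _ ((fun y => y - a) @` fsupport phi)).
    apply: continuous_compact => //; apply: continuous_subspaceT.
    exact: continuous_translate.
  move=> x /fsupport_translate xa; exists (x + a) => //.
  by rewrite addrK.
Qed.

Lemma test_function_cube_bounded phi : test_function phi -> cube_bounded phi.
Proof.
by move=> [/smooth_continuous ? /smooth_continuous ? ?]; exact: cube_bounded_continuous.
Qed.

Definition cderive (l : 'I_n) phi x : R[i] :=
  ('D_(delta_mx 0 l) (fun y => complex.Re (phi y)) x) +i*
  ('D_(delta_mx 0 l) (fun y => complex.Im (phi y)) x).

Lemma test_function_cderive l phi : test_function phi ->
  test_function (cderive l phi).
Proof.
move=> [sRe sIm csupp]; split.
- exact: (smooth_derive l sRe).
- exact: (smooth_derive l sIm).
- apply: (compact_fsupportS csupp); rewrite {2}/fsupport.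
  rewrite [X in _ `<=` X](closure_id (fsupport phi)).1; last exact: closed_closure.
  apply: closureS => x /= dx; apply: contrapT => xs; move: dx.
  (* Off the closed support [phi] vanishes in a whole neighbourhood, so its derivative vanishes
     there too. *)
  have phi0 : \near x, phi x = 0.
    have : open (~` fsupport phi) by apply: closed_openC; exact: closed_closure.
    rewrite openE => /(_ x xs); rewrite /interior => xnear.
    by near=> y; apply: fsupportP; near: y.
  have d0 (P : R[i] -> R) : P 0 = 0 -> 'D_(delta_mx 0 l) (fun y => P (phi y)) x = 0.
    move=> P0; rewrite (@near_eq_derive _ _ _ _ (cst 0)).
      by rewrite derive_cst.
    by near=> y; rewrite (_ : phi y = 0)//; near: y.
  by rewrite /cderive !d0// eqxx.
Unshelve. all: by end_near. Qed.

End test_functions.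

(** * Fourier transforms of test functions and their decay *)

Section fourier_transform.
Context {R : realType} {n : nat}.
Implicit Types (phi : 'rV[R]_n -> R[i]) (x t a : 'rV[R]_n).
Local Notation leb := (lebesgue_rV R n).

Lemma measurable_dotr t : measurable_fun setT (fun x : 'rV[R]_n => dot x t).
Proof. by under eq_fun do rewrite dotC; exact: measurable_dot. Qed.

Lemma measurable_plane_wave_l t : cmeasurable (fun x : 'rV[R]_n => plane_wave x t).
Proof.
by apply: cmeasurable_cexpi; apply: measurable_funN; exact: measurable_dotr.
Qed.

Lemma cube_bounded_wave phi t : cube_bounded phi ->
  cube_bounded (fun x => phi x * plane_wave x t).
Proof.
move=> bphi; apply: cube_boundedM => //; first exact: measurable_plane_wave_l.
by move=> x; rewrite normc_plane_wave.
Qed.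

Lemma plane_wave0 t : plane_wave 0 t = 1.
Proof.
by rewrite /plane_wave /dot big1 ?oppr0 ?cexpi0// => i _; rewrite mxE mul0r.
Qed.

Lemma fourierE phi t : fourier phi t = cintegral leb (fun x => phi x * plane_wave x t).
Proof. by []. Qed.

Lemma fourier_translate phi a t : test_function phi ->
  fourier (fun x => phi (x + a)) t = plane_wave (- a) t * fourier phi t.
Proof.
move=> tphi; have bphi := test_function_cube_bounded tphi.
have bphia := test_function_cube_bounded (test_function_translate a tphi).
have If := cube_bounded_integrable (cube_bounded_wave t bphi).
rewrite !fourierE -(cintegral_translate (a := a) (cube_bounded_wave t bphi).1).
  rewrite -cintegralZ; last first.
    have := cintegrableZ (plane_wave a t) (cube_bounded_integrable (cube_bounded_wave t bphia)).
    by congr cintegrable; apply/funext => x; rewrite plane_waveD; ring.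
  congr cintegral; apply/funext => x; rewrite plane_waveD.
  transitivity ((plane_wave (- a) t * plane_wave a t) * (phi (x + a) * plane_wave x t)).
    by rewrite -plane_waveD addNr plane_wave0 mul1r.
  by ring.
have := cintegrableZ (plane_wave a t) (cube_bounded_integrable (cube_bounded_wave t bphia)).
by congr cintegrable; apply/funext => x; rewrite plane_waveD; ring.
Qed.

Lemma cvg_cderive phi l x : test_function phi ->
  normc ((k.+1%:R : R)%:C * (phi (x + k.+1%:R^-1 *: delta_mx 0 l) - phi x) -
    cderive l phi x) @[k --> \oo] --> (0 : R).
Proof.
move=> [sRe sIm _].
have h1 := cvg_difference_quotient (@smooth_derivable _ _ _ sRe l x).
have h2 := cvg_difference_quotient (@smooth_derivable _ _ _ sIm l x).
have z (u : nat -> R) (v : R) : u k @[k --> \oo] --> v -> `|u k - v| @[k --> \oo] --> 0.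
  by move=> uv; apply/norm_cvg0P; apply/subr_cvg0.
pose q (P : R[i] -> R) k : R := `|k.+1%:R *
  (P (phi (x + k.+1%:R^-1 *: delta_mx 0 l)) - P (phi x)) -
  'D_(delta_mx 0 l) (fun y => P (phi y)) x|.
apply: (@squeeze_cvgr _ _ _ _ (cst 0)
    (fun k => q (@complex.Re R) k + q (@complex.Im R) k)); last 2 first.
- exact: cvg_cst.
- by rewrite -(addr0 (0 : R)); apply: cvgD; exact: z.
apply: nearW => k /=; rewrite normc_ge0/= (le_trans (ler_normc_ReIm _))//.
by rewrite !(ReD, ImD, ReN, ImN, ReM, ImM) /= !mul0r subr0 addr0.
Qed.

(** The mean value inequality bounds the difference quotients by the supremum of the derivative,
    once per component, hence the factor 2. Increments are at most 1, so enlarging the cube by 1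
    contains the supports of all quotients. *)
Lemma normc_cderive_bound phi l : test_function phi ->
  exists M N : R, forall k x,
    normc ((k.+1%:R : R)%:C * (phi (x + k.+1%:R^-1 *: delta_mx 0 l) - phi x)) <=
      M * \1_(cube N) x.
Proof.
move=> tphi; have [_ [M0 [N0 hN]]] := test_function_cube_bounded tphi.
have [_ [M1 [N1 hM]]] := test_function_cube_bounded (test_function_cderive l tphi).
have [sRe sIm _] := tphi.
have bnd x : normc (cderive l phi x) <= `|M1|.
  rewrite (le_trans (hM x))// (le_trans (ler_norm _))// normrM ler_piMr//.
  by rewrite indicE; case: (_ \in _); rewrite ?normr1 ?normr0.
have phi0 x : ~ cube N0 x -> phi x = 0.
  move=> xN; apply/eqP; rewrite -normc_eq0 eq_le normc_ge0 andbT.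
  by rewrite (le_trans (hN x))// indicE memNset// mulr0.
exists (2 * `|M1|), (N0 + 1) => k x; set h := k.+1%:R^-1 : R.
have h0 : 0 < h by rewrite invr_gt0.
have h1 : h <= 1 by rewrite invf_le1// ler1n.
have hk : (k.+1%:R : R) = h^-1 by rewrite invrK.
have [xN|xN] := pselect (cube (N0 + 1) x); last first.
  have -> : phi x = 0.
    apply: phi0; apply: contra_not xN => /cubeP xN; apply/cubeP => i.
    by rewrite (le_trans (xN i))// lerDl.
  rewrite phi0 ?subr0 ?mulr0 ?normc0 ?indicE ?memNset ?mulr0//.
  apply: contra_not xN => /cubeP xN; apply/cubeP => i.
  have := xN i; rewrite !mxE => xi.
  have : `|h * ((0 == 0 :> 'I_1) && (i == l))%:R| <= 1.
    by rewrite normrM (gtr0_norm h0); case: (_ && _); rewrite ?normr1 ?normr0 ?mulr1 ?mulr0.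
  move: xi; set A := h * _ => xA A1.
  rewrite -[x 0 i](addrK A) (le_trans (ler_normB _ _))// lerD//.
rewrite indicE mem_set// mulr1 normcM normc_real gtr0_norm// hk.
rewrite ler_pdivrMl// (le_trans (ler_normc_ReIm _))//.
have -> : h * (2 * `|M1|) = `|M1| * `|h| + `|M1| * `|h| by rewrite (gtr0_norm h0); ring.
rewrite ReD ImD ReN ImN; apply: lerD.
  apply: (ler_derive_line _ _ (@smooth_derivable _ _ _ sRe l)) => y.
  exact: le_trans (ler_normRe (cderive l phi y)) (bnd y).
apply: (ler_derive_line _ _ (@smooth_derivable _ _ _ sIm l)) => y.
exact: le_trans (ler_normIm (cderive l phi y)) (bnd y).
Qed.

End fourier_transform.

(** Adding the majorant [B] makes the integrand nonnegative, so that Tonelli gives measurability;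
    the constant integral of [B] is then subtracted. *)
Lemma measurable_Rintegral_param d1 d2 (T1 : measurableType d1)
    (T2 : measurableType d2) (R : realType)
    (m2 : {sigma_finite_measure set T2 -> \bar R}) (g : T1 * T2 -> R) (B : T2 -> R) :
  measurable_fun setT g -> m2.-integrable setT (EFin \o B) ->
  (forall t x, `|g (t, x)| <= B x) ->
  measurable_fun setT (fun t => \int[m2]_x g (t, x)).
Proof.
move=> mg iB gB.
have mB : measurable_fun setT B by apply/measurable_EFinP; exact: measurable_int iB.
pose h (p : T1 * T2) := (g p + B p.2)%:E.
have mh : measurable_fun setT h.
  apply/measurable_EFinP; apply: measurable_funD => //.
  exact: (measurableT_comp mB measurable_snd).
have h0 p : (0 <= h p)%E.
  case: p => t x; rewrite lee_fin -lerBlDr sub0r.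
  by have := gB t x; rewrite ler_norml => /andP[].
have mF := measurable_fun_fubini_tonelli_F (m2 := m2) h mh h0.
have mgt t : measurable_fun setT (fun x => g (t, x)).
  exact: (measurableT_comp mg (pair1_measurable t)).
have igt t : m2.-integrable setT (fun x => (g (t, x))%:E).
  apply: (le_integrable _ _ _ iB) => //; first exact/measurable_EFinP.
  by move=> x _ /=; rewrite lee_fin (le_trans (gB _ _))// ler_norm.
rewrite (_ : (fun t => _) = fun t => fine (fubini_F m2 h t) - \int[m2]_x B x).
  apply: measurable_funB; last exact: measurable_cst.
  exact: (measurableT_comp (fine_measurable measurableT) mF).
apply/funext => t; rewrite /fubini_F /h.
rewrite -/(Rintegral m2 setT (fun x => g (t, x) + B x)) RintegralD ?addrK//.
exact: igt.
Qed.

Section fourier_decay.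
Context {R : realType} {n : nat}.
Implicit Types (phi : 'rV[R]_n -> R[i]) (x t a : 'rV[R]_n).
Local Notation leb := (lebesgue_rV R n).

Lemma measurable_plane_wave_pair d (T : measurableType d) (f g : T -> 'rV[R]_n) :
  measurable_fun setT f -> measurable_fun setT g ->
  cmeasurable (fun p => plane_wave (f p) (g p)).
Proof.
move=> mf mg; apply: cmeasurable_cexpi; apply: measurable_funN.
apply: measurable_sum => l; apply: measurable_funM.
  exact: (measurableT_comp (measurable_coord_rV l) mf).
exact: (measurableT_comp (measurable_coord_rV l) mg).
Qed.

Lemma measurable_fourier phi : cube_bounded phi -> cmeasurable (fourier phi).
Proof.
move=> bphi; have [mphi [M [N hMN]]] := bphi.
pose f (p : 'rV[R]_n * 'rV[R]_n) := phi p.2 * plane_wave p.2 p.1.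
have mf : cmeasurable f.
  apply: cmeasurableM.
    exact: (cmeasurable_comp mphi measurable_snd).
  exact: (measurable_plane_wave_pair measurable_snd measurable_fst).
have fB t x : normc (f (t, x)) <= M * \1_(cube N) x.
  by rewrite /f normcM normc_plane_wave mulr1.
have iB := integrable_cube (n := n) N M.
split.
  apply: (measurable_Rintegral_param (g := fun p => complex.Re (f p)) mf.1 iB) => t x.
  exact: le_trans (ler_normRe _) (fB t x).
apply: (measurable_Rintegral_param (g := fun p => complex.Im (f p)) mf.2 iB) => t x.
exact: le_trans (ler_normIm _) (fB t x).
Qed.

(** Pairing with [fourier phi] becomes an average of the pointwise transform of [h mu]. The
    integrability of [h] makes that transform meaningful. *)
Lemma fourier_Fubini (mu : {sigma_finite_measure set 'rV[R]_n -> \bar R}) phi h :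
  cube_bounded phi -> cintegrable mu h ->
  cintegral mu (fun t => fourier phi t * h t) =
  cintegral leb (fun x => phi x * cintegral mu (fun t => h t * plane_wave x t)).
Proof.
move=> bphi [mh ih]; have [mphi [M [N hMN]]] := bphi.
pose f (p : 'rV[R]_n * 'rV[R]_n) := phi p.2 * plane_wave p.2 p.1 * h p.1.
have mf : cmeasurable f.
  apply: cmeasurableM; last exact: (cmeasurable_comp mh measurable_fst).
  apply: cmeasurableM.
    exact: (cmeasurable_comp mphi measurable_snd).
  exact: (measurable_plane_wave_pair measurable_snd measurable_fst).
have hMN0 x : 0 <= M * \1_(cube N) x by exact: le_trans (normc_ge0 _) (hMN x).
transitivity (cintegral mu (fun t => cintegral leb (fun x => f (t, x)))).
  congr cintegral; apply/funext => t; rewrite mulrC fourierE -cintegralZ.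
    by congr cintegral; apply/funext => x; rewrite mulrC.
  exact/cube_bounded_integrable/cube_bounded_wave.
rewrite (cintegral_Fubini mf ih (integrable_cube N M))//; last 2 first.
- by move=> t; exact: normc_ge0.
- by move=> t x; rewrite /f !normcM normc_plane_wave mulr1 mulrC ler_wpM2l ?normc_ge0.
congr cintegral; apply/funext => x; rewrite -cintegralZ.
  by congr cintegral; apply/funext => t; rewrite /f /=; ring.
apply: (cintegrableMr (M := 1)) => //; first exact: measurable_plane_wave.
by move=> t; rewrite normc_plane_wave.
Qed.

(** Translation invariance takes the place of integration by parts: a difference quotient in x has
    transform (exp(i h t_l) - 1) / h times that of [phi], and both sides pass to the limit under the
    integral. *)
Lemma fourier_cderive phi l t : test_function phi ->
  fourier (cderive l phi) t = (0 +i* t 0 l) * fourier phi t.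
Proof.
move=> tphi.
have bphi := test_function_cube_bounded tphi.
have bd := test_function_cube_bounded (test_function_cderive l tphi).
have Iphi := cube_bounded_integrable (cube_bounded_wave t bphi).
have Id := cube_bounded_integrable (cube_bounded_wave t bd).
apply/eqP; rewrite -subr_eq0; apply/eqP.
rewrite !fourierE -cintegralZ// -cintegralB//; last exact: cintegrableZ.
pose h k : R := k.+1%:R^-1; pose a k : 'rV[R]_n := h k *: delta_mx 0 l.
pose c k : R[i] := (k.+1%:R : R)%:C.
have h0 k : 0 < h k by rewrite invr_gt0.
have hc k : (h k)%:C * c k = 1 :> R[i] by rewrite -rmorphM /= mulVf.
have wa k : plane_wave (- a k) t = cexpi (h k * t 0 l).
  rewrite /plane_wave dotNl opprK; congr cexpi; rewrite /dot (bigD1 l)//= big1 ?addr0.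
    by rewrite !mxE !eqxx mulr1.
  by move=> j jl; rewrite !mxE (negbTE jl) andbF mulr0 mul0r.
have [M [N hMN]] := normc_cderive_bound l tphi.
have [mphi [M' [N' hMN']]] := bphi.
pose f k x := c k * (phi (x + a k) - phi x) * plane_wave x t -
  c k * (cexpi (h k * t 0 l) - 1) * (phi x * plane_wave x t).
have cB k : normc (c k * (cexpi (h k * t 0 l) - 1)) <= 2 * `|t 0 l|.
  rewrite normcM normc_real gtr0_norm//.
  have := normc_cexpiB1 (h k * t 0 l); rewrite normrM (gtr0_norm (h0 k)) => hB.
  rewrite -ler_pdivlMl//; apply: le_trans hB _; by rewrite mulrCA.
apply: (@cintegral_lim0 _ _ _ leb f _
    (fun x => M * \1_(cube N) x + (2 * `|t 0 l|) * (M' * \1_(cube N') x))).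
- move=> k; apply: cmeasurableB; last first.
    by apply: cmeasurableM; [exact: cmeasurable_cst|apply: (cube_bounded_wave t bphi).1].
  apply: cmeasurableM; last exact: measurable_plane_wave_l.
  apply: cmeasurableM; first exact: cmeasurable_cst.
  apply: cmeasurableB => //.
  exact: (test_function_cube_bounded (test_function_translate (a k) tphi)).1.
- have I2 : leb.-integrable setT
      (fun x => (2 * `|t 0 l| * (M' * \1_(cube N') x))%:E).
    exact: (integrableZl _ (2 * `|t 0 l|) (integrable_cube N' M')).
  exact: (integrableD _ (integrable_cube N M) I2).
- move=> k x; rewrite (le_trans (normcB _ _))// lerD//.
    by rewrite normcM normc_plane_wave mulr1 hMN.
  by rewrite normcM ler_pM ?normc_ge0// normcM normc_plane_wave mulr1.
- move=> x.
  pose A k := normc (c k * (phi (x + a k) - phi x) - cderive l phi x).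
  pose K := 2 * (t 0 l) ^+ 2 * normc (phi x).
  have A0 : A k @[k --> \oo] --> (0 : R) by exact: cvg_cderive.
  have B0 : K * h k @[k --> \oo] --> (0 : R).
    by rewrite -[X in _ --> X](mulr0 K); apply: cvgM; [exact: cvg_cst|exact: cvg_harmonic].
  apply: (@squeeze_cvgr _ _ _ _ (cst 0) (fun k => A k + K * h k)).
  + apply: nearW => k; rewrite normc_ge0/= /f.
    set p := phi (x + a k) - phi x; set W := plane_wave x t; set b := c k * (_ - 1).
    rewrite (_ : _ - _ = (c k * p - cderive l phi x) * W -
        (b - (0 +i* t 0 l)) * (phi x * W)); last by ring.
    rewrite (le_trans (normcB _ _))// lerD//.
      by rewrite normcM normc_plane_wave mulr1.
    rewrite !normcM normc_plane_wave mulr1 /K mulrAC ler_wpM2r ?normc_ge0//.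
    have -> : b - (0 +i* t 0 l) = c k * (cexpi (h k * t 0 l) - (1 +i* (h k * t 0 l))).
      have -> : (0 +i* t 0 l) = c k * ((h k)%:C * (0 +i* t 0 l)).
        by rewrite mulrA [c k * _]mulrC hc mul1r.
      rewrite -mulrBr; congr (_ * _); rewrite -addrA -opprD; congr (_ - _).
      by apply: complex_ext; rewrite ?ReD ?ImD ?ReM ?ImM /=; ring.
    rewrite normcM normc_real gtr0_norm// -ler_pdivlMl//.
    apply: le_trans (normc_cexpi_taylor _) _.
    rewrite le_eqVlt; apply/orP; left; apply/eqP; rewrite exprMn /h.
    by field.
  + exact: cvg_cst.
  + by rewrite -(addr0 (0 : R)); exact: cvgD.
- move=> k.
  have ba := test_function_cube_bounded (test_function_translate (a k) tphi).
  have Ia := cube_bounded_integrable (cube_bounded_wave t ba).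
  transitivity (cintegral leb (fun x => c k *
    ((phi (x + a k) * plane_wave x t - phi x * plane_wave x t) -
     (cexpi (h k * t 0 l) - 1) * (phi x * plane_wave x t)))).
    by congr cintegral; apply/funext => x; rewrite /f; ring.
  have Iz := cintegrableZ (cexpi (h k * t 0 l) - 1) Iphi.
  have Ib := cintegrableB Ia Iphi.
  rewrite cintegralZ; last exact: cintegrableB.
  rewrite cintegralB// cintegralB// cintegralZ//.
  rewrite -!fourierE (fourier_translate _ _ tphi) wa.
  by rewrite mulrBl mul1r subrr mulr0.
Qed.

Lemma fourier_bounded phi : cube_bounded phi ->
  exists2 C : R, 0 <= C & forall t, normc (fourier phi t) <= C.
Proof.
move=> [mphi [M [N hMN]]].
have I0 : 0 <= \int[leb]_x (M * \1_(cube N) x).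
  by apply: Rintegral_ge0 => x _; exact: le_trans (normc_ge0 _) (hMN x).
exists (2 * \int[leb]_x (M * \1_(cube N) x)); first by rewrite mulr_ge0.
move=> t; rewrite fourierE; apply: le_normc_cintegral.
- by apply: cmeasurableM => //; exact: measurable_plane_wave_l.
- exact: integrable_cube.
- by move=> x; rewrite normcM normc_plane_wave mulr1.
Qed.

(** The transform of a second derivative in direction l gains the modulus t_l^2, so [phi] and that
    derivative together bound (1 + t_l^2) times the transform. The induction treats one coordinate
    at a time and needs the bound for all test functions. *)
Lemma fourier_decay phi : test_function phi -> exists2 C : R, 0 <= C &
  forall t, normc (fourier phi t) <= C * cauchy_weight t.
Proof.
suff h (ls : seq 'I_n) : forall phi, test_function phi -> exists2 C : R, 0 <= C &
    forall t, \prod_(l <- ls) (1 + t 0 l ^+ 2) * normc (fourier phi t) <= C.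
  move=> tphi; have [C C0 hC] := h (index_enum 'I_n) phi tphi.
  exists C => // t; rewrite /cauchy_weight prodfV ler_pdivlMr 1?mulrC//.
  by apply: prodr_gt0 => l _; rewrite ltr_wpDr ?sqr_ge0.
elim: ls => [|l ls IHls] {}phi tphi.
  have [C C0 hC] := fourier_bounded (test_function_cube_bounded tphi).
  by exists C => // t; rewrite big_nil mul1r.
have [C C0 hC] := IHls _ tphi.
have td := test_function_cderive l (test_function_cderive l tphi).
have [C' C'0 hC'] := IHls _ td.
exists (C + C'); first exact: addr_ge0.
move=> t; rewrite big_cons; have := hC t; have := hC' t.
rewrite (fourier_cderive _ _ (test_function_cderive l tphi)) (fourier_cderive _ _ tphi).
rewrite !normcM.
have -> : normc (0 +i* t 0 l) = `|t 0 l| by rewrite /= expr0n add0r sqrtr_sqr.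
rewrite [`|_| * (`|_| * _)]mulrA -expr2 real_normK ?num_real// => h1 h2.
apply: le_trans (lerD h2 h1).
by rewrite mulrDl mul1r mulrDl lerD2l mulrCA mulrA.
Qed.

End fourier_decay.

(** * A smooth bump function *)

Section bump.
Context {R : realType}.
Variable a : R.
Hypothesis a0 : 0 < a.
Implicit Types (p : {poly R}) (x y : R).

Let U : {poly R} := (a ^+ 2)%:P - 'X^2.

Let UE x : U.[x] = a ^+ 2 - x ^+ 2.
Proof. by rewrite /U !hornerE. Qed.

(* [p(x) u(x)^-m exp(- 1 / u(x))] with [u(x) = a^2 - x^2], extended by [0] to
   [|x| >= a]: this class of functions is closed under differentiation. *)
Definition bump_fun p (m : nat) x : R :=
  if x ^+ 2 < a ^+ 2 then
    p.[x] * (U.[x])^-1 ^+ m * expR (- (U.[x])^-1)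
  else 0.

(** The numerator of the derivative over u^(m+2): differentiating p, u^-m and exp(-1/u) gives p'
    u^2, - m p u' u and p u' respectively. *)
Definition bump_next p m : {poly R} :=
  p^`() * U ^+ 2 - (p * U^`() * U) *+ m + p * U^`().

Lemma is_derive0_quadratic (f : R -> R) x (K : R) :
  (forall y, `|f y| <= K * (y - x) ^+ 2) -> is_derive x 1 f 0.
Proof.
move=> fK.
have fx : f x = 0.
  by apply/eqP; rewrite -normr_le0 (le_trans (fK x))// subrr expr0n mulr0.
have c0 : (fun h : R => h^-1 *: ((f \o shift x) (h *: 1) - f x)) @ 0^' --> (0 : R).
  apply/cvgr_dnbhsP => u [u0 uc].
  apply/norm_cvg0P.
  apply: (@squeeze_cvgr _ _ _ _ (cst 0) (fun k => K * `|u k|)).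
  - apply: nearW => k /=; rewrite normr_ge0/= fx subr0.
    have uk : 0 < `|u k| by rewrite normr_gt0.
    rewrite normrM normfV ler_pdivrMl// (le_trans (fK _))//.
    rewrite addrK [u k *: 1]mulr1 -(real_normK (num_real (u k))) expr2.
    by rewrite mulrCA.
  - exact: cvg_cst.
  - rewrite -[X in _ --> X](mulr0 K); apply: cvgM; first exact: cvg_cst.
    by apply/norm_cvg0P.
apply: DeriveDef; first by apply/cvg_ex; exists 0.
exact: (cvg_lim (@Rhausdorff R) c0).
Qed.

(** From v/k <= exp(v/k), raised to the power k. *)
Lemma expRN_pow (v : R) (k : nat) : 0 < v -> v ^+ k * expR (- v) <= k%:R ^+ k.
Proof.
move=> v0; case: k => [|k].
  by rewrite !expr0 mul1r -[leRHS]expR0 ler_expR oppr_le0 ltW.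
rewrite expRN ler_pdivrMr ?expR_gt0//.
have k0 : 0 < k.+1%:R :> R by [].
have -> : v = k.+1%:R * (v / k.+1%:R) by rewrite mulrCA mulfV ?mulr1// gt_eqF.
rewrite expRM_natl exprMn ler_wpM2l ?exprn_ge0//.
rewrite ler_pXn2r ?nnegrE ?expR_ge0 ?divr_ge0 ?(ltW v0)//.
by rewrite (le_trans _ (expR_ge1Dx _))// lerDr.
Qed.

Lemma horner_bounded p (M : R) : 0 <= M ->
  exists2 C : R, 0 <= C & forall x, `|x| <= M -> `|p.[x]| <= C.
Proof.
move=> M0; exists (\sum_(i < size p) `|p`_i| * M ^+ i).
  by apply: sumr_ge0 => i _; rewrite mulr_ge0// exprn_ge0.
move=> x xM; rewrite horner_coef (le_trans (ler_norm_sum _ _ _))//.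
by apply: ler_sum => i _; rewrite normrM normrX ler_wpM2l// lerXn2r ?nnegrE.
Qed.

Lemma bump_fun_derive p m x :
  is_derive x 1 (bump_fun p m) (bump_fun (bump_next p m) m.+2 x).
Proof.
have [xa|xa] := ltP (x ^+ 2) (a ^+ 2); last first.
  rewrite {2}/bump_fun ltNge xa /=.
  have [C C0 pC] := horner_bounded p (ltW a0).
  (* Endpoints and exterior are treated together. Two powers of u are split off, the rest being
     bounded by [expRN_pow]; since a^2 <= x^2, one has u(y) <= x^2 - y^2 <= (|x| + a) |y - x|, so
     the function is quadratically small at x. *)
  apply: (@is_derive0_quadratic _ _ (C * (m.+2%:R ^+ m.+2) * (`|x| + a) ^+ 2)) => y.
  rewrite /bump_fun; case: ifPn => ya; last first.
    rewrite normr0; apply: mulr_ge0 _ (sqr_ge0 _); apply: mulr_ge0 _ (sqr_ge0 _).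
    by rewrite mulr_ge0 ?exprn_ge0.
  have u0 : 0 < U.[y] by rewrite UE subr_gt0.
  set u := U.[y] in u0 *; set v := u^-1.
  have v0 : 0 < v by rewrite invr_gt0.
  have yla : `|y| <= a.
    by rewrite -(@ler_pXn2r _ 2) ?nnegrE ?(ltW a0)// real_normK ?num_real// ltW.
  have uB : u ^+ 2 <= (`|x| + a) ^+ 2 * (y - x) ^+ 2.
    rewrite -exprMn -[leRHS]real_normK ?num_real// ler_pXn2r ?nnegrE ?(ltW u0)//.
    have : u <= x ^+ 2 - y ^+ 2 by rewrite /u UE lerD2r.
    rewrite subr_sqr => /le_trans; apply; rewrite (le_trans (ler_norm _))//.
    rewrite !normrM mulrC distrC ler_pM// [leRHS]ger0_norm ?addr_ge0 ?(ltW a0)//.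
    by rewrite (le_trans (ler_normD _ _))// lerD2l.
  have -> : p.[y] * v ^+ m * expR (- v) = p.[y] * (v ^+ m.+2 * expR (- v)) * u ^+ 2.
    have -> : v ^+ m = v ^+ m.+2 * u ^+ 2.
      by rewrite -addn2 exprD -mulrA -exprMn /v mulVf ?gt_eqF// expr1n mulr1.
    by ring.
  have w0 : 0 <= v ^+ m.+2 * expR (- v).
    by apply: mulr_ge0; [exact/exprn_ge0/ltW|exact: expR_ge0].
  rewrite 2!normrM -[leRHS]mulrA (ger0_norm w0) (ger0_norm (sqr_ge0 u)).
  apply: ler_pM => //; [exact: mulr_ge0|exact: sqr_ge0|].
  by apply: ler_pM => //; [exact: pC|exact: expRN_pow].
have near_lt : \near x, x ^+ 2 < a ^+ 2.
  have cX : {for x, continuous (fun y : R => y ^+ 2)} by exact: exprn_continuous.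
  exact: (cvgr_lt (x ^+ 2) cX).
have u0 : U.[x] != 0 by rewrite UE gt_eqF// subr_gt0.
apply: (@near_eq_is_derive _ _ _ (fun y => p.[y] * (U.[y])^-1 ^+ m * expR (- (U.[y])^-1))).
  by near=> y; rewrite /bump_fun ifT//; near: y.
have dU := is_derive_poly U x.
have dV := is_deriveV u0 dU.
have dp := is_derive_poly p x.
have dVm := is_deriveX m dV.
have dE := is_derive1_comp (is_derive_expR _) (is_deriveN dV).
have D := is_deriveM (is_deriveM dp dVm) dE.
rewrite (_ : (fun y => _) = horner p * (fun y => (U.[y])^-1) ^+ m *
    (expR \o (- (fun y => (U.[y])^-1)))); last first.
  by apply/funext => y; rewrite !fctE.
apply: (is_derive_eq D).
rewrite /bump_fun xa -[m.+2]addn2 exprD /bump_next !(hornerE, hornerMn).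
rewrite /GRing.scale /= !fctE.
move: u0; rewrite !UE; set u' := (U^`()).[x]; case: m dVm D => [|m] _ _.
  move: (a ^+ 2 - x ^+ 2) => u u0; rewrite !expr0 !mul0r !mulr0n.
  by move: (expR _) => E; field.
rewrite [m.+1.-1]/= -[(_ * _) *+ m.+1]mulr_natl.
move: (a ^+ 2 - x ^+ 2) => u u0; rewrite [u^-1 ^+ m.+1]exprS.
by move: (expR _) (u^-1 ^+ m) (m.+1%:R : R) => E w M; field.
Unshelve. all: by end_near. Qed.

End bump.

(** * Smoothness of products of one-variable functions *)

Section product_smooth.
Context {R : realType} {n : nat}.
Implicit Types x : 'rV[R]_n.

Lemma is_derive_prod_coord (g : 'I_n -> R -> R) (dg : R) l x :
  is_derive (x 0 l) 1 (g l) dg ->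
  is_derive x (delta_mx 0 l) (fun y : 'rV[R]_n => \prod_j g j (y 0 j))
    (dg * \prod_(j | j != l) g j (x 0 j)).
Proof.
move=> [dgl dglE]; set c := \prod_(j | j != l) _.
have h0 : (fun h : R => h^-1 *: ((g l \o shift (x 0 l)) (h *: 1) - g l (x 0 l))) @ 0^' --> dg.
  by rewrite -dglE; exact: dgl.
have h1 : (fun h : R => h^-1 *: (((fun y : 'rV[R]_n => \prod_j g j (y 0 j)) \o shift x)
    (h *: delta_mx 0 l) - \prod_j g j (x 0 j))) @ 0^' --> dg * c.
  rewrite (_ : (fun h => _) = fun h : R =>
    (h^-1 *: ((g l \o shift (x 0 l)) (h *: 1) - g l (x 0 l))) * c).
    by apply: cvgM h0 _; exact: cvg_cst.
  apply/funext => h /=; rewrite (bigD1 l)//= [\prod_j g j (x 0 j)](bigD1 l)//= -/c.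
  rewrite (_ : \prod_(j | j != l) _ = c); last first.
    by apply: eq_bigr => j jl; rewrite !mxE (negbTE jl) andbF mulr0 add0r.
  rewrite !mxE !eqxx /= -mulrBl -scalerAl.
  by [].
apply: DeriveDef; first by apply/cvg_ex; exists (dg * c).
exact: (cvg_lim (@Rhausdorff R) h1).
Qed.

Variable F : nat -> R -> R.
Hypothesis dF : forall k (x : R), is_derive x 1 (F k) (F k.+1 x).

Let cF k : continuous (F k).
Proof.
by move=> x; apply/differentiable_continuous/derivable1_diffP; case: (dF k x).
Qed.

Lemma derive_prod_coord (c : 'I_n -> nat) l x :
  is_derive x (delta_mx 0 l) (fun y : 'rV[R]_n => \prod_j F (c j) (y 0 j))
    (\prod_j F (c j + (j == l)) (x 0 j)).
Proof.
apply: (is_derive_eq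
  (@is_derive_prod_coord (fun j => F (c j)) _ l x (dF (c l) (x 0 l)))).
rewrite [RHS](bigD1 l)//= eqxx addn1; congr (_ * _).
by apply: eq_bigr => j /negbTE ->; rewrite addn0.
Qed.

(** [F k] is the k-th derivative of [F 0], so an iterated partial derivative only counts how often
    each index occurs. *)
Lemma partial_deriv_prod_coord s x :
  partial_deriv s (fun y : 'rV[R]_n => \prod_j F 0 (y 0 j)) x =
  \prod_j F (count_mem j s) (x 0 j).
Proof.
elim: s x => [//|l s IHs] x /=.
have -> : partial_deriv s (fun y : 'rV[R]_n => \prod_j F 0 (y 0 j)) =
    fun y => \prod_j F (count_mem j s) (y 0 j) by apply/funext => y; exact: IHs.
rewrite (@derive_val _ _ _ _ _ _ _ (derive_prod_coord _ l x)).
by apply: eq_bigr => j _; rewrite addnC eq_sym.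
Qed.

Lemma smooth_prod_coord : smooth (fun x : 'rV[R]_n => \prod_j F 0 (x 0 j)).
Proof.
move=> s.
have -> : partial_deriv s (fun y : 'rV[R]_n => \prod_j F 0 (y 0 j)) =
    fun y => \prod_j F (count_mem j s) (y 0 j).
  by apply/funext => y; exact: partial_deriv_prod_coord.
split; last by move=> l x; case: (derive_prod_coord (fun j => count_mem j s) l x).
have cprod (r : seq 'I_n) (G : 'I_n -> R -> R) : (forall j, continuous (G j)) ->
    continuous (fun y : 'rV[R]_n => \prod_(j <- r) G j (y 0 j)).
  move=> cG; elim: r => [|j r IHr].
    by under eq_fun do rewrite big_nil; exact: cst_continuous.
  under eq_fun do rewrite big_cons.
  move=> y; apply: (@cvgM R 'rV[R]_n (nbhs y) _ (fun y => G j (y 0 j))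
    (fun y => \prod_(j <- r) G j (y 0 j))); last exact: IHr.
  apply: (@continuous_comp _ _ _ (fun y : 'rV[R]_n => y 0 j) (G j)).
    exact: coord_continuous.
  exact: cG.
by apply: (cprod _ (fun j => F (count_mem j s))) => j; exact: cF.
Qed.

End product_smooth.

Section bump_rV.
Context {R : realType} {n : nat}.
Variable a : R.
Hypothesis a0 : 0 < a.
Local Notation leb := (lebesgue_rV R n).
Implicit Types x t : 'rV[R]_n.

(** Each differentiation raises the power of 1/u by two, so the k-th derivative carries the exponent
    [k.*2]. *)
Fixpoint bump_poly (k : nat) : {poly R} :=
  if k is k'.+1 then bump_next a (bump_poly k') k'.*2 else 1.

Let bump_der k := bump_fun a (bump_poly k) k.*2.

Let bump_derP k (x : R) : is_derive x 1 (bump_der k) (bump_der k.+1 x).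
Proof. exact: bump_fun_derive. Qed.

Definition bump x : R := \prod_j bump_der 0 (x 0 j).

Lemma bump_factorE (x : R) : bump_der 0 x =
  if x ^+ 2 < a ^+ 2 then expR (- (a ^+ 2 - x ^+ 2)^-1) else 0.
Proof.
by rewrite /bump_der /bump_fun /= !hornerE ?mul1r ?mulr1 ?expr0 ?mul1r.
Qed.

Lemma bump_factor_ge0 (x : R) : 0 <= bump_der 0 x.
Proof. by rewrite bump_factorE; case: ifP => // _; exact: expR_ge0. Qed.

Lemma bump_ge0 x : 0 <= bump x.
Proof. by apply: prodr_ge0 => j _; exact: bump_factor_ge0. Qed.

Lemma bump_out x : ~ cube a x -> bump x = 0.
Proof.
move=> xa; have [l xl] : exists l, ~ `|x 0 l| <= a.
  by apply/existsNP => h; apply: xa; apply/cubeP.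
rewrite /bump (bigD1 l)//= bump_factorE ifF ?mul0r//.
apply/negbTE; rewrite -leNgt -(real_normK (num_real (x 0 l))).
by rewrite ler_pXn2r ?nnegrE ?(ltW a0)// ltW// ltNge; apply/negP.
Qed.

Lemma compact_cube_set : compact (cube a : set 'rV[R]_n).
Proof.
exact: (rV_compact (fun=> @segment_compact R (- a) a)).
Qed.

Lemma fsupport_bump : fsupport (fun x => (bump x)%:C) `<=` cube a.
Proof.
have cl : closed (cube a : set 'rV[R]_n).
  by apply: compact_closed; [exact: norm_hausdorff|exact: compact_cube_set].
rewrite /fsupport [X in _ `<=` X](closure_id (cube a)).1//.
apply: closureS => x /=; apply: contraPP => /bump_out ->.
by rewrite eqxx.
Qed.

Lemma smooth0 : smooth (fun=> 0 : R) (n := n).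
Proof.
move=> s; have -> : partial_deriv s (fun _ : 'rV[R]_n => 0 : R) = fun=> 0.
  by elim: s => [//|l s IHs] /=; rewrite IHs; apply/funext => x; exact: derive_cst.
split; first exact: cst_continuous.
by move=> l x; exact: derivable_cst.
Qed.

Lemma test_function_bump : test_function (fun x => (bump x)%:C).
Proof.
split.
- exact: (smooth_prod_coord bump_derP).
- exact: smooth0.
- exact: (compact_fsupportS compact_cube_set fsupport_bump).
Qed.

Lemma integrable_bump : leb.-integrable setT (fun x => (bump x)%:E).
Proof.
exact: (cintegrable_Re (cube_bounded_integrable
  (test_function_cube_bounded test_function_bump))).
Qed.

Lemma integral_bump_gt0 : 0 < \int[leb]_x bump x.
Proof.
(* [q] is the minimum of one factor on |x| <= a/2. *)
pose q : R := expR (- (a ^+ 2 - (a / 2) ^+ 2)^-1).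
have q0 : 0 < q by exact: expR_gt0.
have qn : 0 < q ^+ n by rewrite exprn_gt0.
apply: (@lt_le_trans _ _ (\int[leb]_x (q ^+ n * \1_(cube (a / 2)) x))).
  rewrite RintegralZl//; last first.
    have := integrable_cube (R := R) (n := n) (a / 2) 1.
    by under eq_fun do rewrite mul1r.
  rewrite mulr_gt0// /Rintegral integral_indic//; last exact: measurable_cube.
  rewrite setIT [X in fine X](_ : _ =
    (\prod_(i < n) @lebesgue_measure R `[(- (a / 2))%R, (a / 2)%R]%classic)%E); last first.
    exact: lebesgue_rV_box.
  under eq_bigr => i _ do rewrite lebesgue_measure_itv/=.
  have a2 : 0 < a / 2 by rewrite divr_gt0.
  have aa : - (a / 2) < a / 2 by rewrite gtrN.
  rewrite lte_fin aa -EFinB prodEFin /=.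
  by apply: prodr_gt0 => i _; rewrite subr_gt0.
apply: le_Rintegral => //.
- exact: integrable_cube.
- exact: integrable_bump.
move=> x _; rewrite indicE; case: (boolP (_ \in _)) => [|_]; last first.
  by rewrite mulr0 bump_ge0.
rewrite inE mulr1 => /cubeP xa.
have -> : q ^+ n = \prod_(j < n) q by rewrite prodr_const card_ord.
apply: ler_prod => j _; rewrite (ltW q0)/= bump_factorE.
have xa2 : x 0 j ^+ 2 <= (a / 2) ^+ 2.
  by rewrite -(real_normK (num_real (x 0 j))) ler_pXn2r ?nnegrE ?divr_ge0 ?(ltW a0).
have a2 : (a / 2) ^+ 2 < a ^+ 2.
  by rewrite ltr_pXn2r ?nnegrE ?divr_ge0 ?(ltW a0)// gtr_pMr// invf_lt1 // ltr1n.
rewrite (le_lt_trans xa2 a2) ler_expR lerN2 lef_pV2 ?posrE ?subr_gt0//.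
  by rewrite lerD2l lerN2.
exact: le_lt_trans xa2 a2.
Qed.

Definition bump_hat t : R[i] :=
  fourier (fun x => (bump x)%:C) t * ((\int[leb]_x bump x)%:C)^-1.

(** On the cube of half-width a the phase is at most a times the sum of the |t_l|. The constant 4 is
    the 2 of [normc_cexpiB1] times the 2 of [le_normc_cintegral]. *)
Lemma normc_bump_hatB1 t :
  normc (bump_hat t - 1) <= 4 * (\sum_(l < n) `|t 0 l|) * a.
Proof.
set S := \sum_(l < n) _; set c := \int[leb]_x bump x.
have c0 : 0 < c by exact: integral_bump_gt0.
have cC : c%:C != 0 :> R[i] by rewrite eq_complex /= gt_eqF.
have tb := test_function_cube_bounded test_function_bump.
have E : fourier (fun x => (bump x)%:C) t - c%:C =
    cintegral leb (fun x => (bump x)%:C * (plane_wave x t - 1)).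
  have -> : c%:C = cintegral leb (fun x => (bump x)%:C).
    by apply: complex_ext => //=; rewrite Rintegral_cst// mul0r.
  rewrite fourierE -cintegralB.
  - by congr cintegral; apply/funext => x; rewrite mulrBr mulr1.
  - exact/cube_bounded_integrable/cube_bounded_wave.
  - exact: cube_bounded_integrable.
have B : normc (fourier (fun x => (bump x)%:C) t - c%:C) <=
    2 * \int[leb]_x (2 * a * S * bump x).
  rewrite E; apply: le_normc_cintegral.
  - apply: cmeasurableM; first exact: tb.1.
    by apply: cmeasurableB; [exact: measurable_plane_wave_l|exact: cmeasurable_cst].
  - exact: (integrableZl _ (2 * a * S) integrable_bump).
  - move=> x; rewrite normcM normc_real (ger0_norm (bump_ge0 x)) mulrC.
    have [xa|xa] := pselect (cube a x); last by rewrite (bump_out xa) !mulr0.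
    rewrite ler_wpM2r ?bump_ge0// (le_trans (normc_cexpiB1 _))//.
    rewrite normrN -mulrA ler_pM2l// /dot /S mulr_sumr.
    rewrite (le_trans (ler_norm_sum _ _ _))//; apply: ler_sum => l _.
    by rewrite normrM ler_wpM2r//; exact: (cubeP _ _).1 xa l.
rewrite /bump_hat (_ : _ - 1 = (fourier (fun x => (bump x)%:C) t - c%:C) * c%:C^-1); last first.
  by rewrite mulrBl mulfV.
rewrite normcM normcV normc_real (gtr0_norm c0) ler_pdivrMr// (le_trans B)//.
rewrite RintegralZl//; last exact: integrable_bump.
by rewrite -/c le_eqVlt; apply/orP; left; apply/eqP; ring.
Qed.

Lemma normc_bump_hat_le2 t : normc (bump_hat t) <= 2.
Proof.
have c0 : 0 < \int[leb]_x bump x by exact: integral_bump_gt0.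
rewrite normcM normcV normc_real (gtr0_norm c0) ler_pdivrMr// fourierE.
apply: le_normc_cintegral.
- apply: cmeasurableM; last exact: measurable_plane_wave_l.
  exact: (test_function_cube_bounded test_function_bump).1.
- exact: integrable_bump.
- move=> x; rewrite normcM normc_plane_wave mulr1 normc_real.
  by rewrite (ger0_norm (bump_ge0 x)).
Qed.

End bump_rV.

(** * From the Fourier support to the Nevanlinna condition *)

Section locally_null.
Context (R : realType) (n : nat) (mu : {sigma_finite_measure set 'rV[R]_n -> \bar R}).
Hypothesis growth : growth_condition mu.
Local Notation leb := (lebesgue_rV R n).
Implicit Types (phi : 'rV[R]_n -> R[i]) (U K : set 'rV[R]_n) (x y t : 'rV[R]_n).

Definition fourier_null_on U := forall phi, test_function phi ->
  fsupport phi `<=` U -> cintegral mu (fourier phi) = 0.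

Lemma cintegrable_fourier phi : test_function phi -> cintegrable mu (fourier phi).
Proof.
move=> tphi; have [C _ phiC] := fourier_decay tphi.
apply: (@cintegrable_le _ _ _ _ _ (fun t => C * cauchy_weight t)) => //.
  exact/measurable_fourier/test_function_cube_bounded.
exact: (integrableZl _ C (integrable_cauchy_weight growth)).
Qed.

Lemma cintegral_fourier_bump_wave U y (a : R) : 0 < a -> fourier_null_on U ->
  (forall x, cube a x -> U (y + x)) ->
  cintegral mu (fun t => fourier (fun x => (bump a x)%:C) t * plane_wave y t) = 0.
Proof.
move=> a0 nullU yU; have tb := test_function_bump (n := n) a0.
transitivity (cintegral mu (fourier (fun x => (bump a (x + - y))%:C))).
  congr cintegral; apply/funext => t.
  by rewrite (fourier_translate (- y) t tb) opprK mulrC.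
apply: nullU; first exact: (test_function_translate (- y) tb).
move=> x /(fsupport_translate (phi := fun z => (bump a z)%:C)) /(fsupport_bump a0).
by move=> /yU; rewrite addrCA subrr addr0.
Qed.

(** A Lebesgue number for a cover given by a property of open sets, phrased with cubes because these
    contain the supports of the bumps. *)
Lemma compact_lebesgue_number (Q : set 'rV[R]_n -> Prop) K : compact K ->
  (forall x, K x -> exists U, [/\ open U, U x & Q U]) ->
  exists N, forall k y, (N <= k)%N -> K y ->
    exists2 U, Q U & forall x, cube (k.+1%:R^-1 : R) x -> U (y + x).
Proof.
move=> /compact_near_coveringP cK hK.
pose P (k : nat) y := exists2 U, Q U & forall x, cube (k.+1%:R^-1 : R) x -> U (y + x).
have /(_ nat \oo P _) [] := cK.
  move=> x /hK[U [oU Ux QU]].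
  have /nbhs_ballP[e /= e0 eU] : nbhs x U by exact: open_nbhs_nbhs.
  have e20 : 0 < e / 2 by rewrite divr_gt0.
  exists (ball x (e / 2), [set k | k.+1%:R^-1 < e / 2]) => /=.
    split; first exact: nbhsx_ballx.
    exact: near_infty_natSinv_lt (PosNum e20).
  move=> [y k] /= [xy ke]; exists U => // v /cubeP vk; apply: eU.
  split=> // i j; have := xy.2 i j; rewrite (ord1 i) /ball /= mxE => xyj.
  rewrite opprD addrA (splitr e) (le_lt_trans (ler_normB _ _))// ltrD//.
  by rewrite (le_lt_trans (vk j)).
by move=> N _ hN; exists N => k y Nk Ky; exact: hN.
Qed.

(** Plays the role of a partition of unity. Multiplying [fourier phi] by [bump_hat] and applying
    Fubini writes the integral as an average, over y in the support of [phi], of pairings with small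
    bumps centred at y. Each bump fits into one null open set by the Lebesgue number, so every
    pairing vanishes; then [bump_hat] tends to 1. *)
Lemma locally_null_null phi : test_function phi ->
  (forall x, fsupport phi x -> exists U, [/\ open U, U x & fourier_null_on U]) ->
  cintegral mu (fourier phi) = 0.
Proof.
move=> tphi locn; have bphi := test_function_cube_bounded tphi.
have [C C0 phiC] := fourier_decay tphi.
have [N hN] : exists N, forall k y, (N <= k)%N -> fsupport phi y ->
    exists2 U, fourier_null_on U & forall x, cube (k.+1%:R^-1 : R) x -> U (y + x).
  by apply: compact_lebesgue_number => //; have [] := tphi.
pose a k : R := (k + N).+1%:R^-1.
have a0 k : 0 < a k by rewrite invr_gt0.
have mhat k : cmeasurable (bump_hat (n := n) (a k)).
  apply: cmeasurableM; last exact: cmeasurable_cst.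
  exact/measurable_fourier/test_function_cube_bounded/test_function_bump.
apply: (@cintegral_lim0 _ _ _ _ (fun k t => fourier phi t * bump_hat (a k) t) _
  (fun t => C * 2 * cauchy_weight t)).
- by move=> k; apply: cmeasurableM => //; exact: measurable_fourier.
- exact: (integrableZl _ (C * 2) (integrable_cauchy_weight growth)).
- move=> k t; rewrite normcM mulrAC.
  apply: ler_pM; rewrite ?normc_ge0//; exact: normc_bump_hat_le2.
- move=> t; apply: (@squeeze_cvg0 _ _
    (C * cauchy_weight t * (4 * (\sum_(l < n) `|t 0 l|)))) => k.
  rewrite [X in normc X](_ : _ = fourier phi t * (bump_hat (a k) t - 1)); last first.
    by rewrite mulrBr mulr1.
  rewrite normc_ge0 normcM -mulrA andTb.
  apply: ler_pM; rewrite ?normc_ge0//.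
  rewrite (le_trans (normc_bump_hatB1 _ _))// ler_wpM2l//.
    by rewrite mulr_ge0// sumr_ge0.
  by rewrite /a lef_pV2 ?posrE// ler_nat ltnS leq_addr.
- move=> k; set c := (\int[leb]_x bump (a k) x)%:C.
  pose b : 'rV[R]_n -> R[i] := fun x => (bump (a k) x)%:C.
  have tb : test_function b by exact: test_function_bump.
  transitivity (cintegral mu (fun t => c^-1 * (fourier phi t * fourier b t))).
    by congr cintegral; apply/funext => t; rewrite /bump_hat mulrA mulrC.
  rewrite cintegralZ; last first.
    have [C' _ bC] := fourier_bounded (test_function_cube_bounded tb).
    apply: cintegrableMr bC; first exact: cintegrable_fourier.
    exact/measurable_fourier/test_function_cube_bounded.
  rewrite fourier_Fubini//; last exact: cintegrable_fourier.
  rewrite (_ : (fun x => _) = fun=> 0) ?cintegral0 ?mulr0//; apply/funext => y.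
  have [ys|/fsupportP ->] := pselect (fsupport phi y); last by rewrite mul0r.
  have [U nullU yU] := hN (k + N)%N y (leq_addl _ _) ys.
  by rewrite (cintegral_fourier_bump_wave _ nullU yU) ?mulr0.
Qed.

End locally_null.

(** * Multiplication by a Cauchy kernel *)

Section resolvent_multiplier.
Context disp (T : measurableType disp) (R : realType) (mu : {measure set T -> \bar R}).
Variables (h : T -> R[i]) (tau : T -> R).
Hypotheses (ih : cintegrable mu h) (mtau : measurable_fun setT tau).
Hypothesis h0 : forall d : R, 0 <= d ->
  cintegral mu (fun t => h t * cexpi (- (d * tau t))) = 0.

Let den (z : R[i]) (d x : R) : R[i] := 1 - (0 +i* d) * z - cexpi (- (d * x)).

(** The real part of 1 - idz is 1 + d Im z, and the cosine is at most 1. This keeps d / [den z d x]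
    below 1 / Im z uniformly in d and x. *)
Let Re_den (z : R[i]) (d x : R) : 0 < complex.Im z -> 0 < d ->
  d * complex.Im z <= complex.Re (den z d x).
Proof.
move=> z0 d0; rewrite /den !(ReD, ReN) ReM /= mul0r sub0r opprK lerBrDr [leRHS]addrC.
by rewrite lerD2l cos_le1.
Qed.

Let normc_den_ge (z : R[i]) (d x : R) : 0 < complex.Im z -> 0 < d ->
  d * complex.Im z <= normc (den z d x).
Proof.
move=> z0 d0; rewrite (le_trans (Re_den x z0 d0))//.
by rewrite (le_trans (ler_norm _))// ler_normRe.
Qed.

Let normc_denV (z : R[i]) (d x : R) : 0 < complex.Im z -> 0 < d ->
  normc (den z d x)^-1 <= (d * complex.Im z)^-1.
Proof.
move=> z0 d0; rewrite normcV lef_pV2 ?posrE ?normc_den_ge ?mulr_gt0//.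
by rewrite (lt_le_trans _ (normc_den_ge x z0 d0))// mulr_gt0.
Qed.

Let den_neq0 (z : R[i]) (d x : R) : 0 < complex.Im z -> 0 < d -> den z d x != 0.
Proof.
move=> z0 d0; rewrite -normc_gt0 (lt_le_trans _ (normc_den_ge x z0 d0))//.
by rewrite mulr_gt0.
Qed.

Let mden (z : R[i]) (d : R) : cmeasurable (fun t => (den z d (tau t))^-1).
Proof.
apply: cmeasurableV; apply: cmeasurableB; first exact: cmeasurable_cst.
apply: cmeasurable_cexpi; apply: measurableT_comp => //.
exact: measurable_funM.
Qed.

(* Geometric series: [1 / (w - E) = \sum_k w^-(k+1) E^k] with [w = 1 - i d z],
   [|w| > 1] and [E = exp (- i d tau)]. *)
Let cintegral_den0 (z : R[i]) (d : R) : 0 < complex.Im z -> 0 < d ->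
  cintegral mu (fun t => h t * (den z d (tau t))^-1) = 0.
Proof.
move=> z0 d0; set y := complex.Im z in z0 *.
pose w : R[i] := 1 - (0 +i* d) * z; pose q := w^-1.
have w1 : 1 + d * y <= normc w.
  have -> : 1 + d * y = complex.Re w by rewrite /w ReD ReN ReM /= mul0r sub0r opprK.
  by rewrite (le_trans (ler_norm _))// ler_normRe.
have dy0 : 0 < d * y by rewrite mulr_gt0.
have w0 : w != 0 by rewrite -normc_gt0 (lt_le_trans _ w1)// addr_gt0.
have q1 : `|normc q| < 1.
  rewrite ger0_norm ?normc_ge0// /q normcV invf_lt1 ?normc_gt0//.
  by rewrite (lt_le_trans _ w1)// ltrDl.
pose E t := cexpi (- (d * tau t)).
have qE t : normc (q * E t) = normc q by rewrite normcM normc_cexpi mulr1.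
have sumE N t : (den z d (tau t))^-1 * (1 - (q * E t) ^+ N) =
    \sum_(i < N) q ^+ i.+1 * E t ^+ i.
  have -> : 1 - (q * E t) ^+ N = (den z d (tau t)) * \sum_(i < N) q ^+ i.+1 * E t ^+ i.
    rewrite -opprB subrX1 -mulNr opprB.
    have -> : 1 - q * E t = q * den z d (tau t).
      by rewrite /den -/w -/(E t) mulrBr /q mulVf.
    rewrite [q * den _ _ _]mulrC -mulrA mulr_sumr; congr (_ * _).
    by apply: eq_bigr => i _; rewrite exprMn mulrA -exprS.
  by rewrite mulrA mulVf ?den_neq0// mul1r.
have mE : cmeasurable E.
  by apply: cmeasurable_cexpi; apply: measurableT_comp => //; exact: measurable_funM.
have [mh inh] := ih.
apply: (@cintegral_lim0 _ _ _ _
  (fun N t => h t * ((den z d (tau t))^-1 * (1 - (q * E t) ^+ N))) _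
  (fun t => (2 * (d * y)^-1) * normc (h t))).
- move=> N; apply: cmeasurableM => //; apply: cmeasurableM => //.
  apply: cmeasurableB; first exact: cmeasurable_cst.
  by apply: cmeasurableX; apply: cmeasurableM => //; exact: cmeasurable_cst.
- exact: (integrableZl _ _ inh).
- move=> N t; rewrite !normcM mulrC ler_wpM2r ?normc_ge0// mulrC.
  apply: ler_pM; rewrite ?normc_ge0//; last exact: normc_denV.
  rewrite (le_trans (normcB _ _))// normc1 normcX qE lerD2l.
  by rewrite exprn_ile1 ?normc_ge0// ltW// (le_lt_trans (ler_norm _)).
- move=> t; rewrite (_ : (fun N => _) = fun N =>
      normc (h t * (den z d (tau t))^-1) * normc q ^+ N); last first.
    apply/funext => N; rewrite -(qE t) -normcX -normcM -normcN.
    by congr normc; ring.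
  rewrite -[X in _ --> X](mulr0 (normc (h t * (den z d (tau t))^-1))).
  by apply: cvgM; [exact: cvg_cst|exact: cvg_expr].
- move=> N; transitivity (cintegral mu (fun t => \sum_(i < N) q ^+ i.+1 * (h t * E t ^+ i))).
    congr cintegral; apply/funext => t; rewrite sumE mulr_sumr.
    by apply: eq_bigr => i _; rewrite mulrCA.
  have iE i : cintegrable mu (fun t => h t * E t ^+ i).
    apply: (@cintegrableMr _ _ _ _ _ _ 1) => //; first exact: cmeasurableX.
    by move=> t; rewrite normcX normc_cexpi expr1n.
  have iS (i : 'I_N) := cintegrableZ (q ^+ i.+1) (iE i).
  rewrite (cintegral_sum _ iS).2 big1// => i _; rewrite cintegralZ//.
  rewrite [X in _ * X](_ : _ = 0) ?mulr0//.
  rewrite -(h0 (mulr_ge0 (ler0n _ i) (ltW d0))).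
  congr cintegral; apply/funext => t; congr (_ * _).
  by rewrite /E cexpiX mulrN mulrA.
Qed.

(* [d / (1 - i d z - exp (- i d x))] tends to [1 / (i (x - z))] as [d -> 0+]. *)
Lemma cintegral_cauchy_multiplier (z : R[i]) : 0 < complex.Im z ->
  cintegral mu (fun t => h t * cauchy z (tau t)) = 0.
Proof.
move=> z0; set y := complex.Im z; have y0 : 0 < y by [].
have zn0 : complex.Im z != 0 by rewrite gt_eqF.
have [mh inh] := ih.
pose a k : R := k.+1%:R^-1; have a0 k : 0 < a k by rewrite invr_gt0.
apply: (@cintegral_lim0 _ _ _ _
  (fun k t => h t * ((0 +i* a k) * (den z (a k) (tau t))^-1)) _
  (fun t => y^-1 * normc (h t))).
- move=> k; apply: cmeasurableM => //; apply: cmeasurableM => //.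
  exact: cmeasurable_cst.
- exact: (integrableZl _ _ inh).
- move=> k t; rewrite !normcM mulrC ler_wpM2r ?normc_ge0//.
  have -> : normc (0 +i* a k) = a k.
    by rewrite /= expr0n add0r sqrtr_sqr ger0_norm ?(ltW (a0 k)).
  rewrite -ler_pdivlMl// -invfM; exact: normc_denV.
- move=> t; apply: (@squeeze_cvg0 _ _ (normc (h t) * (2 * tau t ^+ 2 / y ^+ 2))) => k.
  rewrite normc_ge0 andTb -mulrBr normcM -[leRHS]mulrA.
  apply: ler_wpM2l; rewrite ?normc_ge0//.
  set x := tau t; set D := den z (a k) x.
  have D0 : D != 0 by exact: den_neq0.
  have xz0 : x%:C - z != 0 by exact: cauchy_den_neq0.
  (* The difference is the Taylor remainder of exp(-iax), of order a^2, divided by [D] and by x - z.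
     As |D| is at least a Im z, a factor a remains. *)
  have -> : (0 +i* a k) * D^-1 - cauchy z x =
      (cexpi (- (a k * x)) - (1 +i* (- (a k * x)))) * (D^-1 * cauchy z x).
    have -> : cexpi (- (a k * x)) - (1 +i* (- (a k * x))) =
        (0 +i* a k) * (x%:C - z) - D.
      rewrite /D /den; move: (cexpi _) => [e1 e2]; case: (z) => z1 z2.
      by apply: complex_ext; simpc; rewrite /=; ring.
    by rewrite /cauchy; field; rewrite D0 xz0.
  have -> : 2 * x ^+ 2 / y ^+ 2 * k.+1%:R^-1 =
      2 * (- (a k * x)) ^+ 2 * ((a k * y)^-1 * y^-1).
    by rewrite /a; field; rewrite gt_eqF//= pnatr_eq0.
  rewrite !normcM; apply: ler_pM; rewrite ?normc_ge0 ?mulr_ge0 ?normc_ge0//.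
    exact: normc_cexpi_taylor.
  apply: ler_pM; rewrite ?normc_ge0//; first exact: normc_denV.
  by apply: normc_cauchy_le => //; exact: ler_norm.
- move=> k; transitivity (cintegral mu (fun t =>
      (0 +i* a k) * (h t * (den z (a k) (tau t))^-1))).
    by congr cintegral; apply/funext => t; rewrite mulrCA.
  rewrite cintegralZ ?cintegral_den0 ?mulr0//.
  exact: (cintegrableMr ih (mden z (a k)) (fun t => normc_denV (tau t) z0 (a0 k))).
Qed.

End resolvent_multiplier.

(** * Densities whose transform vanishes on a closed quadrant *)

Section annihilated.
Context (R : realType) (n : nat) (mu : {measure set 'rV[R]_n -> \bar R}).
Variables j1 j2 : 'I_n.
Hypothesis j12 : j1 != j2.
Implicit Types (h : 'rV[R]_n -> R[i]) (s t : 'rV[R]_n) (z : R[i]) (l : 'I_n).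

(** The closed conditions include s = 0, where the statement is the vanishing of the integral
    itself. *)
Definition annihilated h := cintegrable mu h /\
  forall s, 0 <= s 0 j1 -> s 0 j2 <= 0 ->
    cintegral mu (fun t => h t * plane_wave s t) = 0.

Lemma cintegrable_wave h s : cintegrable mu h ->
  cintegrable mu (fun t => h t * plane_wave s t).
Proof.
move=> ih; apply: (cintegrableMr ih (measurable_plane_wave s) (M := 1)) => t.
by rewrite normc_plane_wave.
Qed.

Lemma annihilatedB h h' : annihilated h -> annihilated h' ->
  annihilated (fun t => h t - h' t).
Proof.
move=> [ih h0] [ih' h0']; split; first exact: cintegrableB.
move=> s s1 s2; under eq_fun do rewrite mulrBl.
by rewrite cintegralB ?h0 ?h0' ?subr0//; exact: cintegrable_wave.
Qed.

Lemma plane_wave_delta (d : R) l t :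
  plane_wave (d *: delta_mx 0 l) t = cexpi (- (d * t 0 l)).
Proof.
rewrite /plane_wave /dot (bigD1 l)//= !mxE !eqxx mulr1 big1 ?addr0// => i il.
by rewrite !mxE (negbTE il) andbF mulr0 mul0r.
Qed.

(** The multiplier only uses shifts of s by d >= 0 along the direction l. For l different from j2
    these leave s_j2 unchanged and can only increase s_j1, so they preserve the quadrant. *)
Lemma annihilated_cauchy h l z : 0 < complex.Im z -> l != j2 ->
  annihilated h -> annihilated (fun t => h t * cauchy z (t 0 l)).
Proof.
move=> z0 lj [ih h0].
have mc : cmeasurable (fun t : 'rV[R]_n => cauchy z (t 0 l)).
  exact: (cmeasurable_comp (measurable_cauchy z) (@measurable_coord_rV R n l)).
split.
  apply: (cintegrableMr ih mc (M := (complex.Im z)^-1)) => t.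
  by apply: normc_cauchy_le => //; exact: ler_norm.
move=> s s1 s2; under eq_fun do rewrite mulrAC.
apply: (cintegral_cauchy_multiplier (cintegrable_wave s ih)
  (@measurable_coord_rV R n l)) => // d d0.
have := h0 (s + d *: delta_mx 0 l).
rewrite !mxE (eq_sym j2) (negbTE lj) andbF mulr0 addr0 => h0'; rewrite -[RHS]h0'//.
  congr cintegral; apply/funext => t.
  by rewrite plane_waveD plane_wave_delta mulrA.
by apply: addr_ge0 => //; rewrite mulr_ge0.
Qed.

(** In the variable - t_l the conjugate kernel has its pole at [- conjc z], in the upper half-plane.
    The shifts along l are now by -d, which leaves s_j1 unchanged and can only decrease s_j2. *)
Lemma annihilated_cauchy_conj h l z : 0 < complex.Im z -> l != j1 ->
  annihilated h -> annihilated (fun t => h t * cauchy (conjc z) (t 0 l)).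
Proof.
move=> z0 lj [ih h0].
have mc : cmeasurable (fun t : 'rV[R]_n => cauchy (conjc z) (t 0 l)).
  exact: (cmeasurable_comp (measurable_cauchy _) (@measurable_coord_rV R n l)).
split.
  apply: (cintegrableMr ih mc (M := (complex.Im z)^-1)) => t.
  by apply: normc_cauchy_le => //; rewrite Im_conjc normrN; exact: ler_norm.
move=> s s1 s2.
have z0' : 0 < complex.Im (- conjc z) by rewrite ImN Im_conjc opprK.
have mN : measurable_fun setT (fun t : 'rV[R]_n => - t 0 l).
  by apply: measurableT_comp => //; exact: measurable_coord_rV.
have E t : h t * cauchy (conjc z) (t 0 l) * plane_wave s t =
    - (h t * plane_wave s t * cauchy (- conjc z) (- t 0 l)).
  rewrite mulrAC -mulrN; congr (_ * _).
  by rewrite /cauchy -invrN opprD rmorphN /= !opprK.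
under eq_fun do rewrite E.
have iw := cintegrable_wave s ih.
rewrite cintegralN; last first.
  apply: (cintegrableMr iw (M := (complex.Im z)^-1)).
    exact: (cmeasurable_comp (measurable_cauchy _) mN).
  move=> t; apply: normc_cauchy_le => //.
  by rewrite ImN Im_conjc opprK; exact: ler_norm.
rewrite (cintegral_cauchy_multiplier iw mN _ z0') ?oppr0// => d d0.
have := h0 (s + (- d) *: delta_mx 0 l).
rewrite !mxE (eq_sym j1) (negbTE lj) andbF mulr0 addr0 => h0'; rewrite -[RHS]h0'//.
  congr cintegral; apply/funext => t.
  by rewrite plane_waveD plane_wave_delta mulrA mulrN mulNr.
by rewrite (le_trans _ s2)// gerDl mulNr oppr_le0 mulr_ge0.
Qed.

Lemma annihilated_factor h l z : 0 < complex.Im z -> annihilated h ->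
  annihilated (fun t => h t * nevanlinna_factor j1 j2 l z (t 0 l)).
Proof.
move=> z0 ah; rewrite /nevanlinna_factor.
case: eqVneq => [->|l1].
  under eq_fun do rewrite mulrA.
  by apply: annihilated_cauchy => //; apply: annihilated_cauchy.
case: eqVneq => [->|l2].
  under eq_fun do rewrite mulrA.
  by apply: annihilated_cauchy_conj; rewrite 1?eq_sym//;
    apply: annihilated_cauchy_conj; rewrite 1?eq_sym.
under eq_fun do rewrite mulrBr.
by apply: annihilatedB; [exact: annihilated_cauchy|exact: annihilated_cauchy_conj].
Qed.

Lemma annihilated_kernel h (z : 'rV[R[i]]_n) : (forall l, 0 < complex.Im (z 0 l)) ->
  annihilated h -> annihilated (fun t => h t * nevanlinna_kernel z j1 j2 t).
Proof.
move=> z0.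
have -> : nevanlinna_kernel z j1 j2 = fun t =>
    \prod_(l < n) nevanlinna_factor j1 j2 l (z 0 l) (t 0 l).
  by apply/funext => t; rewrite nevanlinna_kernel_prod.
elim: (index_enum _) h => [|l r IHr] h ah.
  by under eq_fun do rewrite big_nil mulr1.
under eq_fun do rewrite big_cons mulrA.
exact/IHr/annihilated_factor.
Qed.

End annihilated.

(** * The Nevanlinna condition from local vanishing *)

Section nevanlinna_of_locally_null.
Context (R : realType) (n : nat) (mu : {sigma_finite_measure set 'rV[R]_n -> \bar R}).
Hypothesis growth : growth_condition mu.
Variables j1 j2 : 'I_n.
Hypothesis j12 : j1 != j2.
Hypothesis locn : forall x : 'rV[R]_n, 0 < x 0 j1 -> x 0 j2 < 0 ->
  exists U, [/\ open U, U x & fourier_null_on mu U].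
Local Notation leb := (lebesgue_rV R n).

(* The shift moves the Fourier support of [bump_hat a] into the open set
   where [x_j1 > 0 > x_j2]. *)
Let shift_vec (a : R) : 'rV[R]_n := (2 * a) *: (delta_mx 0 j1 - delta_mx 0 j2).

Let shift1 a : shift_vec a 0 j1 = 2 * a.
Proof. by rewrite !mxE !eqxx /= (negbTE j12) subr0 mulr1. Qed.

Let shift2 a : shift_vec a 0 j2 = - (2 * a).
Proof. by rewrite !mxE !eqxx /= eq_sym (negbTE j12) sub0r mulrN1. Qed.

Let hmult (a : R) (t : 'rV[R]_n) : R[i] := plane_wave (shift_vec a) t * bump_hat a t.

Let annihilated_hmult (a : R) : 0 < a -> annihilated mu j1 j2 (hmult a).
Proof.
move=> a0; pose b : 'rV[R]_n -> R[i] := fun x => (bump a x)%:C.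
have tb : test_function b by exact: test_function_bump.
have ib := cintegrable_fourier growth tb.
have ih : cintegrable mu (bump_hat a).
  rewrite /bump_hat; under [X in cintegrable _ X]eq_fun do rewrite mulrC.
  exact: cintegrableZ.
split.
  rewrite /hmult; under [X in cintegrable _ X]eq_fun do rewrite mulrC.
  exact: cintegrable_wave.
move=> s s1 s2.
transitivity (cintegral mu (fun t => ((\int[leb]_x bump a x)%:C)^-1 *
    fourier (fun x => b (x + - (s + shift_vec a))) t)).
  congr cintegral; apply/funext => t.
  rewrite (fourier_translate _ _ tb) opprK plane_waveD /hmult /bump_hat -/b.
  by ring.
have tt := test_function_translate (- (s + shift_vec a)) tb.
rewrite cintegralZ; last exact: (cintegrable_fourier growth tt).
rewrite (locally_null_null growth tt) ?mulr0//.
(* The support lies within a of [s + shift_vec a], whose coordinates at j1 and j2 are at least 2a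
   and at most -2a; a margin a is left on both sides. *)
move=> x /fsupport_translate /(fsupport_bump a0) /cubeP xa; apply: locn.
  have := xa j1.
  have -> : (x - (s + shift_vec a)) 0 j1 = x 0 j1 - (s 0 j1 + 2 * a).
    by rewrite -(shift1 a) !mxE.
  rewrite ler_norml.
  by move=> /andP[+ _]; move: a0 s1; lra.
have := xa j2.
  have -> : (x - (s + shift_vec a)) 0 j2 = x 0 j2 - (s 0 j2 + - (2 * a)).
    by rewrite -(shift2 a) !mxE.
  rewrite ler_norml.
by move=> /andP[_ +]; move: a0 s2; lra.
Qed.

Lemma nevanlinna_of_locally_null (z : 'rV[R[i]]_n) :
  (forall l, 0 < complex.Im (z 0 l)) ->
  cintegral mu (nevanlinna_kernel z j1 j2) = 0.
Proof.
move=> z0; pose a k : R := k.+1%:R^-1.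
have a0 k : 0 < a k by rewrite invr_gt0.
have KE t : nevanlinna_kernel z j1 j2 t =
    \prod_(l < n) nevanlinna_factor j1 j2 l (z 0 l) (t 0 l).
  exact: nevanlinna_kernel_prod.
have [C KC] : exists C : R, forall t,
    normc (nevanlinna_kernel z j1 j2 t) <= C * cauchy_weight t.
  have [C hC] := normc_prod_decay predT (fun l => decay_nevanlinna_factor j1 j2 l (z0 l)).
  by exists C => t; rewrite KE.
have ak k := annihilated_kernel j12 z0 (annihilated_hmult (a0 k)).
apply: (@cintegral_lim0 _ _ _ _
  (fun k t => hmult (a k) t * nevanlinna_kernel z j1 j2 t) _
  (fun t => 2 * C * cauchy_weight t)).
- by move=> k; have [[]] := ak k.
- exact: (integrableZl _ (2 * C) (integrable_cauchy_weight growth)).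
- move=> k t; rewrite normcM [normc (hmult _ _)]normcM normc_plane_wave mul1r.
  rewrite -mulrA.
  by apply: ler_pM; rewrite ?normc_ge0//; exact: normc_bump_hat_le2.
(* The first term of [S] accounts for [bump_hat], the second for the shift, which also tends to 0
   with a. *)
- move=> t; pose S := 4 * (\sum_(l < n) `|t 0 l|) + 4 * `|t 0 j1 - t 0 j2|.
  apply: (@squeeze_cvg0 _ _ (S * normc (nevanlinna_kernel z j1 j2 t))) => k.
  rewrite [X in normc X](_ : _ = (hmult (a k) t - 1) * nevanlinna_kernel z j1 j2 t);
    last by rewrite mulrBl mul1r.
  rewrite normc_ge0 andTb normcM [leRHS]mulrAC ler_wpM2r ?normc_ge0//.
  rewrite /hmult; set p := plane_wave _ _; set b := bump_hat _ _.
  have -> : p * b - 1 = p * (b - 1) + (p - 1) by ring.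
  rewrite (le_trans (le_normcD _ _))// mulrDl lerD//.
    by rewrite normcM normc_plane_wave mul1r; exact: normc_bump_hatB1.
  rewrite (le_trans (normc_cexpiB1 _))// normrN.
  have -> : dot (shift_vec (a k)) t = 2 * a k * (t 0 j1 - t 0 j2).
    rewrite /dot; transitivity (\sum_(i < n) 2 * a k *
        (((i == j1)%:R - (i == j2)%:R) * t 0 i)).
      by apply: eq_bigr => i _; rewrite !mxE /= mulrA.
    rewrite -mulr_sumr; congr (_ * _).
    under eq_bigr do rewrite mulrBl.
    rewrite sumrB (bigD1 j1)//= eqxx mul1r big1 ?addr0; last first.
      by move=> i /negbTE ->; rewrite mul0r.
    rewrite (bigD1 j2)//= eqxx mul1r big1 ?addr0// => i /negbTE ->.
    by rewrite mul0r.
  rewrite !normrM (ger0_norm (ltW (a0 k))) (ger0_norm (ler0n _ 2)).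
  by rewrite le_eqVlt; apply/orP; left; apply/eqP; rewrite /a; ring.
(* Annihilation is used at s = 0 only, where the plane wave is 1. *)
- move=> k; have := (ak k).2 0; rewrite !mxE lexx => /(_ isT isT) <-.
  by congr cintegral; apply/funext => t; rewrite plane_wave0 mulr1.
Qed.

End nevanlinna_of_locally_null.

(** Chebyshev's inequality bounds the measure of each superlevel set of the positive weight, and
    these sets exhaust the space. *)
Lemma growth_sigma_finite (R : realType) (n : nat)
  (mu : {measure set 'rV[R]_n -> \bar R}) : growth_condition mu -> sigma_finite setT mu.
Proof.
move=> growth; pose F k := [set t : 'rV[R]_n | k.+1%:R^-1 <= cauchy_weight t].
have mF k : measurable (F k).
  rewrite (_ : F k = setT `&` (@cauchy_weight R n) @^-1` `[k.+1%:R^-1, +oo[%classic).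
    exact: (measurable_cauchy_weight measurableT).
  by apply/seteqP; split=> t /=; rewrite in_itv/= andbT; [|case].
exists F => [|k].
  apply/esym/seteqP; split=> // t _.
  have w0 : 0 < cauchy_weight t.
    by apply: prodr_gt0 => l _; rewrite invr_gt0 ltr_wpDr ?sqr_ge0.
  have /ltr_add_invr[k] := w0; rewrite add0r => kw.
  by exists k => //=; exact: ltW.
split => //; have k0 : 0 < k.+1%:R^-1 :> R by rewrite invr_gt0.
suff : ((k.+1%:R^-1)%:E * mu (F k) < +oo)%E.
  case: (mu (F k)) (measure_ge0 mu (F k)) => [r _ _||]//; first by rewrite ltry.
  by rewrite gt0_muley ?lte_fin.
rewrite -integral_cst//; apply: le_lt_trans growth.
have mw : measurable_fun setT (fun t : 'rV[R]_n => (cauchy_weight t)%:E).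
  by apply/measurable_EFinP; exact: measurable_cauchy_weight.
apply: (@le_trans _ _ (\int[mu]_(t in F k) (cauchy_weight t)%:E)%E).
  apply: ge0_le_integral => //.
  - by move=> t _; rewrite lee_fin ltW.
  - exact: (measurable_funS measurableT (@subsetT _ _) mw).
apply: ge0_subset_integral => //.
by move=> t _; rewrite lee_fin cauchy_weight_ge0.
Qed.

(* Carries the sigma-finite structure on [mu] that the Fubini theorem requires. *)
Definition sigma_finite_copy (R : realType) (n : nat)
    (mu : {measure set 'rV[R]_n -> \bar R}) (sf : sigma_finite setT mu) :
  set 'rV[R]_n -> \bar R := mu.

HB.instance Definition _ (R : realType) (n : nat)
    (mu : {measure set 'rV[R]_n -> \bar R}) (sf : sigma_finite setT mu) :=
  isMeasure.Build _ _ _ (sigma_finite_copy sf) (measure0 mu) (measure_ge0 mu)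
    (@measure_semi_sigma_additive _ _ _ mu).

HB.instance Definition _ (R : realType) (n : nat)
    (mu : {measure set 'rV[R]_n -> \bar R}) (sf : sigma_finite setT mu) :=
  @Measure_isSigmaFinite.Build _ _ _ (sigma_finite_copy sf) sf.

(** * Quadrants and the support criterion *)

Section quadrant.
Context (R : realType) (n : nat) (mu : {sigma_finite_measure set 'rV[R]_n -> \bar R}).
Hypothesis growth : growth_condition mu.

Definition quadrant (j1 j2 : 'I_n) : set 'rV[R]_n := [set x | 0 < x 0 j1 /\ x 0 j2 < 0].

Lemma open_quadrant j1 j2 : open (quadrant j1 j2).
Proof.
rewrite (_ : quadrant j1 j2 = (fun x : 'rV[R]_n => x 0 j1) @^-1` [set y | 0 < y] `&`
  (fun x : 'rV[R]_n => x 0 j2) @^-1` [set y | y < 0])//.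
apply: openI; apply: open_comp; [|exact: open_gt| |exact: open_lt] => x _;
  exact: coord_continuous.
Qed.

(** After Fubini the integrand in x vanishes pointwise: [phi] is 0 off the quadrant, and [reg k]
    annihilates the plane waves on it. The decay of [fourier phi] dominates the removal of
    [reg k]. *)
Lemma fourier_null_on_quadrant j1 j2 : approximate_unit mu j1 j2 ->
  fourier_null_on mu (quadrant j1 j2).
Proof.
move=> [reg [ireg reg1 regB reg0]] phi tphi phiQ.
have bphi := test_function_cube_bounded tphi.
have [C _ phiC] := fourier_decay tphi.
apply: (@cintegral_lim0 _ _ _ _ (fun k t => fourier phi t * reg k t) _
  (fun t => C * cauchy_weight t)).
- by move=> k; apply: cmeasurableM; [exact: measurable_fourier|have [] := ireg k].
- exact: (integrableZl _ C (integrable_cauchy_weight growth)).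
- move=> k t; rewrite normcM -[leRHS]mulr1.
  by apply: ler_pM; rewrite ?normc_ge0.
- move=> t; have [K tK] := regB t.
  apply: (@squeeze_cvg0 _ _ (normc (fourier phi t) * K)) => k.
  rewrite [X in normc X](_ : _ = fourier phi t * (reg k t - 1)); last first.
    by rewrite mulrBr mulr1.
  by rewrite normc_ge0 andTb normcM -mulrA ler_wpM2l ?normc_ge0.
- move=> k; rewrite fourier_Fubini// (_ : (fun x => _) = fun=> 0) ?cintegral0//.
  apply/funext => x.
  have [/phiQ[x1 x2]|/fsupportP ->] := pselect (fsupport phi x); last by rewrite mul0r.
  by rewrite reg0 ?mulr0.
Qed.

Lemma nevanlinna_support :
  nevanlinna_condition mu <->
  distribution_support (fourier_distribution (measure_distribution mu)) `<=`
    [set xi : 'rV[R]_n | forall j, 0 <= xi 0 j] `|`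
    [set xi : 'rV[R]_n | forall j, xi 0 j <= 0].
Proof.
split=> [nev x sx|supp z z0 j1 j2 j12].
  apply: contrapT => /not_orP[/existsNP[j2 /negP x2] /existsNP[j1 /negP x1]].
  move: x1 x2; rewrite -!ltNge => x1 x2; apply: sx.
  exists (quadrant j1 j2) => //; split; first exact: open_quadrant.
  apply: fourier_null_on_quadrant.
  (* The Nevanlinna condition orders its two indices, whereas the positive and the negative
     coordinate of x may come in either order; conjugation supplies the second case. *)
  have [j12|j12|j12] := ltngtP j1 j2.
  - apply: nevanlinna_approximate_unit => // [|z z0]; last exact: nev.
    by rewrite -val_eqE /= ltn_eqF.
  - apply: approximate_unit_sym.
    apply: nevanlinna_approximate_unit => // [|z z0]; last exact: nev.
    by rewrite -val_eqE /= ltn_eqF.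
  - by move: x1; rewrite (val_inj j12) => /(lt_trans x2); rewrite ltxx.
apply: nevanlinna_of_locally_null => //; first by rewrite -val_eqE /= ltn_eqF.
move=> x x1 x2; apply: contrapT => hU.
have /supp : distribution_support (fourier_distribution (measure_distribution mu)) x.
  by move=> [U [oU nullU] Ux]; apply: hU; exists U.
by case=> [/(_ j2)|/(_ j1)]; rewrite leNgt ?x1 ?x2.
Qed.

End quadrant.

Theorem theorem3p2 (R : realType) (n : nat) (hn : (2 <= n)%N)
    (mu : {measure set 'rV[R]_n -> \bar R}) (hmu : growth_condition mu) :
  nevanlinna_measure mu <->
  distribution_support (fourier_distribution (measure_distribution mu)) `<=`
    [set xi : 'rV[R]_n | forall j, 0 <= xi 0 j] `|`
    [set xi : 'rV[R]_n | forall j, xi 0 j <= 0].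
Proof.
have sf := growth_sigma_finite hmu.
have [nev_supp supp_nev] := @nevanlinna_support R n (sigma_finite_copy sf) hmu.
by split=> [[_ /nev_supp]//|/supp_nev ?]; split.
Qed.
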